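(* Let $\mathcal B$ be the Basilica, $T(\mathcal B)$ its tree with the canonical cyclic orders on the sets $\mathrm{edge}(v)$, and let $\Pi:\mathrm{Homeo}(\mathcal B)\to \mathrm{Aut}(T(\mathcal B))$ be the canonical homomorphism (all as defined in the context). Then: a) $\Pi$ is an isomorphism of topological groups $\mathrm{Homeo}(\mathcal B)\simeq \mathrm{Aut}(T(\mathcal B))$. b) $\Pi$ restricts to an isomorphism of topological groups $\mathrm{Homeo}_+(\mathcal B)\simeq \mathrm{Aut}_+(T(\mathcal B))$. c) The Basilica Thompson group $\mathrm{Th}(\mathcal B)$ (more precisely, its image $\Pi(\mathrm{Th}(\mathcal B))$) is dense in $\mathrm{Aut}_+(T(\mathcal B))$.
   Context: **The Basilica.** Let $S=\mathbb R/2\mathbb Z$. The Basilica $\mathcal B$ is the quotient topological space of $S$ by the equivalence relation $\frac{3k+1}{3^n}\sim\frac{3k+2}{3^n}$ for all nonnegative integers $k,n$ (in particular $1\sim 2=0$). It is compact and metrizable, and each nontrivial equivalence class has exactly two points. A separating point of $\mathcal B$ is a point corresponding to a nontrivial (two-point) class. **Leafs and Cantorgons.** Regard $S$ as the boundary circle of a disk $D$. For each nontrivial class $\{a,b\}$ draw the chord $[a\text{---}b]$ of $D$, called a leaf; different leafs are disjoint. Let $L(\mathcal B)$ be the set of all leafs. The leafs divide the disk into domains called Cantorgons. Each Cantorgon $C$ has countably many sides (leafs in its boundary), and the intersection of (the closure of) $C$ with $S$ is a Cantor set. The set of sides of a Cantorgon carries a canonical cyclic order induced by the orientation of $S$; as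 a cyclically ordered set it is isomorphic to $\mathbb Q/\mathbb Z$. Contracting each side of $C$ to a point turns $C$ into a topological disk whose boundary $\eth(C)$ is a topological circle with a canonical orientation induced from $S$. The circle $\eth(C)$ embeds homeomorphically in $\mathcal B$ (its image is the image in $\mathcal B$ of the closure of $C$ intersected with $S$); this image is called a component of $\mathcal B$. Every homeomorphism of $\mathcal B$ sends components to components and separating points to separating points. **Homeomorphism groups.** $\mathrm{Homeo}(\mathcal B)$ is the group of all homeomorphisms of $\mathcal B$, with the topology of uniform convergence. $\mathrm{Homeo}_+(\mathcal B)$ is the subgroup of homeomorphisms that preserve orientation, i.e. that map each component to its image component in an orientation-preserving way. **The tree.** $T=T(\mathcal B)$ is the graph whose vertices are the Cantorgons and whose edges are the leafs; an edge contains a vertex if the leaf is a side of the Cantorgon. $T$ is a tree in which every vertex has countably infinite valence. For a vertex $v$, $\mathrm{edge}(v)$ denotes the set of edges incident to $v$, with the canonical cyclic order on the sides of the Cantorgon. An automorphism $g$ of the tree $T$ is orientation preserving if for each vertex $v$ the induced map $\mathrm{edge}(v)\to\mathrm{edge}(gv)$ preserves the cyclic order; it respects orientation if for each vertex $v$ this map either preserves or reverses the cyclic order (the choice may depend on $v$). $\mathrm{Aut}_+(T(\mathcal B))$ and $\mathrm{Aut}(T(\mathcal B))$ denote the groups of all orientation preserving, respectively orientation respecting, automorphisms of $T$. They are topologized by declaring the (pointwise) stabilizers of finite subtrees to be open subgroups, forming a base of neighbourhoods of the identity; they are Polish groups. **The homomorphism $\Pi$.** A homeomorphism of $\mathcal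 B$ permutes components (which correspond to Cantorgons, i.e. vertices of $T$) and separating points (which correspond to leafs, i.e. edges of $T$). This gives the homomorphism $\Pi:\mathrm{Homeo}(\mathcal B)\to\mathrm{Aut}(T(\mathcal B))$, which maps $\mathrm{Homeo}_+(\mathcal B)$ into $\mathrm{Aut}_+(T(\mathcal B))$. **The Basilica Thompson group.** A perfect diagram is a finite set of leafs obtained as follows. Start with the diameter $[0\text{---}1]$, which splits $S$ into two arcs (intervals). At each step choose one of the current intervals of $S$, divide it by two points $a,b$ into three parts with length ratios $1:1:1$, and add the chord $[a\text{---}b]$ (which is a leaf); stop after finitely many steps (possibly zero). The ends of the leafs are the vertices of the diagram, and the arcs of $S$ between neighbouring vertices are its intervals. Two perfect diagrams $\Delta_1,\Delta_2$ are isomorphic if there is an orientation-preserving continuous bijection identifying $\Delta_1$ with $\Delta_2$ (leafs to leafs); it determines a bijection of the vertices of the diagrams, which is extended to a homeomorphism $S\to S$ by mapping each interval of $\Delta_1$ linearly onto the corresponding interval of $\Delta_2$. All maps $S\to S$ obtained this way form a group $\mathrm{Th}(\mathcal B)$, the Basilica Thompson group. These maps respect the equivalence relation $\sim$, so they determine homeomorphisms of $\mathcal B$, and $\mathrm{Th}(\mathcal B)$ is regarded as a subgroup of $\mathrm{Homeo}_+(\mathcal B)$. *)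

(* Defs.v *)
From HB Require Import structures.
From mathcomp Require Import all_boot all_order all_algebra.
From mathcomp Require Import generic_quotient.
From mathcomp Require Import all_classical all_reals all_analysis.
From Stdlib Require Import Relation_Operators.

Set Implicit Arguments.
Unset Strict Implicit.
Unset Printing Implicit Defensive.

Import Order.TTheory GRing.Theory Num.Theory.
Import numFieldNormedType.Exports.

Local Open Scope classical_set_scope.
Local Open Scope quotient_scope.
Local Open Scope ring_scope.

(* Groups carrying a topology; the continuity of the operations is not part of
   the structure.  *)
#[short(type="topGroupCarrierType")]
HB.structure Definition TopGroupCarrier := {G of Topological G & Group G}.

Definition is_subgroup (G : topGroupCarrierType) (A : set G) : Prop :=
  A 1%g /\ forall x y : G, A x -> A y -> A (x * y^-1)%g.

(* [phi] restricts to an isomorphism of topological groups between the subgroups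
   [A] and [B], both with the subspace topology. *)
Definition topgroup_iso (G H : topGroupCarrierType) (A : set G) (B : set H)
    (phi : G -> H) : Prop :=
  [/\ is_subgroup A, is_subgroup B, set_bij A B phi,
      (forall x y : G, A x -> A y -> phi (x * y)%g = (phi x * phi y)%g) &
      {within A, continuous phi} /\
      exists psi : H -> G,
        [/\ {homo psi : y / B y >-> A y},
            (forall x, A x -> psi (phi x) = x),
            (forall y, B y -> phi (psi y) = y) &
            {within B, continuous psi}]].

Record homeo (X : topologicalType) := Homeo {
  homeo_fun :> X -> X;
  homeo_inv : X -> X;
  homeoK : cancel homeo_fun homeo_inv;
  homeoVK : cancel homeo_inv homeo_fun;
  homeo_cts : continuous homeo_fun;
  homeoV_cts : continuous homeo_inv }.

Section HomeoGroup.
Context {X : topologicalType}.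
Implicit Types f g h : homeo X.

Lemma homeo_eq f g : homeo_fun f =1 homeo_fun g -> f = g.
Proof.
case: f g => [f f' fK f'K fc f'c] [g g' gK g'K gc g'c] /= /funext fg.
subst g; have f'g' : f' = g' by apply/funext => x; rewrite -[x in LHS]g'K fK.
by subst g'; congr Homeo; exact: Prop_irrelevance.
Qed.

HB.instance Definition _ := gen_eqMixin (homeo X).
HB.instance Definition _ := gen_choiceMixin (homeo X).

Definition homeo_one : homeo X :=
  @Homeo X id id (fun=> erefl) (fun=> erefl)
    (fun x => @cvg_id _ (nbhs x)) (fun x => @cvg_id _ (nbhs x)).

Definition homeo_mul f g : homeo X :=
  @Homeo X (f \o g) (homeo_inv g \o homeo_inv f)
    (can_comp (@homeoK _ f) (@homeoK _ g)) (can_comp (@homeoVK _ g) (@homeoVK _ f))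
    (fun x => continuous_comp (@homeo_cts _ g x) (@homeo_cts _ f (g x)))
    (fun x => continuous_comp (@homeoV_cts _ f x)
                (@homeoV_cts _ g (homeo_inv f x))).

Definition homeo_opp f : homeo X :=
  @Homeo X (homeo_inv f) f (@homeoVK _ f) (@homeoK _ f)
    (@homeoV_cts _ f) (@homeo_cts _ f).

Fact homeo_mulA : associative homeo_mul.
Proof. by move=> f g h; exact: homeo_eq. Qed.
Fact homeo_mul1g : left_id homeo_one homeo_mul.
Proof. by move=> f; exact: homeo_eq. Qed.
Fact homeo_mulg1 : right_id homeo_one homeo_mul.
Proof. by move=> f; exact: homeo_eq. Qed.
Fact homeo_mulVg : left_inverse homeo_one homeo_opp homeo_mul.
Proof. by move=> f; apply: homeo_eq => x; exact: homeoK. Qed.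
Fact homeo_mulgV : right_inverse homeo_one homeo_opp homeo_mul.
Proof. by move=> f; apply: homeo_eq => x; exact: homeoVK. Qed.

HB.instance Definition _ := isGroup.Build (homeo X)
  homeo_mulA homeo_mul1g homeo_mulg1 homeo_mulVg homeo_mulgV.

(* The topology of uniform convergence on [homeo X] for a compact Hausdorff [X]:
   the entourages of the unique uniformity of such a space are the
   neighbourhoods of the diagonal.  By [open_homeo_metric] below, this is the
   topology of uniform convergence for any metric defining the topology of a
   compact [X], in particular for the Basilica by [basilica_compact]. *)
Definition entourage_diag (W : set (X * X)) : Prop :=
  forall x : X, nbhs (x, x) W.

Definition homeo_open (U : set (homeo X)) : Prop :=
  forall f, U f -> exists2 W, entourage_diag W &
    forall g, (forall x, W (f x, g x)) -> U g.

Fact homeo_openT : homeo_open setT.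
Proof. by move=> f _; exists setT => // x; exact: filterT. Qed.
Fact homeo_openI : setI_closed homeo_open.
Proof.
move=> U V oU oV f [/oU[W1 W1d W1U] /oV[W2 W2d W2V]].
exists (W1 `&` W2) => [x|g fgW]; first exact: filterI.
by split; [apply: W1U|apply: W2V] => x; have [] := fgW x.
Qed.
Fact homeo_open_bigU (I : Type) (F : I -> set (homeo X)) :
  (forall i, homeo_open (F i)) -> homeo_open (\bigcup_i F i).
Proof.
move=> oF f [i _ /oF[W Wd WF]]; exists W => // g fgW; exists i => //.
exact: WF.
Qed.

HB.instance Definition _ := isOpenTopological.Build (homeo X)
  homeo_openT homeo_openI homeo_open_bigU.

End HomeoGroup.

Definition metric_of_topology (R : realType) (X : topologicalType)
    (d : X -> X -> R) : Prop :=
  [/\ forall x y, d x y = 0 <-> x = y,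
      forall x y, d x y = d y x,
      forall x y z, d x z <= d x y + d y z &
      forall x A, nbhs x A <-> exists2 e, 0 < e & [set y | d x y < e] `<=` A].

Lemma open_homeo_metric (R : realType) (X : topologicalType)
    (d : X -> X -> R) (U : set (homeo X)) :
  compact [set: X] -> metric_of_topology d ->
  open U <-> forall f, U f -> exists2 e, 0 < e &
               forall g : homeo X, (forall x, d (f x) (g x) < e) -> U g.
Proof.
move=> cX [d0 dC dT dN]; rewrite (_ : open U = homeo_open U)//.
have dxx x : d x x = 0 by apply/d0.
split=> oU f /oU => [[W Wd WU]|[e e0 eU]]; last first.
  exists [set z | d z.1 z.2 < e]; last by move=> g; exact: eU.
  move=> x; have nB : nbhs x [set y | d x y < e / 2].
    by apply/dN; exists (e / 2) => //; rewrite divr_gt0.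
  exists ([set y | d x y < e / 2], [set y | d x y < e / 2]) => //= -[y z] /=.
  move=> [xy xz]; apply: le_lt_trans (dT _ x _) _.
  by rewrite dC [ltRHS]splitr ltrD.
pose P (e : R) (y : X) := forall z, d y z < e -> W (y, z).
have /(compact_near_coveringP _).1/(_ R (0^'+) P) := cX.
have PP (x : X) : [set: X] x -> \forall x' \near x & e \near 0^'+, P e x'.
  move=> _; have [[A B] /= [/dN[a a0 aA] /dN[b b0 bB]] ABW] := Wd x.
  pose e := Num.min a b; have e0 : 0 < e by rewrite lt_min a0.
  exists ([set y | d x y < e / 2], [set r | r < e / 2]) => /=.
    split; first by apply/dN; exists (e / 2) => //; rewrite divr_gt0.
    by apply: nbhs_right_lt; rewrite divr_gt0.
  move=> [y r] /= [xy re] z yz; apply: ABW; split => /=.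
    apply/aA/(lt_le_trans xy); apply: (@le_trans _ _ e).
      by rewrite ler_pdivrMr// ler_peMr ?ler1n// ltW.
    by rewrite /e ge_min lexx.
  apply/bB/(le_lt_trans (dT _ y _))/(@lt_le_trans _ _ e).
    by rewrite [ltRHS]splitr ltrD// (lt_trans yz).
  by rewrite /e ge_min lexx orbT.
move=> /(_ _ PP) nP.
near (0:R)^'+ => e; exists e => // g fge; apply: WU => x.
have /(_ (f x) I) : [set: X] `<=` P e by near: e; exact: nP.
exact.
Unshelve. all: by end_near. Qed.

Record cyc_graph := CycGraph {
  vertex : Type;
  edge : Type;
  incident : edge -> vertex -> Prop;
  edge_cyc : vertex -> edge -> edge -> edge -> Prop }.

Section CycPreserve.
Context {G : cyc_graph}.
Implicit Types (av : vertex G -> vertex G) (ae : edge G -> edge G).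

Definition cyc_preserving_at av ae (v : vertex G) : Prop :=
  forall e1 e2 e3, incident e1 v -> incident e2 v -> incident e3 v ->
    edge_cyc v e1 e2 e3 <-> edge_cyc (av v) (ae e1) (ae e2) (ae e3).

Definition cyc_reversing_at av ae (v : vertex G) : Prop :=
  forall e1 e2 e3, incident e1 v -> incident e2 v -> incident e3 v ->
    edge_cyc v e1 e2 e3 <-> edge_cyc (av v) (ae e3) (ae e2) (ae e1).

End CycPreserve.

(* Orientation respecting automorphisms. *)
Record cyc_aut (G : cyc_graph) := CycAut {
  aut_v : vertex G -> vertex G;
  aut_e : edge G -> edge G;
  aut_vV : vertex G -> vertex G;
  aut_eV : edge G -> edge G;
  aut_vK : cancel aut_v aut_vV;
  aut_vVK : cancel aut_vV aut_v;
  aut_eK : cancel aut_e aut_eV;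
  aut_eVK : cancel aut_eV aut_e;
  aut_incident : forall e v, incident (aut_e e) (aut_v v) <-> incident e v;
  aut_respects : forall v,
    cyc_preserving_at aut_v aut_e v \/ cyc_reversing_at aut_v aut_e v }.

Section CycAutGroup.
Context {G : cyc_graph}.
Implicit Types g h k : cyc_aut G.

Lemma cyc_aut_eq g h : aut_v g =1 aut_v h -> aut_e g =1 aut_e h -> g = h.
Proof.
case: g h => [gv ge gv' ge' gvK gvVK geK geVK gi gr].
case=> [hv he hv' he' hvK hvVK heK heVK hi hr] /= /funext vE /funext eE.
subst hv he.
have vE' : gv' = hv' by apply/funext => x; rewrite -[x in LHS]hvVK gvK.
have eE' : ge' = he' by apply/funext => x; rewrite -[x in LHS]heVK geK.
by subst hv' he'; congr CycAut; exact: Prop_irrelevance.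
Qed.

HB.instance Definition _ := gen_eqMixin (cyc_aut G).
HB.instance Definition _ := gen_choiceMixin (cyc_aut G).

Program Definition cyc_aut_one : cyc_aut G :=
  @CycAut G id id id id (fun=> erefl) (fun=> erefl) (fun=> erefl) (fun=> erefl)
    _ _.
Next Obligation. by []. Qed.
Next Obligation. by move=> v; left. Qed.

Program Definition cyc_aut_mul g h : cyc_aut G :=
  @CycAut G (aut_v g \o aut_v h) (aut_e g \o aut_e h)
    (aut_vV h \o aut_vV g) (aut_eV h \o aut_eV g)
    (can_comp (@aut_vK _ g) (@aut_vK _ h))
    (can_comp (@aut_vVK _ h) (@aut_vVK _ g))
    (can_comp (@aut_eK _ g) (@aut_eK _ h))
    (can_comp (@aut_eVK _ h) (@aut_eVK _ g)) _ _.
Next Obligation. by move=> g h e v /=; rewrite !aut_incident. Qed.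
Next Obligation.
move=> g h v; case: (aut_respects h v) => hP;
  case: (aut_respects g (aut_v h v)) => gP; [left|right|right|left];
  by move=> e1 e2 e3 i1 i2 i3; rewrite hP// gP// aut_incident.
Qed.

Program Definition cyc_aut_opp g : cyc_aut G :=
  @CycAut G (aut_vV g) (aut_eV g) (aut_v g) (aut_e g)
    (@aut_vVK _ g) (@aut_vK _ g) (@aut_eVK _ g) (@aut_eK _ g) _ _.
Next Obligation.
move=> g e v /=; have := aut_incident g (aut_eV g e) (aut_vV g v).
by rewrite aut_vVK aut_eVK => ->.
Qed.
Next Obligation.
move=> g v; have iV e : incident e v -> incident (aut_eV g e) (aut_vV g v).
  have := aut_incident g (aut_eV g e) (aut_vV g v).
  by rewrite aut_vVK aut_eVK => ->.
case: (aut_respects g (aut_vV g v)) => gP; [left|right];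
  by move=> e1 e2 e3 i1 i2 i3; rewrite gP ?aut_vVK ?aut_eVK//; exact: iV.
Qed.

Fact cyc_aut_mulA : associative cyc_aut_mul.
Proof. by move=> f g h; exact: cyc_aut_eq. Qed.
Fact cyc_aut_mul1g : left_id cyc_aut_one cyc_aut_mul.
Proof. by move=> f; exact: cyc_aut_eq. Qed.
Fact cyc_aut_mulg1 : right_id cyc_aut_one cyc_aut_mul.
Proof. by move=> f; exact: cyc_aut_eq. Qed.
Fact cyc_aut_mulVg : left_inverse cyc_aut_one cyc_aut_opp cyc_aut_mul.
Proof. by move=> f; apply: cyc_aut_eq => x; [exact: aut_vK|exact: aut_eK]. Qed.
Fact cyc_aut_mulgV : right_inverse cyc_aut_one cyc_aut_opp cyc_aut_mul.
Proof. by move=> f; apply: cyc_aut_eq => x; [exact: aut_vVK|exact: aut_eVK]. Qed.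

HB.instance Definition _ := isGroup.Build (cyc_aut G)
  cyc_aut_mulA cyc_aut_mul1g cyc_aut_mulg1 cyc_aut_mulVg cyc_aut_mulgV.

(* A connected subgraph; if [G] is a tree, this is a subtree. *)
Definition finite_subtree (V : set (vertex G)) (E : set (edge G)) : Prop :=
  [/\ finite_set V, finite_set E, V !=set0,
      (forall e v, E e -> incident e v -> V v) &
      forall u v, V u -> V v ->
        clos_refl_trans _
          (fun x y => exists e, [/\ E e, incident e x & incident e y]) u v].

Definition subtree_stabilizer (V : set (vertex G)) (E : set (edge G)) :
    set (cyc_aut G) :=
  [set g | (forall v, V v -> aut_v g v = v) /\ (forall e, E e -> aut_e g e = e)].

(* The left cosets of the stabilizers of finite subtrees are taken as a subbase;
   when [G] is a tree, any two finite subtrees lie in a third one and these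
   cosets form a base. *)
HB.instance Definition _ := isPointed.Build (cyc_aut G) 1%g.

Definition stabilizer_coset
    (i : cyc_aut G * (set (vertex G) * set (edge G))) : set (cyc_aut G) :=
  [set h | exists2 s, subtree_stabilizer i.2.1 i.2.2 s & h = (i.1 * s)%g].

HB.instance Definition _ := isSubBaseTopological.Build (cyc_aut G)
  [set i | finite_subtree i.2.1 i.2.2] stabilizer_coset.

End CycAutGroup.

Definition aut_plus (G : cyc_graph) : set (cyc_aut G) :=
  [set g | forall v, cyc_preserving_at (aut_v g) (aut_e g) v].

Section Circle.
Context {R : realType}.

Definition eq_mod2 (x y : R) : bool := (x - y) / 2 \is a Num.int.

Fact eq_mod2_refl : reflexive eq_mod2.
Proof. by move=> x; rewrite /eq_mod2 subrr mul0r rpred0. Qed.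
Fact eq_mod2_sym : symmetric eq_mod2.
Proof. by move=> x y; rewrite /eq_mod2 -opprB mulNr rpredN. Qed.
Fact eq_mod2_trans : transitive eq_mod2.
Proof.
move=> y x z; rewrite /eq_mod2 => xy yz.
by rewrite -(subrKA y) mulrDl rpredD.
Qed.

Canonical eq_mod2_equiv :=
  EquivRel eq_mod2 eq_mod2_refl eq_mod2_sym eq_mod2_trans.

End Circle.

Definition circle (R : realType) : Type :=
  quotient_topology {eq_quot (@eq_mod2_equiv R)}.
HB.instance Definition _ (R : realType) := Quotient.on (circle R).
HB.instance Definition _ (R : realType) := Topological.on (circle R).

Definition to_circle {R : realType} (t : R) : circle R := \pi_(circle R) t.

Section BasilicaRelation.
Context {R : realType}.

Definition basilica_step (x y : circle R) : Prop :=
  exists k n : nat, x = to_circle ((3 * k + 1)%N%:R / 3 ^+ n) /\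
                    y = to_circle ((3 * k + 2)%N%:R / 3 ^+ n).

Definition basilica_rel (x y : circle R) : bool :=
  `[< clos_refl_sym_trans (circle R) basilica_step x y >].

Fact basilica_rel_refl : reflexive basilica_rel.
Proof. by move=> x; apply/asboolP; exact: rst_refl. Qed.
Fact basilica_rel_sym : symmetric basilica_rel.
Proof.
by move=> x y; apply: asbool_equiv_eq; split; exact: rst_sym.
Qed.
Fact basilica_rel_trans : transitive basilica_rel.
Proof.
by move=> y x z /asboolP xy /asboolP yz; apply/asboolP; exact: rst_trans yz.
Qed.

Canonical basilica_equiv :=
  EquivRel basilica_rel basilica_rel_refl basilica_rel_sym basilica_rel_trans.

End BasilicaRelation.

Definition basilica (R : realType) : Type :=
  quotient_topology {eq_quot (@basilica_equiv R)}.
HB.instance Definition _ (R : realType) := Quotient.on (basilica R).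
HB.instance Definition _ (R : realType) := Topological.on (basilica R).

Definition to_basilica {R : realType} (x : circle R) : basilica R :=
  \pi_(basilica R) x.

Lemma to_circle_surj (R : realType) (x : circle R) :
  exists2 t, t \in `[0, 2]%classic & to_circle t = x.
Proof.
pose r := repr x; pose n := Num.floor (r / 2); exists (r - n%:~R * 2).
  rewrite inE /= in_itv /= subr_ge0 -ler_pdivlMr// floor_le /=.
  rewrite lerBlDl -[X in _ + X]mul1r -mulrDl -ler_pdivrMr//.
  by rewrite ltW// -intrD1 floorD1_gt.
rewrite -[RHS]reprK; apply/eqmodP => /=.
by rewrite /eq_mod2 addrAC subrr add0r mulNr mulfK// rpredN intr_int.
Qed.

Lemma basilica_compact (R : realType) : compact [set: basilica R].
Proof.
have -> : [set: basilica R] =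
    (to_basilica \o to_circle) @` `[0 : R, 2]%classic.
  apply/seteqP; split=> // y _; have [t] := to_circle_surj (repr y).
  by rewrite inE => t02 ty; exists t => //=; rewrite ty; exact: reprK.
apply: continuous_compact; last exact: segment_compact.
apply: continuous_subspaceT => t.
by apply: continuous_comp; exact: pi_continuous.
Qed.

(* Positive (counterclockwise) cyclic order of three distinct points. *)
Definition circle_cyc {R : realType} (x y z : circle R) : Prop :=
  exists a b c : R, [/\ x = to_circle a, y = to_circle b, z = to_circle c &
                        [/\ a < b, b < c & c < a + 2]].

Section Lamination.
Context {R : realType}.

(* The circle as the boundary of the unit disk of the plane. *)
Definition plane_point (x : circle R) : R * R :=
  (cos (pi * repr x), sin (pi * repr x)).

Definition open_disk : set (R * R) := [set z | z.1 ^+ 2 + z.2 ^+ 2 < 1].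

(* A leaf is given by its pair of ends, a nontrivial class of [basilica_rel]. *)
Definition is_leaf (l : set (circle R)) : Prop :=
  exists x y, [/\ l = [set z | basilica_rel x z], l y & y <> x].

Definition leaf : Type := {l : set (circle R) | is_leaf l}.

Definition leaf_ends (l : leaf) : set (circle R) := sval l.

Definition chord (l : leaf) : set (R * R) :=
  [set z | exists x y (t : R), [/\ leaf_ends l x, leaf_ends l y, 0 <= t <= 1 &
     z = ((1 - t) * (plane_point x).1 + t * (plane_point y).1,
          (1 - t) * (plane_point x).2 + t * (plane_point y).2)]].

Definition cut_disk : set (R * R) :=
  open_disk `\` \bigcup_(l in [set: leaf]) chord l.

Definition is_cantorgon (C : set (R * R)) : Prop :=
  exists2 z, cut_disk z & C = connected_component cut_disk z.

Definition cantorgon : Type := {C : set (R * R) | is_cantorgon C}.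

Definition cantorgon_set (C : cantorgon) : set (R * R) := sval C.

(* No chord meets a Cantorgon, hence the condition says that the chord lies in
   the boundary of [C]. *)
Definition is_side (l : leaf) (C : cantorgon) : Prop :=
  chord l `<=` closure (cantorgon_set C).

(* The choice of the ends is immaterial: the ends of a side of [C] are not
   separated on the circle by the ends of the other sides of [C]. *)
Definition side_cyc (C : cantorgon) (l1 l2 l3 : leaf) : Prop :=
  [/\ is_side l1 C, is_side l2 C, is_side l3 C,
      [/\ l1 <> l2, l2 <> l3 & l1 <> l3] &
      exists x1 x2 x3, [/\ leaf_ends l1 x1, leaf_ends l2 x2, leaf_ends l3 x3 &
                           circle_cyc x1 x2 x3]].

(* The points of the circle in the closure of a Cantorgon (a Cantor set). *)
Definition cantorgon_ideal (C : cantorgon) : set (circle R) :=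
  [set x | closure (cantorgon_set C) (plane_point x)].

Definition component (C : cantorgon) : set (basilica R) :=
  to_basilica @` cantorgon_ideal C.

(* The cyclic order of the oriented circle [component C]. *)
Definition component_cyc (C : cantorgon) (p q r : basilica R) : Prop :=
  [/\ p <> q, q <> r, p <> r &
      exists x y z, [/\ cantorgon_ideal C x, cantorgon_ideal C y,
                        cantorgon_ideal C z &
        [/\ p = to_basilica x, q = to_basilica y, r = to_basilica z &
            circle_cyc x y z]]].

End Lamination.

Definition basilica_tree (R : realType) : cyc_graph :=
  @CycGraph (@cantorgon R) (@leaf R) (@is_side R) (@side_cyc R).

Definition homeo_plus (R : realType) : set (homeo (basilica R)) :=
  [set f | forall C : @cantorgon R, exists C' : @cantorgon R,
     f @` component C = component C' /\
     forall p q r, component C p -> component C q -> component C r ->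
       component_cyc C p q r <-> component_cyc C' (f p) (f q) (f r)].

(* [g] is the action of [f] on the components and on the separating points;
   the separating point of a leaf [l] is the image of its ends. *)
Definition induces {R : realType} (f : homeo (basilica R))
    (g : cyc_aut (basilica_tree R)) : Prop :=
  (forall C : @cantorgon R, f @` component C = component (aut_v g C)) /\
  (forall l : @leaf R,
     f @` (to_basilica @` leaf_ends l) = to_basilica @` leaf_ends (aut_e g l)).

(* [perfect_diagram D I]: [D] is a perfect diagram (leafs given by their ends)
   and [I] is the set of its intervals; the pair [(u, v)] stands for the arc
   swept from [u] to [v], where 0 <= u < v <= 2. *)
Inductive perfect_diagram (R : realType) :
    set (set (circle R)) -> set (R * R) -> Prop :=
| perfect_start :
    perfect_diagram [set [set to_circle 0; to_circle 1]] [set (0, 1); (1, 2)]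
| perfect_step D I (u v a b : R) :
    perfect_diagram D I -> I (u, v) ->
    a = u + (v - u) / 3 -> b = u + 2 * (v - u) / 3 ->
    perfect_diagram (D `|` [set [set to_circle a; to_circle b]])
      ((I `\ (u, v)) `|` [set (u, a); (a, b); (b, v)]).

Definition diagram_iso (R : realType) (D1 D2 : set (set (circle R)))
    (phi : circle R -> circle R) : Prop :=
  [/\ continuous phi, bijective phi,
      (forall x y z, circle_cyc x y z -> circle_cyc (phi x) (phi y) (phi z)) &
      [set phi @` l | l in D1] = D2].

Definition thompson_map (R : realType) (h : circle R -> circle R) : Prop :=
  exists D1 I1 D2 I2 phi,
    [/\ perfect_diagram D1 I1, perfect_diagram D2 I2, diagram_iso D1 D2 phi &
        forall u v, I1 (u, v) -> exists u' v',
          [/\ I2 (u', v'), phi (to_circle u) = to_circle u',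
              phi (to_circle v) = to_circle v' &
              forall t : R, 0 <= t <= 1 ->
                h (to_circle (u + t * (v - u))) =
                to_circle (u' + t * (v' - u'))]].

Definition basilica_thompson (R : realType) : set (homeo (basilica R)) :=
  [set f | exists2 h : circle R -> circle R, thompson_map h &
     forall x, f (to_basilica x) = to_basilica (h x)].

(* Main.v *)
From HB Require Import structures.
Require Import Defs.
From mathcomp Require Import all_boot all_order all_algebra.
From mathcomp Require Import generic_quotient finmap.
From mathcomp Require Import all_classical all_reals all_analysis.
From mathcomp Require Import zify ring lra.
From Stdlib Require Import Relation_Operators.

(* Removing the point of a leaf disconnects the Basilica, and nothing else does.
   Which points are separated by which leaf determines the tree: two leafs are
   sides of a common Cantorgon iff no third leaf separates them, and the cyclic
   order on a component is determined, up to orientation, by the pairs of its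
   points that separate two others.  Hence a homeomorphism acts on the tree.
   Conversely, an automorphism carries the arcs of the circle bounded by ends of
   two unseparated leafs to arcs of the same kind; such arcs shrink to the points
   of the Basilica, which extends the action on the leafs to a homeomorphism.

   Density is shown along the construction of perfect diagrams.  Suppose that a
   Thompson map agrees with [g] on the leafs of a diagram, and let [m] be the leaf
   added in an interval [J].  Up to that map, [g] fixes the leafs of the diagram
   and moves [m] to a leaf [q] in [J] that no leaf in [J] separates from the
   diagram; a product of generators of Thompson's group in base 3, rescaled to
   triadic subintervals of [J], carries [m] to [q] as well. *)

Set Implicit Arguments.
Unset Strict Implicit.
Unset Printing Implicit Defensive.

Import Order.TTheory GRing.Theory Num.Theory.
Import numFieldNormedType.Exports.

Local Open Scope classical_set_scope.
Local Open Scope quotient_scope.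
Local Open Scope ring_scope.

(** * Triadic points and leafs *)

Section Triadic.
Context {R : realType}.
Implicit Types (s t : R) (x y : circle R) (n j k : nat).

(** Cutting the circle at 0 gives each leaf an inner and an outer side ([inl]), but an automorphism
    may exchange the two. What it transports is lying on the same side of a leaf as a given
    Cantorgon, so statements about images are made relative to a Cantorgon ([aut_sd]). Likewise,
    orientation may be kept at one Cantorgon and reversed at the next; an arc is therefore
    transported together with the unordered pair of its boundary leafs and the set of leafs inside
    it ([aut_arc]). These arcs contain both ends of a leaf or none, which makes their images in the
    Basilica open. Plane geometry serves to identify a Cantorgon with its choice of a side for every
    leaf. An inner point of a Cantorgon has positive distance from the circle and short leafs cut
    off thin caps, whence only finitely many leafs separate a Cantorgon from a leaf; induction on
    their number replaces induction along paths in the tree. In the density argument, preservation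
    of orientation ensures that an automorphism fixing two unseparated leafs does not exchange the
    two arcs between them. *)

Lemma to_circleE s t : to_circle s = to_circle t <-> exists k : int, s = t + 2 * k%:~R.
Proof.
split=> [/eqmodP/= /intrP[k kE]|[k ->]].
  by exists k; move: kE => /(congr1 (fun z => z * 2)); rewrite mulfVK//; lra.
apply/eqmodP => /=; rewrite /eq_mod2.
by rewrite [X in X / 2](_ : _ = k%:~R * 2) ?mulfK ?intr_int//; lra.
Qed.

Lemma to_circleD2 t (k : int) : to_circle (t + 2 * k%:~R) = to_circle t.
Proof. by apply/to_circleE; exists k. Qed.

Lemma int_lt2_eq0 (k : int) : `|2 * k%:~R : R| < 2 -> k = 0.
Proof.
rewrite normrM ger0_norm// -[ltRHS]mulr1 ltr_pM2l// -intr_norm -[1]/(1%:~R) ltr_int.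
lia.
Qed.

Lemma to_circle_near s t : `|s - t| < 2 -> to_circle s = to_circle t -> s = t.
Proof.
move=> st /to_circleE[k sE]; have k0 : k = 0.
  by apply: int_lt2_eq0; move: st; rewrite sE addrAC subrr add0r.
by rewrite sE k0 mulr0 addr0.
Qed.

Lemma to_circle_inj s t : 0 < s <= 2 -> 0 < t <= 2 ->
  to_circle s = to_circle t -> s = t.
Proof. by move=> s02 t02; apply: to_circle_near; rewrite ltr_norml; lra. Qed.

Fact crd_exists x : exists t, 0 < t <= 2 /\ to_circle t = x.
Proof.
have [t /[!inE]/=/[!in_itv]/= t02 <-] := to_circle_surj x.
have [->|t0] := eqVneq t 0; last first.
  by exists t; split=> //; rewrite lt0r t0; exact: t02.
exists 2; split; first by lra.
by apply/to_circleE; exists 1; rewrite add0r mulr1.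
Qed.

(** Coordinates are taken in (0,2], so the point 0 has coordinate 2 and the root leaf, like every
    other leaf, has ends [la < lb] in this interval. *)
Definition crd x : R := projT1 (cid (crd_exists x)).

Lemma crd_itv x : 0 < crd x <= 2.
Proof. by rewrite /crd; case: cid => t /= []. Qed.

Lemma crdK x : to_circle (crd x) = x.
Proof. by rewrite /crd; case: cid => t /= []. Qed.

Lemma to_circleK t : 0 < t <= 2 -> crd (to_circle t) = t.
Proof. by move=> t02; apply: to_circle_inj (crdK _) => //; exact: crd_itv. Qed.

Definition tri n j : R := j%:R / 3 ^+ n.

Lemma pow3_gt0 n : 0 < 3 ^+ n :> R. Proof. by rewrite exprn_gt0. Qed.

Lemma le_tri n j m k : (tri n j <= tri m k) = (j * 3 ^ m <= k * 3 ^ n)%N.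
Proof.
rewrite /tri ler_pdivrMr ?pow3_gt0// mulrAC ler_pdivlMr ?pow3_gt0//.
by rewrite -!natrX -!natrM ler_nat.
Qed.

Lemma lt_tri n j m k : (tri n j < tri m k) = (j * 3 ^ m < k * 3 ^ n)%N.
Proof. by rewrite ltNge le_tri -ltnNge. Qed.

Lemma eq_tri n j m k : (tri n j == tri m k) = (j * 3 ^ m == k * 3 ^ n)%N.
Proof. by rewrite eq_le !le_tri eqn_leq. Qed.

Lemma triS n j : tri n j = tri n.+1 (3 * j).
Proof. by apply/eqP; rewrite eq_tri expnS; lia. Qed.

Lemma lt_triE n i j : (tri n i < tri n j) = (i < j)%N.
Proof. by rewrite lt_tri ltn_pmul2r ?expn_gt0. Qed.

Lemma le_triE n i j : (tri n i <= tri n j) = (i <= j)%N.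
Proof. by rewrite le_tri leq_pmul2r ?expn_gt0. Qed.

Lemma tri_lift d n j : tri n j = tri (d + n) (j * 3 ^ d).
Proof. by apply/eqP; rewrite eq_tri expnD mulnA. Qed.

Lemma tri_ge0 n j : 0 <= tri n j.
Proof. by rewrite divr_ge0// ltW// pow3_gt0. Qed.

Lemma tri_le2 n j : (tri n j <= 2) = (j <= 2 * 3 ^ n)%N.
Proof. by rewrite -[2](_ : tri 0 2 = _) ?le_tri ?muln1// /tri expr0 divr1. Qed.

Lemma tri_gt0 n j : (0 < tri n j) = (0 < j)%N.
Proof. by rewrite -[0](_ : tri 0 0 = _) ?lt_tri ?mul0n ?muln1// /tri mul0r. Qed.

(* The ends of a leaf of level [m] are interior to a triadic interval of level
   [m - 1], and points of lower level are not. *)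
Lemma tri_outside p j m i : (p < m)%N ->
  tri p j < tri m (3 * i + 1) \/ tri m (3 * i + 2) < tri p j.
Proof.
case: m => // m; rewrite ltnS => pm; rewrite !lt_tri.
have [d ->] : exists d, m = (d + p)%N by exists (m - p)%N; rewrite subnK.
rewrite expnS expnD !mulnA -(mulnA _ 3) [(3 * _)%N]mulnC !mulnA !ltn_pmul2r ?expn_gt0//.
by have [|] := leqP (j * 3 ^ d) i; [left|right]; lia.
Qed.

End Triadic.

Section Leafs.
Context {R : realType}.
Implicit Types (s t : R) (x y : circle R) (n j k : nat).

(** [k] is confined to one turn of the circle, so that distinct codes give distinct leafs; level 0
    has the single code [k = 0]. *)
Definition is_code n k := (3 * k + 2 <= 2 * 3 ^ n)%N.

Lemma tri_code n k : is_code n k ->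
  [/\ 0 < (tri n (3 * k + 1) : R), tri n (3 * k + 1) < tri n (3 * k + 2) :> R &
      (tri n (3 * k + 2) : R) <= 2].
Proof.
rewrite /is_code => nk; rewrite tri_gt0 tri_le2 lt_tri ltn_pmul2r ?expn_gt0//.
by split; rewrite ?nk//; lia.
Qed.

Lemma code_end_itv n k e : is_code n k -> (0 < e <= 2)%N ->
  0 < (tri n (3 * k + e) : R) <= 2.
Proof. by rewrite /is_code tri_gt0 tri_le2; lia. Qed.

(** The numerators are prime to 3, so the fractions are in lowest terms; for distinct levels this is
    drawn from [tri_outside]. *)
Lemma code_end_inj n k e m i e' : (0 < e <= 2)%N -> (0 < e' <= 2)%N ->
  tri n (3 * k + e) = tri m (3 * i + e') :> R -> [/\ n = m, k = i & e = e'].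
Proof.
wlog nm : n k e m i e' / (n <= m)%N => [H e12 e'12|e12 e'12 kiE].
  have [|/ltnW] := leqP n m => [|nm] kiE; first exact: H.
  by have [] := H _ _ _ _ _ _ nm e'12 e12 (esym kiE).
have [nm'|] := ltnP n m; last first.
  move=> mn; have nmE : n = m by apply/eqP; rewrite eqn_leq nm.
  subst m; move/eqP: kiE; rewrite eq_tri eqn_pmul2r ?expn_gt0// => /eqP kiE.
  by split=> //; lia.
have := @tri_outside R n (3 * k + e) m i nm'.
by rewrite kiE !lt_tri !ltn_pmul2r ?expn_gt0//; lia.
Qed.

Definition code_pair x y := exists n k,
  [/\ is_code n k, x = to_circle (tri n (3 * k + 1)) &
                   y = to_circle (tri n (3 * k + 2))].

Lemma step_code_pair x y : basilica_step x y -> code_pair x y \/ code_pair y x.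
Proof.
move=> [k [n [-> ->]]].
have shift c q e r : (3 * k + e = c * q * 2 + r)%N -> c = (3 ^ n)%N ->
    to_circle ((3 * k + e)%N%:R / 3 ^+ n) = to_circle (tri n r) :> circle R.
  move=> kE cE; apply/to_circleE; exists q; rewrite kE cE /tri natrD mulrDl addrC.
  congr (_ + _); rewrite !natrM natrX -pmulrn; field.
  by rewrite gt_eqF ?pow3_gt0.
case: n shift => [|n] shift.
  (* At level 0 the ends are integers; for odd [k] the first is even and the second odd, so the pair
     is the root leaf with its ends exchanged. *)
  have kE := divn_eq k 2; have := @ltn_pmod k 2 isT.
  rewrite /code_pair; case: (k %% 2)%N kE => [|[|//]] kE _; [left|right];
    exists 0%N, 0%N; split=> //.
  - by apply: (shift 1%N (k %/ 2 * 3)%N) => //; lia.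
  - by apply: (shift 1%N (k %/ 2 * 3)%N) => //; lia.
  - by apply: (shift 1%N (k %/ 2 * 3 + 2)%N) => //; lia.
  - rewrite (shift 1%N (k %/ 2 * 3 + 1)%N 1%N 2%N)//; first by lia.
have n0 : (0 < 2 * 3 ^ n)%N by rewrite muln_gt0 expn_gt0.
have kE := divn_eq k (2 * 3 ^ n); have klt := ltn_pmod k n0.
left; exists n.+1, (k %% (2 * 3 ^ n))%N; split.
- by rewrite /is_code expnS; lia.
- by apply: (shift (3 ^ n.+1)%N (k %/ (2 * 3 ^ n))%N) => //; rewrite expnS; lia.
- by apply: (shift (3 ^ n.+1)%N (k %/ (2 * 3 ^ n))%N) => //; rewrite expnS; lia.
Qed.

Lemma code_pair_step x y : code_pair x y -> basilica_step x y.
Proof. by move=> [n [k [_ -> ->]]]; exists k, n. Qed.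

Lemma code_pair_fun x y z : code_pair x y -> code_pair x z -> y = z.
Proof.
move=> [n [k [nk -> ->]]] [m [i [mi /to_circle_inj + ->]]] => E.
by have [-> -> _] := code_end_inj (e:=1%N) (e':=1%N) isT isT (E (code_end_itv nk (e:=1%N) isT) (code_end_itv mi (e:=1%N) isT)).
Qed.

Lemma code_pair_funV x y z : code_pair y x -> code_pair z x -> y = z.
Proof.
move=> [n [k [nk -> ->]]] [m [i [mi -> /to_circle_inj]]] => E.
by have [-> -> _] := code_end_inj (e:=2%N) (e':=2%N) isT isT (E (code_end_itv nk (e:=2%N) isT) (code_end_itv mi (e:=2%N) isT)).
Qed.

Lemma code_pair_chain x y z : code_pair x y -> ~ code_pair y z.
Proof.
move=> [n [k [nk _ ->]]] [m [i [mi /to_circle_inj + _]]] => E.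
by have [] := code_end_inj (e:=2%N) (e':=1%N) isT isT (E (code_end_itv nk (e:=2%N) isT) (code_end_itv mi (e:=1%N) isT)).
Qed.

(** By uniqueness of codes a point is an end of at most one pair, so the closure adds to the
    generating pairs nothing but reflexivity and symmetry. *)
Lemma basilica_relP x y :
  basilica_rel x y <-> [\/ x = y, code_pair x y | code_pair y x].
Proof.
split=> [/asboolP|[->|xy|yx]]; last 3 first.
- exact: basilica_rel_refl.
- by apply/asboolP/rst_step/code_pair_step.
- by apply/asboolP/rst_sym/rst_step/code_pair_step.
elim=> {x y} [x y /step_code_pair|x|x y _|x y z _ xy _ yz]; first by case; constructor.
- by constructor.
- by case; constructor.
case: xy yz => [->//|xy|yx] [<-|yz|zy].
- exact: Or32.
- by have := code_pair_chain xy yz.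
- by constructor; exact: code_pair_funV xy zy.
- exact: Or33.
- by constructor; exact: code_pair_fun yx yz.
- by have := code_pair_chain zy yx.
Qed.

Lemma to_basilicaE x y : to_basilica x = to_basilica y <-> basilica_rel x y.
Proof. by split=> [/eqmodP|xy]; last exact/eqmodP. Qed.

Lemma code_leafP n k : is_code n k ->
  is_leaf [set to_circle (tri n (3 * k + 1)); to_circle (tri n (3 * k + 2)) : circle R].
Proof.
move=> nk; set a := to_circle _; set b := to_circle _.
have ab : code_pair a b by exists n, k.
exists a, b; split; [|by right|]; last first.
  by move=> ba; rewrite ba in ab; exact: (code_pair_chain ab ab).
apply/seteqP; split=> [z [->|->]|z] /=.
- exact: basilica_rel_refl.
- by apply/basilica_relP; exact: Or32.
- move/basilica_relP => [<-|az|za]; [by left| |by have := code_pair_chain za ab].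
  by right; exact: code_pair_fun az ab.
Qed.

Lemma leaf_codeP (l : @leaf R) : exists n k, is_code n k /\
  leaf_ends l = [set to_circle (tri n (3 * k + 1)); to_circle (tri n (3 * k + 2))].
Proof.
case: l => A lA; rewrite /leaf_ends /=; have [x [y [-> xy yx]]] := lA.
have {}xy : code_pair x y \/ code_pair y x.
  move: xy => /= /basilica_relP[/esym//| |]; by [left|right].
have : exists u v, code_pair u v /\ (u = x \/ v = x).
  by case: xy => ?; [exists x, y|exists y, x]; split=> //; [left|right].
move=> [u [v [[n [k [nk uE vE]]] uvx]]]; exists n, k; split=> //.
rewrite -uE -vE; have uv : code_pair u v by exists n, k.
apply/seteqP; split=> z /=; case: uvx => <-.
- move=> /basilica_relP[->|?|zu]; [by left| |by have := code_pair_chain zu uv].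
  by right; exact: code_pair_fun uv.
- move=> /basilica_relP[->|vz|?]; [by right|by have := code_pair_chain uv vz|].
  by left; exact: code_pair_funV uv.
- by move=> [->|->]; apply/basilica_relP; [exact: Or31|exact: Or32].
- by move=> [->|->]; apply/basilica_relP; [exact: Or33|exact: Or31].
Qed.

Definition lv (l : @leaf R) : nat := projT1 (cid (leaf_codeP l)).
Definition lk (l : @leaf R) : nat := projT1 (cid (projT2 (cid (leaf_codeP l)))).
Definition la (l : @leaf R) : R := tri (lv l) (3 * lk l + 1).
Definition lb (l : @leaf R) : R := tri (lv l) (3 * lk l + 2).

Lemma leaf_codeE l : is_code (lv l) (lk l) /\
  leaf_ends l = [set to_circle (la l); to_circle (lb l)].
Proof. by rewrite /la /lb /lv /lk; case: cid => n /= h; case: cid => k /= []. Qed.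

Lemma leaf_code l : is_code (lv l) (lk l). Proof. by have [] := leaf_codeE l. Qed.

Lemma leaf_endsE l x : leaf_ends l x <-> x = to_circle (la l) \/ x = to_circle (lb l).
Proof. by have [_ ->] := leaf_codeE l. Qed.

Lemma leaf_ltW l : [/\ 0 < la l, la l < lb l & lb l <= 2].
Proof. exact/tri_code/leaf_code. Qed.

Lemma leaf_eq (l m : @leaf R) : leaf_ends l = leaf_ends m -> l = m.
Proof. by case: l m => A lA [B lB] /= AB; exact: eq_exist. Qed.

Lemma leaf_code_inj l m : lv l = lv m -> lk l = lk m -> l = m.
Proof.
move=> nE kE; apply: leaf_eq; have [_ ->] := leaf_codeE l; have [_ ->] := leaf_codeE m.
by rewrite /la /lb nE kE.
Qed.

Definition mkleaf n k (nk : is_code n k) : @leaf R := exist _ _ (code_leafP nk).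

Lemma mkleafE n k (nk : is_code n k) : [/\ lv (mkleaf nk) = n, lk (mkleaf nk) = k,
  la (mkleaf nk) = tri n (3 * k + 1) & lb (mkleaf nk) = tri n (3 * k + 2)].
Proof.
set l := mkleaf nk.
have : leaf_ends l (to_circle (la l)) by apply/leaf_endsE; left.
rewrite {1}/leaf_ends/= => laE.
suff [nE kE] : lv l = n /\ lk l = k by rewrite /la /lb nE kE.
have L := leaf_code l.
case: laE => /to_circle_inj E.
- by have [] := code_end_inj (e:=1%N) (e':=1%N) isT isT (E (code_end_itv L (e:=1%N) isT) (code_end_itv nk (e:=1%N) isT)).
- by have [] := code_end_inj (e:=1%N) (e':=2%N) isT isT (E (code_end_itv L (e:=1%N) isT) (code_end_itv nk (e:=2%N) isT)).
Qed.

(** Leafs do not cross: ends of lower level avoid the inner arc by [tri_outside], and distinct leafs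
    of one level lie in disjoint triadic intervals. *)
Lemma leaf_outside l m : l <> m -> (lv l <= lv m)%N ->
  (la l < la m \/ lb m < la l) /\ (lb l < la m \/ lb m < lb l).
Proof.
move=> lm; rewrite leq_eqVlt => /orP[/eqP nE|nm]; last by split; apply: tri_outside.
rewrite /la /lb -nE !lt_tri !ltn_pmul2r ?expn_gt0//.
have : lk l <> lk m by move=> kE; apply: lm; exact: leaf_code_inj.
lia.
Qed.

Lemma leaf_eq_end l m : [\/ la l = la m, la l = lb m, lb l = la m | lb l = lb m] -> l = m.
Proof.
move=> E; apply: contrapT => lm; wlog : l m lm E / (lv l <= lv m)%N => [H|nm].
  have [|/ltnW] := leqP (lv l) (lv m); first exact: H.
  by apply: H; [exact: nesym|case: E; [constructor 1|constructor 3|constructor 2|constructor 4]].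
have := leaf_outside lm nm; have := leaf_ltW l; have := leaf_ltW m.
by case: E => -> [? ? ?] [? ? ?]; lra.
Qed.

(** Which side counts as the inner one depends on where the circle is cut; homeomorphisms need not
    preserve it. *)
Definition inl l t : bool := la l < t < lb l.

Lemma inl_la l : inl l (la l) = false. Proof. by rewrite /inl ltxx. Qed.
Lemma inl_leaf l m : l <> m -> inl l (lb m) = inl l (la m).
Proof.
move=> lm; rewrite /inl; have [? ? ?] := leaf_ltW l; have [? ? ?] := leaf_ltW m.
have [nm|/ltnW nm] := leqP (lv l) (lv m).
- have := leaf_outside lm nm => -[H1 H2].
  by apply/idP/idP => /andP[? ?]; apply/andP; split; lra.
- have := leaf_outside (nesym lm) nm => -[H1 H2].
  by apply/idP/idP => /andP[? ?]; apply/andP; split; lra.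
Qed.

(** Levels increase strictly along nested inner arcs, hence only finitely many leafs surround a
    given one. *)
Lemma inl_level l m : inl l (la m) -> (lv l < lv m)%N.
Proof.
move=> lm; rewrite ltnNge; apply/negP => nm.
have lm' : m <> l by move=> ml; move: lm; rewrite ml inl_la.
by have := leaf_outside lm' nm; move: lm; rewrite /inl => /andP[]; lra.
Qed.

Lemma leaf_finite_level n : finite_set [set l : @leaf R | (lv l < n)%N].
Proof.
pose f l := (lv l, lk l).
have fin : finite_set (`I_n `*` `I_(2 * 3 ^ n)) by apply: finite_setX; exact: finite_II.
apply: (@sub_finite_set _ _ (f @^-1` (`I_n `*` `I_(2 * 3 ^ n)))); last first.
  by apply: finite_preimage => // l m _ _ [nE kE]; exact: leaf_code_inj.
move=> l /= ln; split=> //=.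
have := leaf_code l; rewrite /is_code.
have : (3 ^ lv l <= 3 ^ n)%N by rewrite leq_exp2l// ltnW.
lia.
Qed.

End Leafs.

(** * Cantorgons *)

Section Plane.
Context {R : realType}.
Implicit Types (s t : R) (x y : circle R) (l m : @leaf R) (w z : R * R) (b : bool).

Lemma cosD2z s (k : int) : cos (s + pi * (2 * k%:~R)) = cos s.
Proof.
have H (n : nat) (u : R) : cos (u + pi * (2 * n%:R)) = cos u.
  have -> : pi * (2 * n%:R) = pi *+ 2 *+ n :> R by rewrite -mulrnA -[RHS]mulr_natr natrM.
  exact/periodicn/cosD2pi.
case: k => n; first by rewrite -pmulrn H.
rewrite NegzE mulrNz -pmulrn -[LHS](H n.+1); congr cos; ring.
Qed.

Lemma sinD2z s (k : int) : sin (s + pi * (2 * k%:~R)) = sin s.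
Proof. by rewrite -!cosBpihalf addrAC cosD2z. Qed.

Lemma plane_pointE t : plane_point (to_circle t) = (cos (pi * t), sin (pi * t)).
Proof.
have [k E] : exists k : int, repr (to_circle t) = t + 2 * k%:~R.
  by apply/to_circleE; exact: reprK.
by rewrite /plane_point E mulrDr cosD2z sinD2z.
Qed.

Definition seg w z s : R * R := ((1 - s) * w.1 + s * z.1, (1 - s) * w.2 + s * z.2).

Definition norm2 w : R := w.1 ^+ 2 + w.2 ^+ 2.

Lemma norm2_point x : norm2 (plane_point x) = 1.
Proof. exact: cos2Dsin2. Qed.

Lemma norm2_seg w z s : norm2 w <= 1 -> norm2 z < 1 -> 0 < s <= 1 -> norm2 (seg w z s) < 1.
Proof.
rewrite /norm2 /seg /=; move: w z => [w1 w2] [z1 z2] /= wD zD s01.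
rewrite -subr_gt0 [X in 0 < X](_ : _ =
  (1 - s) * (1 - (w1 ^+ 2 + w2 ^+ 2)) + s * (1 - (z1 ^+ 2 + z2 ^+ 2)) +
  s * (1 - s) * ((w1 - z1) ^+ 2 + (w2 - z2) ^+ 2)); last by ring.
have H1 : 0 <= (1 - s) * (1 - (w1 ^+ 2 + w2 ^+ 2)) by apply: mulr_ge0; lra.
have H2 : 0 < s * (1 - (z1 ^+ 2 + z2 ^+ 2)) by apply: mulr_gt0; lra.
have H3 : 0 <= s * (1 - s) * ((w1 - z1) ^+ 2 + (w2 - z2) ^+ 2).
  by rewrite mulr_ge0 ?addr_ge0 ?sqr_ge0// mulr_ge0//; lra.
by lra.
Qed.

Lemma norm2_seg_le w z s : norm2 w <= 1 -> norm2 z <= 1 -> 0 <= s <= 1 ->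
  norm2 (seg w z s) <= 1.
Proof.
rewrite /norm2 /seg /=; move: w z => [w1 w2] [z1 z2] /= wD zD s01.
rewrite -subr_ge0 [X in 0 <= X](_ : _ =
  (1 - s) * (1 - (w1 ^+ 2 + w2 ^+ 2)) + s * (1 - (z1 ^+ 2 + z2 ^+ 2)) +
  s * (1 - s) * ((w1 - z1) ^+ 2 + (w2 - z2) ^+ 2)); last by ring.
have H1 : 0 <= (1 - s) * (1 - (w1 ^+ 2 + w2 ^+ 2)) by apply: mulr_ge0; lra.
have H2 : 0 <= s * (1 - (z1 ^+ 2 + z2 ^+ 2)) by apply: mulr_ge0; lra.
have H3 : 0 <= s * (1 - s) * ((w1 - z1) ^+ 2 + (w2 - z2) ^+ 2).
  by rewrite mulr_ge0 ?addr_ge0 ?sqr_ge0// mulr_ge0//; lra.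
by lra.
Qed.

(** Affine function whose zero line carries the chord of [l]: the normal points to the middle of the
    arc from [la l] to [lb l], and the constant is the distance of the chord from the centre. It is
    positive on the inner side. *)
Definition lam l w : R :=
  w.1 * cos (pi * ((la l + lb l) / 2)) + w.2 * sin (pi * ((la l + lb l) / 2))
  - cos (pi * ((lb l - la l) / 2)).

Lemma lam_seg l w z s : lam l (seg w z s) = (1 - s) * lam l w + s * lam l z.
Proof. rewrite /lam /seg /=; ring. Qed.

Lemma lam_pointE l t : lam l (plane_point (to_circle t)) =
  cos (pi * (t - (la l + lb l) / 2)) - cos (pi * ((lb l - la l) / 2)).
Proof. by rewrite plane_pointE /lam /= mulrBr cosB. Qed.

Lemma lt_cospi s t : 0 <= s <= 1 -> 0 <= t <= 1 -> (cos (pi * s) < cos (pi * t)) = (t < s).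
Proof.
move=> s01 t01; have H u : 0 <= u <= 1 -> pi * u \in `[0, pi].
  by move=> /andP[u0 u1]; rewrite in_itv/= mulr_ge0 ?pi_ge0//= ler_piMr ?pi_ge0.
by rewrite ltr_cos ?H// ltr_pM2l ?pi_gt0.
Qed.

(** [s] is the distance from [t] to the middle of the inner arc, measured on the circle of length 2.
    It lies in [[0, 1]], where the cosine of [pi * s] decreases. *)
Lemma lam_fold l t : 0 < t <= 2 -> exists s, [/\ 0 <= s <= 1,
  cos (pi * (t - (la l + lb l) / 2)) = cos (pi * s) &
  [/\ inl l t -> s < (lb l - la l) / 2,
      t = la l \/ t = lb l -> s = (lb l - la l) / 2 &
      t < la l \/ lb l < t -> (lb l - la l) / 2 < s]].
Proof.
move=> t02; have [a0 ab b2] := leaf_ltW l; set m := (la l + lb l) / 2.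
have [tm|tm] := leP t m.
  have -> : cos (pi * (t - m)) = cos (pi * (m - t)) by rewrite -cosN -mulrN opprB.
  have [s1|s1] := leP (m - t) 1.
    exists (m - t); split=> //; first by rewrite /m in s1 tm *; lra.
    by rewrite /inl /m; split=> [|[]|[]]; rewrite /m in s1 tm; lra.
  exists (2 - (m - t)); split; first by rewrite /m in s1 tm *; lra.
    by rewrite -[RHS]cosN -[RHS](cosD2z _ 1); congr cos; rewrite mulr1z; ring.
  by rewrite /inl /m; split=> [|[]|[]]; rewrite /m in s1 tm; lra.
have [s1|s1] := leP (t - m) 1.
  exists (t - m); split=> //; first by rewrite /m in s1 tm *; lra.
  by rewrite /inl /m; split=> [|[]|[]]; rewrite /m in s1 tm; lra.
exists (2 - (t - m)); split; first by rewrite /m in s1 tm *; lra.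
  by rewrite -[RHS]cosN -[RHS](cosD2z _ 1); congr cos; rewrite mulr1z; ring.
by rewrite /inl /m; split=> [|[]|[]]; rewrite /m in s1 tm; lra.
Qed.

Definition has_sign b (v : R) : bool := if b then 0 < v else v < 0.

Lemma lam_end l t : t = la l \/ t = lb l -> lam l (plane_point (to_circle t)) = 0.
Proof.
move=> tE; have [a0 ab b2] := leaf_ltW l.
have t02 : 0 < t <= 2 by case: tE => ->; lra.
have [s [s01 sE [_ /(_ tE) sd _]]] := lam_fold l t02.
by rewrite lam_pointE sE sd subrr.
Qed.

Lemma lam_sign l t : 0 < t <= 2 -> t <> la l -> t <> lb l ->
  has_sign (inl l t) (lam l (plane_point (to_circle t))).
Proof.
move=> t02 ta tb; have [a0 ab b2] := leaf_ltW l.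
have [s [s01 sE [H _ K]]] := lam_fold l t02; rewrite lam_pointE sE.
have d01 : 0 <= (lb l - la l) / 2 <= 1 by lra.
have [/H sd|] := boolP (inl l t).
  by rewrite /= subr_gt0 lt_cospi.
rewrite /inl negb_and -!leNgt => h; rewrite /= subr_lt0 lt_cospi//; apply: K.
by case/orP: h => h; [left|right]; rewrite lt_neqAle h andbT; apply/eqP => // /esym.
Qed.

Lemma lam_chord l w : norm2 w < 1 -> lam l w = 0 -> chord l w.
Proof.
move=> w1 l0; have [a0 ab b2] := leaf_ltW l.
pose c := (la l + lb l) / 2; pose d := (lb l - la l) / 2.
have laE : la l = c - d by rewrite /c /d; lra.
have lbE : lb l = c + d by rewrite /c /d; lra.
pose u := w.2 * cos (pi * c) - w.1 * sin (pi * c).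
have cs := cos2Dsin2 (pi * c); have ds := cos2Dsin2 (pi * d).
have S0 : 0 < sin (pi * d).
  by rewrite sin_gt0_pi// mulr_gt0 ?pi_gt0//= ?gtr_pMr ?pi_gt0//; rewrite /d; lra.
have vE : w.1 * cos (pi * c) + w.2 * sin (pi * c) = cos (pi * d).
  by move: l0; rewrite /lam -/c -/d; lra.
have wE1 : w.1 = cos (pi * d) * cos (pi * c) - u * sin (pi * c).
  by rewrite -vE -[LHS]mulr1 -cs /u; ring.
have wE2 : w.2 = cos (pi * d) * sin (pi * c) + u * cos (pi * c).
  by rewrite -vE -[LHS]mulr1 -cs /u; ring.
have uS : u ^+ 2 < sin (pi * d) ^+ 2.
  suff E : norm2 w = cos (pi * d) ^+ 2 + u ^+ 2 by lra.
  by rewrite /norm2 -vE -[LHS]mulr1 -cs /u; ring.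
have uS' : - sin (pi * d) < u < sin (pi * d).
  by rewrite -ltr_norml -(ger0_norm (ltW S0)) -ltr_sqr ?nnegrE// !real_normK ?num_real.
(* [u] is the coordinate along the chord; it runs from [- sin (pi * d)] at [la l] to [sin (pi * d)]
   at [lb l]. *)
exists (to_circle (la l)), (to_circle (lb l)), ((u + sin (pi * d)) / (2 * sin (pi * d))).
split; [by apply/leaf_endsE; left|by apply/leaf_endsE; right| |].
  apply/andP; split; first by apply: divr_ge0; lra.
  by rewrite ler_pdivrMr ?mulr_gt0//; lra.
rewrite !plane_pointE laE lbE [w]surjective_pairing /= wE1 wE2 mulrBr mulrDr.
rewrite cosB cosD sinB sinD; congr pair; field; exact: lt0r_neq0.
Qed.

Lemma chord_lam l w : chord l w -> lam l w = 0.
Proof.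
move=> [x [y [s [/leaf_endsE xl /leaf_endsE yl s01 ->]]]].
rewrite -[(_, _)]/(seg (plane_point x) (plane_point y) s) lam_seg.
by case: xl => ->; case: yl => ->; rewrite !lam_end ?mulr0 ?addr0//; by [left|right].
Qed.

Lemma cut_diskP w : cut_disk w <-> norm2 w < 1 /\ forall l, lam l w != 0.
Proof.
split=> [[wD wC]|[wD wl]].
  split=> // l; apply/eqP => l0; apply: wC; exists l => //; exact: lam_chord.
by split=> // -[l _ /chord_lam]; apply/eqP.
Qed.

Lemma lam_continuous l : continuous (lam l).
Proof.
move=> w; rewrite /lam; apply: cvgB; last exact: cvg_cst.
by apply: cvgD; apply: cvgMr_tmp; [exact: cvg_fst|exact: cvg_snd].
Qed.

Lemma seg_continuous w z : continuous (seg w z).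
Proof.
have H (u v : R) : continuous (fun s : R => (1 - s) * u + s * v).
  move=> s; apply: cvgD; apply: cvgMr_tmp; last exact: cvg_id.
  by apply: cvgB; [exact: cvg_cst|exact: cvg_id].
by move=> s; exact: (cvg_pair (H _ _ s) (H _ _ s)).
Qed.

(* [sg C l] tells on which side of the leaf [l] the Cantorgon [C] lies. *)
Definition cpt (C : @cantorgon R) : R * R := s2val (cid2 (svalP C)).
Definition sg (C : @cantorgon R) l : bool := 0 < lam l (cpt C).

Lemma has_signP v : v != 0 -> has_sign (0 < v) v.
Proof. by move=> v0; case: ltP => //=; rewrite le_eqVlt (negPf v0). Qed.

Lemma has_sign_inj b b' v : has_sign b v -> has_sign b' v -> b = b'.
Proof. by case: b b' => -[] //= ? ?; lra. Qed.

Lemma has_sign_neq0 b v : has_sign b v -> v != 0.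
Proof. by case: b => /=; [apply: lt0r_neq0|apply: ltr0_neq0]. Qed.

Lemma has_sign_comb b u v s : 0 < s <= 1 -> u = 0 \/ has_sign b u -> has_sign b v ->
  has_sign b ((1 - s) * u + s * v).
Proof.
move=> /andP[s0 s1] [->|]; first by rewrite mulr0 add0r; case: b => /=; rewrite ?pmulr_rgt0 ?pmulr_rlt0.
have := s1; rewrite le_eqVlt => /orP[/eqP ->|s1']; first by rewrite subrr mul0r add0r mul1r.
case: b => /= u0 v0; first by rewrite addr_gt0// mulr_gt0//; lra.
by rewrite -oppr_gt0 opprD -!mulrN addr_gt0// mulr_gt0//; lra.
Qed.

Lemma connected_sign l (A : set (R * R)) w z : connected A -> A `<=` cut_disk ->
  A w -> A z -> (0 < lam l w) = (0 < lam l z).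
Proof.
move=> Ac AD Aw Az; have : connected (lam l @` A).
  by apply: connected_continuous_connected => //; exact/continuous_subspaceT/lam_continuous.
move=> /connected_intervalP I.
have n0 : ~ (lam l @` A) 0.
  by move=> [v /AD/cut_diskP[_ /(_ l)]] + v0; rewrite v0 eqxx.
apply: contrapT => /eqP.
have [w0|w0] := ltP 0 (lam l w); have [z0|z0] := ltP 0 (lam l z) => // _; apply: n0.
- by apply: (I (lam l z) (lam l w)); [exists z|exists w|rewrite z0 ltW].
- by apply: (I (lam l w) (lam l z)); [exists w|exists z|rewrite w0 ltW].
Qed.

Lemma cpt_cut C : cut_disk (cpt C).
Proof. by rewrite /cpt; case: cid2. Qed.

(** A connected set off the leafs cannot change sides ([connected_sign]); conversely, the points of
    the open disk with prescribed signs form a convex set. A Cantorgon thus amounts to its sign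
    function [sg C]. *)
Lemma cantorgon_setP C w :
  cantorgon_set C w <-> norm2 w < 1 /\ forall l, has_sign (sg C l) (lam l w).
Proof.
have -> : cantorgon_set C = connected_component cut_disk (cpt C).
  by rewrite /cpt /cantorgon_set; case: cid2.
have /cut_diskP[zD zl] := cpt_cut C.
split=> [[A [Az AD Ac] Aw]|[wD wl]].
  have /cut_diskP[wD wl] := AD _ Aw; split=> // l.
  by rewrite /sg -(connected_sign l Ac AD Aw Az); exact: has_signP.
exists (seg (cpt C) w @` `[0, 1]) => //; last first.
  by exists 1; rewrite /= ?in_itv/= ?lexx ?ler01// /seg subrr !mul0r !mul1r !add0r -surjective_pairing.
split.
- by exists 0; rewrite /= ?in_itv/= ?lexx ?ler01// /seg subr0 !mul0r !mul1r !addr0 -surjective_pairing.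
- move=> _ [s /= /[!in_itv]/= /andP[s0 s1] <-].
  have [->|s0'] := eqVneq s 0.
    by rewrite /seg subr0 !mul0r !mul1r !addr0 -surjective_pairing; exact: cpt_cut.
  have s01 : 0 < s <= 1 by rewrite lt0r s0' s0.
  apply/cut_diskP; split; first by apply: norm2_seg => //; exact: ltW.
  move=> l; rewrite lam_seg; apply: (@has_sign_neq0 (sg C l)).
  by apply: has_sign_comb => //; right; exact: has_signP.
- apply: connected_continuous_connected; first exact: segment_connected.
  exact/continuous_subspaceT/seg_continuous.
Qed.

Lemma cantorgon_mem C : cantorgon_set C (cpt C).
Proof.
have /cut_diskP[zD zl] := cpt_cut C.
by apply/cantorgon_setP; split=> // l; exact: has_signP.
Qed.

Lemma cantorgon_eq C C' : sg C =1 sg C' -> C = C'.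
Proof.
move=> CC'; suff : cantorgon_set C = cantorgon_set C'.
  by case: C C' {CC'} => A AP [B BP] /= AB; exact: eq_exist.
apply/seteqP; split=> w /cantorgon_setP[wD wl]; apply/cantorgon_setP.
  by split=> // l; rewrite -CC'.
by split=> // l; rewrite CC'.
Qed.

Lemma cantorgon_exists w : cut_disk w ->
  exists C : @cantorgon R, forall l b, has_sign b (lam l w) -> sg C l = b.
Proof.
move=> wc; have CP : is_cantorgon (connected_component cut_disk w) by exists w.
exists (exist _ _ CP) => l b; apply: has_sign_inj.
have : cantorgon_set (exist _ _ CP) w by exact: connected_component_refl.
by move=> /cantorgon_setP[].
Qed.

Lemma closure_cantorgon C w : closure (cantorgon_set C) w ->
  forall l, lam l w = 0 \/ has_sign (sg C l) (lam l w).
Proof.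
move=> clw l; have [->|l0] := eqVneq (lam l w) 0; first by left.
right; case Eb : (sg C l) => /=; move: l0; rewrite neq_lt => /orP[l0|l0]//.
- have H := @cvgr_lt R (R * R)%type (nbhs w) (nbhs_filter w) (lam l) _ (@lam_continuous l w) 0 l0.
  have [v [/cantorgon_setP[_ /(_ l)]]] := clw _ H; by rewrite Eb /=; lra.
- have H := @cvgr_gt R (R * R)%type (nbhs w) (nbhs_filter w) (lam l) _ (@lam_continuous l w) 0 l0.
  have [v [/cantorgon_setP[_ /(_ l)]]] := clw _ H; by rewrite Eb /=; lra.
Qed.

(** The segment from [w] to an inner point of [C] lies in [C] except possibly for [w]: a sign that
    vanishes at [w] takes its right value at once. *)
Lemma closure_cantorgonP C w : norm2 w <= 1 -> closure (cantorgon_set C) w <->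
  forall l, lam l w = 0 \/ has_sign (sg C l) (lam l w).
Proof.
move=> wD; split=> [|wl]; first exact: closure_cantorgon.
have [zD zl] := (cantorgon_setP C _).1 (cantorgon_mem C).
move=> B; rewrite -[w in nbhs w](_ : seg w (cpt C) 0 = _); last first.
  by rewrite /seg subr0 !mul0r !mul1r !addr0 -surjective_pairing.
move=> /seg_continuous [e /= e0 eB].
pose s := Num.min (e / 2) 1; have s0 : 0 < s by rewrite lt_min ltr01 divr_gt0.
have s1 : s <= 1 by rewrite /s ge_min lexx orbT.
have se : s <= e / 2 by rewrite /s ge_min lexx.
have s01 : 0 < s <= 1 by rewrite s0 s1.
exists (seg w (cpt C) s); split.
  apply/cantorgon_setP; split; first exact: norm2_seg.
  by move=> l; rewrite lam_seg; exact: has_sign_comb.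
by apply: eB => /=; rewrite sub0r normrN gtr0_norm//; lra.
Qed.

Lemma lam_end_or_sign l t : 0 < t <= 2 ->
  (t = la l \/ t = lb l) /\ lam l (plane_point (to_circle t)) = 0 \/
  (t <> la l /\ t <> lb l) /\ has_sign (inl l t) (lam l (plane_point (to_circle t))).
Proof.
move=> t02; have [->|/eqP ta] := eqVneq t (la l).
  by left; split; [left|apply: lam_end; left].
have [->|/eqP tb] := eqVneq t (lb l).
  by left; split; [right|apply: lam_end; right].
by right; split=> //; exact: lam_sign.
Qed.

Lemma idealP C x : cantorgon_ideal C x <->
  forall l, (crd x = la l \/ crd x = lb l) \/ inl l (crd x) = sg C l.
Proof.
have x02 := crd_itv x; have -> : cantorgon_ideal C x <->
    forall l, lam l (plane_point x) = 0 \/ has_sign (sg C l) (lam l (plane_point x)).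
  by apply: closure_cantorgonP; rewrite norm2_point.
split=> H l; have := lam_end_or_sign l x02; rewrite crdK => -[[xl x0]|[[xa xb] xs]].
- by left.
- by right; case: (H l) => [x0|]; [move: (has_sign_neq0 xs); rewrite x0 eqxx|apply: has_sign_inj].
- by left.
- by right; case: (H l) => [[]//|<-].
Qed.

Lemma leaf_end_itv l : 0 < la l <= 2 /\ 0 < lb l <= 2.
Proof. by have [? ? ?] := leaf_ltW l; lra. Qed.

Lemma lam_leaf l m : m <> l -> has_sign (inl m (la l)) (lam m (plane_point (to_circle (la l)))) /\
   has_sign (inl m (la l)) (lam m (plane_point (to_circle (lb l)))).
Proof.
move=> ml; have [l1 l2] := leaf_end_itv l.
have ml' E : [\/ la m = la l, la m = lb l, lb m = la l | lb m = lb l] -> E.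
  by move/leaf_eq_end.
split; [|rewrite -inl_leaf//]; apply: lam_sign => // e; apply: ml'.
- by constructor 1.
- by constructor 3.
- by constructor 2.
- by constructor 4.
Qed.

(** For [m <> l] both ends of [l] have the same nonzero sign, and so has the whole chord. Nothing is
    required at [l] itself, which leaves room for one Cantorgon on either side of [l]. *)
Lemma sideP l C : is_side l C <-> forall m, m <> l -> inl m (la l) = sg C m.
Proof.
split=> [lC m ml|lC w].
  have [sa sb] := lam_leaf ml.
  pose w := seg (plane_point (to_circle (la l))) (plane_point (to_circle (lb l))) (1/2).
  have : chord l w.
    exists (to_circle (la l)), (to_circle (lb l)), (1/2); split=> //.
    + by apply/leaf_endsE; left.
    + by apply/leaf_endsE; right.
    + by lra.
  move=> /lC/closure_cantorgon/(_ m).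
  have : has_sign (inl m (la l)) (lam m w).
    by rewrite lam_seg; apply: has_sign_comb => //; [lra|right].
  by move=> s [s0|]; [move: (has_sign_neq0 s); rewrite s0 eqxx|exact: has_sign_inj].
move=> lw; have l0 := chord_lam lw.
have [x [y [s [/leaf_endsE xl /leaf_endsE yl s01 wE]]]] := lw.
have wE' : w = seg (plane_point x) (plane_point y) s by rewrite wE.
(* At [s = 0] the combination degenerates, and [has_sign_comb] needs a positive weight on its second
   point. *)
have [s0|s0] := eqVneq s 0.
  have -> : w = plane_point x.
    by rewrite wE' s0 /seg subr0 !mul0r !mul1r !addr0 -surjective_pairing.
  apply/closure_cantorgonP; first by rewrite norm2_point.
  move=> m; have [->|ml] := pselect (m = l).
    by left; case: xl => ->; apply: lam_end; [left|right].
  by right; rewrite -lC//; have [? ?] := lam_leaf ml; case: xl => ->.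
apply/closure_cantorgonP.
  by rewrite wE' norm2_seg_le ?norm2_point.
move=> m; have [->|ml] := pselect (m = l); first by left.
right; rewrite -lC// wE' lam_seg; have [? ?] := lam_leaf ml.
apply: has_sign_comb.
- by move: s01; rewrite le_eqVlt eq_sym (negPf s0).
- by right; case: xl => ->.
- by case: yl => ->.
Qed.

(* A point of the open disk off all the leafs, found as a barycentre of the
   ends of a leaf and of another point of the circle. *)
Lemma side_exists l t : 0 < t <= 2 -> t <> la l -> t <> lb l ->
  (forall m, m <> l -> (t = la m \/ t = lb m) \/ inl m t = inl m (la l)) ->
  exists C, is_side l C /\ sg C l = inl l t.
Proof.
move=> t02 ta tb H; have [a0 ab b2] := leaf_ltW l.
pose w := seg (plane_point (to_circle (la l))) (plane_point (to_circle (lb l))) (1/2).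
pose z := seg (plane_point (to_circle t)) w (1/2).
have wD : norm2 w < 1.
  rewrite /w /seg /norm2 !plane_pointE /=.
  have ca := cos2Dsin2 (pi * la l); have cb := cos2Dsin2 (pi * lb l).
  (* The ends of [l] are distinct points of the circle, so the middle of the chord is strictly
     inside the disk: [norm2 w] is half of 1 plus this cosine. *)
  have : cos (pi * lb l - pi * la l) < 1.
    have -> : pi * lb l - pi * la l = (pi * ((lb l - la l) / 2)) *+ 2.
      by rewrite mulr2n; lra.
    rewrite cos_mulr2n.
    have := cos2Dsin2 (pi * ((lb l - la l) / 2)).
    have : 0 < sin (pi * ((lb l - la l) / 2)).
      by rewrite sin_gt0_pi// mulr_gt0 ?pi_gt0//= ?gtr_pMr ?pi_gt0//; lra.
    move=> /(exprn_gt0 2%N) h1 h2; rewrite mulr2n; lra.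
  by rewrite cosB => h; move: ca cb h; lra.
have ws m : m <> l -> has_sign (inl m (la l)) (lam m w).
  move=> ml; rewrite lam_seg; have [? ?] := lam_leaf ml.
  by apply: has_sign_comb => //; [lra|right].
have zs m : m <> l -> has_sign (inl m (la l)) (lam m z).
  move=> ml; rewrite lam_seg; apply: has_sign_comb; [lra| |exact: ws].
  have [[_ ->]|[[ma mb] ms]] := lam_end_or_sign m t02; first by left.
  by right; case: (H m ml) => [[]|<-].
have zl : has_sign (inl l t) (lam l z).
  rewrite lam_seg [lam l w]lam_seg (@lam_end l (la l)); last by left.
  rewrite (@lam_end l (lb l)); last by right.
  have := lam_sign t02 ta tb; case: (inl l t) => /= h; lra.
have [|C CP] := @cantorgon_exists z.
  apply/cut_diskP; split; first by apply: norm2_seg; rewrite ?norm2_point//; lra.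
  move=> m; have [->|ml] := pselect (m = l); first exact: has_sign_neq0 zl.
  exact: has_sign_neq0 (zs m ml).
exists C; split; last exact: CP zl.
by apply/sideP => m ml; apply/esym/CP/zs.
Qed.

(** The inner side of a short leaf is a thin cap near the circle, which misses a fixed inner point
    of [C]. *)
Lemma sg_finite C : exists n, forall l, sg C l -> (lv l < n)%N.
Proof.
have [zD _] := (cantorgon_setP C _).1 (cantorgon_mem C).
(* [c] is at least the distance of [z] from the centre, because [(1 - norm2 z)^2 >= 0]; a chord
   farther than [c] from the centre leaves [z] on its outer side. *)
set z := cpt C in zD; set c := (1 + norm2 z) / 2.
have z0 : 0 <= norm2 z by rewrite addr_ge0 ?sqr_ge0.
have [d d0 dP] : exists2 d, 0 < d & forall s, 0 <= s < d -> c < cos (pi * s).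
  have cc : {for 0, continuous (fun s : R => cos (pi * s))}.
    apply: continuous_comp; last exact: continuous_cos.
    by apply: cvgMl_tmp; exact: cvg_id.
  have c1 : c < cos (pi * 0) by rewrite mulr0 cos0 /c; lra.
  have [d /= d0 dP] := @cvgr_gt R R (nbhs (0 : R)) (nbhs_filter _) _ _ cc _ c1; exists d => // s /andP[s0 sd].
  by apply: dP => /=; rewrite sub0r normrN ger0_norm.
have [n nP] : exists n, forall k, (n <= k)%N -> (3 ^+ k)^-1 < d.
  have := @near_infty_natSinv_lt R (PosNum d0) => -[n _ nP]; exists n => k nk.
  apply: le_lt_trans (nP k nk); rewrite lef_pV2 ?posrE ?pow3_gt0 ?ltr0n// -natrX ler_nat.
  exact: ltn_expl.
exists n => l; rewrite /sg -/z => l0; rewrite ltnNge; apply/negP => nl.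
have [a0 ab b2] := leaf_ltW l.
have lE : lb l - la l = (3 ^+ lv l)^-1.
  by rewrite /la /lb /tri -mulrBl -natrB ?leq_add2l// subnDl mul1r.
have := dP ((lb l - la l) / 2); have := nP _ nl; rewrite -lE => lt1 cd.
have {}cd : c < cos (pi * ((lb l - la l) / 2)) by apply: cd; lra.
pose m := (la l + lb l) / 2; pose v := z.1 * cos (pi * m) + z.2 * sin (pi * m).
move: l0; rewrite /lam -/m -/v.
have : v ^+ 2 <= norm2 z.
  have -> : norm2 z = v ^+ 2 + (z.1 * sin (pi * m) - z.2 * cos (pi * m)) ^+ 2.
    by rewrite /norm2 -[LHS]mulr1 -(cos2Dsin2 (pi * m)) /v -/m; ring.
  by rewrite lerDl sqr_ge0.
have : 0 <= (1 - norm2 z) ^+ 2 by rewrite sqr_ge0.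
move: cd; rewrite /c; set N := norm2 z in z0 zD *; set k := cos _ => cd h1 h2 h3.
by nra.
Qed.

End Plane.

(** * The tree *)

HB.instance Definition _ (R : realType) := gen_eqMixin (@leaf R).
HB.instance Definition _ (R : realType) := gen_choiceMixin (@leaf R).

Section Tree.
Context {R : realType}.
Implicit Types (s t u : R) (l m n p q r : @leaf R) (C : @cantorgon R).

Definition cyc s t u : bool := [|| s < t < u, t < u < s | u < s < t].

Lemma cyc_rot s t u : cyc s t u = cyc t u s.
Proof. by rewrite /cyc orbC -orbA. Qed.

Lemma cycC s t u : s != t -> t != u -> s != u -> cyc s t u = ~~ cyc u t s.
Proof.
rewrite /cyc; case: (ltgtP s t) => //; case: (ltgtP t u) => //; case: (ltgtP s u) => //=; lra.
Qed.

Lemma cyc_asym s t u : cyc s t u -> cyc u t s = false.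
Proof.
rewrite /cyc; case: (ltgtP s t) => //; case: (ltgtP t u) => //; case: (ltgtP s u) => //=; lra.
Qed.

(** As seen from one side of [l], the two ends of [l] occupy the same place in the cyclic order;
    [cyc_behind] adds the points beyond [l]. *)
Lemma cyc_end l s t : inl l s = inl l t -> s != la l -> s != lb l -> t != la l -> t != lb l ->
  cyc (la l) s t = cyc (lb l) s t.
Proof.
have [_ ab _] := leaf_ltW l; rewrite /inl /cyc.
case: (ltgtP s (la l)) => //; case: (ltgtP s (lb l)) => //;
case: (ltgtP t (la l)) => //; case: (ltgtP t (lb l)) => //; case: (ltgtP s t) => //=; lra.
Qed.

Lemma cyc_behind l s t u : inl l s = inl l t -> inl l u = ~~ inl l s ->
  s != la l -> s != lb l -> t != la l -> t != lb l -> u != la l -> u != lb l ->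
  cyc (la l) s t = cyc u s t.
Proof.
have [_ ab _] := leaf_ltW l; rewrite /inl /cyc.
case: (ltgtP s (la l)) => //; case: (ltgtP s (lb l)) => //;
case: (ltgtP t (la l)) => //; case: (ltgtP t (lb l)) => //;
case: (ltgtP u (la l)) => //; case: (ltgtP u (lb l)) => //=;
case: (ltgtP s t) => //=; case: (ltgtP u t) => //=; case: (ltgtP u s) => //=; lra.
Qed.

Lemma int_01 (d : int) : -2 < 2 * (d%:~R : R) < 4 -> d = 0 \/ d = 1.
Proof.
move=> /andP[d1 d2]; have : -1 < d%:~R :> R by lra.
have : d%:~R < 2 :> R by lra.
rewrite -[2]/(2%:~R) -[-1]/((-1)%:~R) !ltr_int; lia.
Qed.

Lemma circle_cycE s t u : 0 < s <= 2 -> 0 < t <= 2 -> 0 < u <= 2 ->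
  circle_cyc (to_circle s) (to_circle t) (to_circle u) <-> cyc s t u.
Proof.
move=> s02 t02 u02; split=> [[a [b [c [/to_circleE[i sE] /to_circleE[j tE]]]]]|].
  move=> /to_circleE[k uE] [ab bc ca].
  (* [2 * (i - j)] is the sum of [s - t], in (-2,2), and of [b - a], in (0,2). *)
  have ij : i - j = 0 \/ i - j = 1 by apply: int_01; rewrite intrB; lra.
  have ik : i - k = 0 \/ i - k = 1 by apply: int_01; rewrite intrB; lra.
  have ijR : i%:~R - j%:~R = (i - j)%:~R :> R by rewrite intrB.
  have ikR : i%:~R - k%:~R = (i - k)%:~R :> R by rewrite intrB.
  rewrite /cyc; case: ij ijR => ->; case: ik ikR => ->; rewrite ?mulr0z ?mulr1z => h1 h2;
    apply/or3P; first [constructor 1; lra|constructor 2; lra|constructor 3; lra].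
rewrite /cyc => /or3P[] H.
- by exists s, t, u; split=> //; split; lra.
- exists s, (t + 2), (u + 2); split=> //; last by split; lra.
  by apply/to_circleE; exists (-1); rewrite mulrNz mulr1z; lra.
  by apply/to_circleE; exists (-1); rewrite mulrNz mulr1z; lra.
- exists s, t, (u + 2); split=> //; last by split; lra.
  by apply/to_circleE; exists (-1); rewrite mulrNz mulr1z; lra.
Qed.

Lemma circle_cycP x y z : circle_cyc x y z <-> cyc (crd x) (crd y) (crd z : R).
Proof. by rewrite -circle_cycE ?crd_itv// !crdK. Qed.

(** The value at [m = l] is always [false] and has no meaning. *)
Definition sd l m : bool := inl l (la m).

Lemma sd_end l m : l <> m -> sd l m = inl l (lb m).
Proof. by move=> lm; rewrite /sd inl_leaf. Qed.

Lemma la_neq l m : l <> m -> [/\ la l != la m, la l != lb m, lb l != la m & lb l != lb m].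
Proof. by move=> lm; split; apply/eqP => e; apply: lm; apply: leaf_eq_end;
 [constructor 1|constructor 2|constructor 3|constructor 4]. Qed.

Definition unsep p q := forall n, n <> p -> n <> q -> sd n p = sd n q.

Lemma side_sd C p m : is_side p C -> m <> p -> sd m p = sg C m.
Proof. by move=> /sideP; exact. Qed.

Lemma sides_unsep C p q : is_side p C -> is_side q C -> unsep p q.
Proof. by move=> pC qC n np nq; rewrite (side_sd pC np) (side_sd qC nq). Qed.

Lemma sides_unique C C' p q : p <> q -> is_side p C -> is_side q C ->
  is_side p C' -> is_side q C' -> C = C'.
Proof.
move=> pq pC qC pC' qC'; apply: cantorgon_eq => l.
have [->|lp] := pselect (l = p); first by rewrite -(side_sd qC) -?(side_sd qC').
by rewrite -(side_sd pC lp) -(side_sd pC' lp).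
Qed.

Lemma side_unique C C' p : is_side p C -> is_side p C' -> sg C p = sg C' p -> C = C'.
Proof.
move=> pC pC' CC'; apply: cantorgon_eq => l; have [->//|lp] := pselect (l = p).
by rewrite -(side_sd pC lp) -(side_sd pC' lp).
Qed.

(** Take the Cantorgon adjacent to [p] on the side of [q]: a leaf keeping it away from [q] would
    separate [p] from [q]. *)
Lemma unsep_common p q : p <> q -> unsep p q ->
  exists C, [/\ is_side p C, is_side q C & sg C p = sd p q].
Proof.
move=> pq pqU; have [qp1 qp2 qp3 qp4] := la_neq (nesym pq).
have [q02 _] := leaf_end_itv q.
have [||m mp|C [pC sC]] := @side_exists _ p (la q) q02.
- exact/eqP.
- exact/eqP.
- have [->|mq] := pselect (m = q); first by left; left.
  by right; have := pqU _ mp mq; rewrite /sd => ->.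
exists C; split=> //; apply/sideP => m mq.
have [->|mp] := pselect (m = p); first by rewrite sC.
by rewrite -(side_sd pC mp); apply/esym/pqU.
Qed.

(** A Helly property of the tree. It lets the image of a Cantorgon be found from relations between
    pairs of leafs. *)
Lemma side_of_unsep C p q m : p <> q -> is_side p C -> is_side q C ->
  unsep m p -> unsep m q -> is_side m C.
Proof.
move=> pq pC qC mp mq; apply/sideP => n nm; rewrite -[inl _ _]/(sd n m).
have [np|np] := pselect (n = p); last by rewrite (mp n)// (side_sd pC).
by subst n; rewrite (mq p)// (side_sd qC).
Qed.

Lemma neighbour p b : exists m, [/\ p <> m, unsep p m & sd p m = b].
Proof.
(* The interval of level [n] between numerators [j] and [j + 1] has [la p] as its left end if [b]
   holds and as its right end otherwise; [m] bounds its middle third. *)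
pose n := lv p; pose k := lk p; pose j := (if b then 3 * k + 1 else 3 * k)%N.
have jb : (j.+1 <= 2 * 3 ^ n)%N by have := leaf_code p; rewrite /is_code /j -/n -/k; case: (b); lia.
have mc : is_code n.+1 j by rewrite /is_code expnS; lia.
pose m := mkleaf mc : @leaf R; have [nE kE aE bE] := @mkleafE R _ _ mc; rewrite -/m in nE kE aE bE.
have pm : p <> m by move=> pm; move: nE; rewrite -pm /n; lia.
exists m; split=> // [l lp lm|]; last first.
  by rewrite /sd /inl aE /la /lb -/n -/k ![tri n _]triS !lt_triE /j; case: (b); lia.
have [ln|nl] := leqP (lv l) n; last first.
  have /negPf -> : ~~ sd l p by apply/negP => /inl_level; rewrite -/n; lia.
  by have /negPf -> : ~~ sd l m by apply/negP => /inl_level; rewrite nE; lia.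
have nm : (lv l < lv m)%N by rewrite nE.
have [d nd] : exists d, n = (d + lv l)%N by exists (n - lv l)%N; rewrite subnK.
have oa : la l <= tri n j \/ tri n j.+1 <= la l.
  by rewrite /la (tri_lift d) -nd !le_triE; lia.
have ob : lb l <= tri n j \/ tri n j.+1 <= lb l.
  by rewrite /lb (tri_lift d) -nd !le_triE; lia.
have m1 : tri n j < la m by rewrite aE [tri n _]triS lt_triE; lia.
have m2 : la m < tri n j.+1 by rewrite aE [tri n _]triS lt_triE; lia.
have pE : la p = tri n j \/ la p = tri n j.+1.
  by rewrite /la -/n -/k /j; case: (b); [left|right; rewrite addn1].
have := la_neq lp => -[/eqP l1 _ /eqP l2 _].
rewrite /sd /inl; case: pE => pE; move: l1 l2; rewrite pE => l1 l2.
  by apply/idP/idP; lra.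
by apply/idP/idP; lra.
Qed.

Lemma side_exists_sg p b : exists C, is_side p C /\ sg C p = b.
Proof.
have [m [pm pmU pmb]] := neighbour p b.
by have [C [pC mC sC]] := unsep_common pm pmU; exists C; rewrite sC.
Qed.

(** The edges on the path in the tree from [C] to [m], with [m] left out. *)
Definition sep C m : set (@leaf R) := [set n | n <> m /\ sd n m <> sg C n].

(** A leaf separating [C] from [m] has one of them on its inner side; [sg_finite] bounds its level
    in the first case, [inl_level] in the second. *)
Lemma sep_finite C m : finite_set (sep C m).
Proof.
have [N NP] := sg_finite C.
apply: (sub_finite_set _ (leaf_finite_level (maxn N (lv m)))) => n [nm /=].
rewrite leq_max; case E : (sg C n); first by rewrite NP.
by case E' : (sd n m) => // _; rewrite (inl_level E') orbT.
Qed.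

Lemma finite_argmin (T : Type) (A : set T) (f : T -> R) : finite_set A -> A !=set0 ->
  exists2 x, A x & forall y, A y -> f x <= f y.
Proof.
move=> /(finite_image f)/finite_seqP[s sE] A0.
have : (f @` A) !=set0 by case: A0 => x Ax; exists (f x), x.
rewrite sE => -[y0 /= y0s].
have [y [ys yP]] : exists y, y \in s /\ forall z, z \in s -> y <= z.
  case: s y0s {sE} => // a s _; elim: s a => [|b s IH] a.
    by exists a; rewrite inE eqxx; split=> // z; rewrite inE => /eqP ->.
  have [y [ys yP]] := IH b; have [ay|/ltW ya] := leP a y.
    exists a; rewrite inE eqxx; split=> // z; rewrite inE => /orP[/eqP ->//|/yP].
    exact: le_trans.
  exists y; rewrite inE ys orbT; split=> // z; rewrite inE => /orP[/eqP ->//|]; exact: yP.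
have : (f @` A) y by rewrite sE.
move=> [x Ax xy]; exists x => // z Az; rewrite xy; apply: yP.
have : (f @` A) (f z) by exists z.
by rewrite sE.
Qed.

(* Among the leafs separating [C] from [m], the first one crossed by a segment
   from an inner point of [C] to an end of [m] is a side of [C]. *)
Lemma nearest_side C m : sep C m !=set0 -> exists2 r, sep C m r & is_side r C.
Proof.
set z := cpt C; set w := plane_point (to_circle (la m)).
have [zD zl] := (cantorgon_setP C z).1 (cantorgon_mem C).
have wl n : n <> m -> has_sign (sd n m) (lam n w) by move=> nm; have [] := lam_leaf nm.
(* The parameter at which the segment from [z] to [w] crosses the line of [n]. *)
pose t n := lam n z / (lam n z - lam n w).
move=> /(finite_argmin t (sep_finite C m))[r [rm rC] rmin]; exists r => //.
have sepP n : sep C m n -> has_sign (~~ sg C n) (lam n w).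
  move=> [nm nC]; have := wl n nm; suff -> : sd n m = ~~ sg C n by [].
  by case: (sd n m) (sg C n) nC => -[].
have tP n : sep C m n -> 0 < t n < 1.
  move=> nS; have := sepP _ nS; have := zl n; rewrite /t.
  case: (sg C n) => /= h1 h2.
    by rewrite divr_gt0 ?ltr_pdivrMr; lra.
  by rewrite -mulrNN -invrN divr_gt0 ?ltr_pdivrMr; lra.
have t0 n : sep C m n -> (1 - t n) * lam n z + t n * lam n w = 0.
  move=> nS; have : lam n z - lam n w != 0.
    by have := sepP _ nS; have := zl n; case: (sg C n) => /= h1 h2; rewrite subr_eq0 neq_lt; apply/orP; [right|left]; lra.
  by rewrite /t => ?; field.
have rS : sep C m r by split.
have /andP[tr0 tr1] := tP r rS; pose v := seg w z (1 - t r).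
have lamv n : lam n v = (1 - t r) * lam n z + t r * lam n w by rewrite lam_seg; ring.
have : chord r v.
  apply: lam_chord; last by rewrite lamv t0.
  by apply: norm2_seg; rewrite ?norm2_point//; lra.
move=> [x [y [s [/leaf_endsE xr /leaf_endsE yr s01 vE]]]].
have {}vE : v = seg (plane_point x) (plane_point y) s by rewrite vE.
have vr n : n <> r -> has_sign (sd n r) (lam n v).
  move=> nr; rewrite vE; have [h1 h2] := lam_leaf nr.
  have hx : has_sign (sd n r) (lam n (plane_point x)) by case: xr => ->.
  have hy : has_sign (sd n r) (lam n (plane_point y)) by case: yr => ->.
  have [s0|s0] := eqVneq s 0.
    by rewrite s0 /seg subr0 !mul0r !mul1r !addr0 -surjective_pairing.
  rewrite lam_seg; apply: has_sign_comb => //; last by right.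
  by move: s01; rewrite le_eqVlt eq_sym (negPf s0).
apply/sideP => n nr; apply: has_sign_inj (vr n nr) _; rewrite lamv.
(* A leaf separating [C] from [m] is crossed no earlier than [r], and not at [v], so [v] is still on
   the side of [C]. Any other leaf has the whole segment weakly on the side of [C]. *)
have [nS|nS] := pselect (sep C m n).
  have vn0 := has_sign_neq0 (vr n nr); rewrite lamv in vn0.
  have tn := rmin n nS; have := sepP n nS; have := zl n.
  set e := (1 - t r) * lam n z + _ in vn0 *.
  have eE : e = (t n - t r) * (lam n z - lam n w).
    by rewrite -[RHS]add0r -(t0 n nS) /e; ring.
  case: (sg C n) => /= h1 h2.
    by rewrite lt_def vn0 eE mulr_ge0//; lra.
  by rewrite lt_def eq_sym vn0 eE mulr_ge0_le0//; lra.
have := @has_sign_comb _ (sg C n) (lam n w) (lam n z) (1 - t r).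
have -> : (1 - (1 - t r)) * lam n w + (1 - t r) * lam n z = (1 - t r) * lam n z + t r * lam n w by ring.
apply; [lra| |exact: zl].
have [->|nm] := pselect (n = m); first by left; apply: lam_end; left.
right; have -> : sg C n = sd n m; last exact: wl.
by apply: contrapT => /nesym ?; apply: nS.
Qed.

Lemma side_of_sep0 C m : ~ (sep C m !=set0) -> is_side m C.
Proof.
move=> S0; apply/sideP => n nm; apply: contrapT => nC; apply: S0.
by exists n.
Qed.

(** Connectedness of the tree, as induction on the number of leafs between [C] and [m]: crossing the
    nearest side [r] removes [r] from the separating leafs and adds none. *)
Lemma tree_ind (Q : @cantorgon R -> @leaf R -> Prop) :
  (forall C m, is_side m C -> Q C m) ->
  (forall C C' r m, is_side r C -> is_side r C' -> sg C' r = ~~ sg C r -> r <> m ->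
     sd r m = sg C' r -> Q C' m -> Q C m) ->
  forall C m, Q C m.
Proof.
move=> Qs Qi C m; have /finite_seqP[s sE] := sep_finite C m.
have {sE} : sep C m `<=` [set` s] by rewrite sE.
have [k] := ubnP (size s); elim: k => // k IH in C s *; rewrite ltnS => sk Cs.
have [/nearest_side[r rS rC]|/side_of_sep0] := pselect (sep C m !=set0); last exact: Qs.
have [C' [rC' sC']] := side_exists_sg r (~~ sg C r).
have rm : sd r m = sg C' r by rewrite sC'; case: rS => _; case: (sd r m) (sg C r) => -[].
apply: (Qi C C' r m) => //; first by case: rS.
apply: (IH _ [seq n <- s | n != r]).
  apply: leq_trans sk; rewrite size_filter -(count_predC (pred1 r) s).
  rewrite -[X in (X < _)%N]add0n ltn_add2r -has_count.
  by apply/hasP; exists r => //=; exact: (Cs r rS).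
move=> n [nm nC']; have nr : n <> r by move=> nr; apply: nC'; rewrite nr.
rewrite /= mem_filter /=; apply/andP; split; first exact/eqP.
apply: Cs; split=> // nC; apply: nC'; rewrite nC.
by rewrite -(side_sd rC nr) -(side_sd rC' nr).
Qed.

End Tree.

(** * Arcs between leafs *)

Section Arcs.
Context {R : realType}.
Implicit Types (s t u a b : R) (l m n p q r : @leaf R) (C : @cantorgon R)
  (g : cyc_aut (basilica_tree R)).

Definition is_end l t := t = la l \/ t = lb l.

Lemma is_end_itv l t : is_end l t -> 0 < t <= 2.
Proof. by have [? ?] := leaf_end_itv l; move=> [->|->]. Qed.

Lemma is_end_neq l m s t : l <> m -> is_end l s -> is_end m t -> s != t.
Proof. by move=> /la_neq[? ? ? ?] [->|->] [->|->]. Qed.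

Lemma lab_neq l : la l != lb l /\ lb l != la l.
Proof. by have [_ lt _] := leaf_ltW l; rewrite (lt_eqF lt) (gt_eqF lt). Qed.

Lemma sd_is_end l m t : l <> m -> is_end m t -> inl l t = sd l m.
Proof. by move=> lm [->//|->]; rewrite -sd_end. Qed.

Lemma cyc_sep l a b : a != la l -> a != lb l -> b != la l -> b != lb l -> a != b ->
  (cyc a (la l) b == cyc a (lb l) b) = (inl l a == inl l b).
Proof.
have [_ ab _] := leaf_ltW l; rewrite /inl /cyc.
case: (ltgtP a (la l)) => //; case: (ltgtP a (lb l)) => //;
case: (ltgtP b (la l)) => //; case: (ltgtP b (lb l)) => //;
case: (ltgtP a b) => //=; lra.
Qed.

(** Changing sides of [l] takes passing an end of [l]: an arc that starts at one end and avoids the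
    other stays on the side of [b]. *)
Lemma cyc_across l a a' b s : is_end l a -> is_end l a' -> a != a' -> cyc a a' b = false ->
  b != la l -> b != lb l -> s != la l -> s != lb l ->
  inl l s != inl l b -> cyc a s b = false.
Proof.
have [_ ab _] := leaf_ltW l; rewrite /inl /cyc.
move=> [->|->] [->|->]; rewrite ?eqxx// => _;
case: (ltgtP s (la l)) => //; case: (ltgtP s (lb l)) => //;
case: (ltgtP b (la l)) => //; case: (ltgtP b (lb l)) => //;
case: (ltgtP s b) => //=; lra.
Qed.

Lemma cyc_acrossV l a b b' s : is_end l b -> is_end l b' -> b != b' -> cyc a b' b = false ->
  a != la l -> a != lb l -> s != la l -> s != lb l ->
  inl l s != inl l a -> cyc a s b = false.
Proof.
have [_ lt _] := leaf_ltW l; rewrite /inl /cyc.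
move=> [->|->] [->|->]; rewrite ?eqxx// => _;
case: (ltgtP s (la l)) => //; case: (ltgtP s (lb l)) => //;
case: (ltgtP a (la l)) => //; case: (ltgtP a (lb l)) => //;
case: (ltgtP s a) => //=; lra.
Qed.

(** The open arc from [a] to [b] is then a union of classes of the Basilica relation, so its image
    is open ([U_open]). *)
Definition sat a b := forall m, cyc a (la m) b = cyc a (lb m) b.

(** The case [p = q] is included: the arc is then one of the two sides of [p]. *)
Definition leaf_arc p q a b := [/\ is_end p a, is_end q b, a != b & sat a b].

Lemma cyc_xxy s t : cyc s s t = false.
Proof. by rewrite /cyc ltxx; apply/negP => /or3P[] /andP[]; lra. Qed.

Lemma cyc_xyy s t : cyc s t t = false.
Proof. by rewrite cyc_rot cyc_rot; rewrite /cyc ltxx; apply/negP => /or3P[] /andP[]; lra. Qed.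

Lemma arc_endsF p q a b m t : leaf_arc p q a b -> m = p \/ m = q -> is_end m t -> cyc a t b = false.
Proof.
move=> [[->|->] [->|->] ab S] [->|->] [->|->]; have := S p; have := S q;
  by rewrite ?cyc_xxy ?cyc_xyy// => <-.
Qed.

Lemma arc_unsep p q a b : leaf_arc p q a b -> unsep p q.
Proof.
move=> [pa qb ab S] n np nq; have /eqP := S n.
have nn t m : n <> m -> is_end m t -> t != la n /\ t != lb n.
  by move=> nm mt; split; apply: (is_end_neq (nesym nm) mt); [left|right].
have [a1 a2] := nn _ _ np pa; have [b1 b2] := nn _ _ nq qb.
by rewrite cyc_sep// (sd_is_end np pa) (sd_is_end nq qb) => /eqP.
Qed.

Lemma arc_halfP p a b : leaf_arc p p a b ->
  exists c : bool, forall m, m <> p -> cyc a (la m) b = (sd p m == c).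
Proof.
have [_ plt _] := leaf_ltW p.
move=> [[->|->] [->|->]]; rewrite ?eqxx// => _ _; [exists true|exists false] => m mp;
  have [? ? ? ?] := la_neq mp; rewrite /sd /inl /cyc; apply/idP/idP.
- by move=> /or3P[] /andP[]; rewrite eqb_id; lra.
- by rewrite eqb_id => ->.
- by move=> /or3P[] /andP[]; rewrite eqbF_neg negb_and -!leNgt; lra.
- rewrite eqbF_neg negb_and -!leNgt !le_eqVlt; case: (ltgtP (la m) (la p)) => //; case: (ltgtP (la m) (lb p)) => //=; lra.
Qed.

Lemma cyc_in l t : cyc (la l) t (lb l) = inl l t.
Proof.
have [_ lt _] := leaf_ltW l; rewrite /cyc /inl; apply/idP/idP; last by move=> ->.
by move=> /or3P[] /andP[]; lra.
Qed.

Lemma cyc_out l t : t != la l -> t != lb l -> cyc (lb l) t (la l) = ~~ inl l t.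
Proof.
by move=> ta tb; rewrite -cyc_in; apply: cycC => //; [rewrite eq_sym|have [] := lab_neq l].
Qed.

Lemma leaf_arcs p : leaf_arc p p (la p) (lb p) /\ leaf_arc p p (lb p) (la p).
Proof.
split; (split; [by [left|right]|by [left|right]|by have [] := lab_neq p|] => m;
  have [->|mp] := pselect (m = p); first by rewrite cyc_xxy cyc_xyy);
  have [? ? ? ?] := la_neq mp.
  by rewrite !cyc_in inl_leaf//; exact: nesym.
by rewrite !cyc_out// inl_leaf//; exact: nesym.
Qed.

Lemma arc_half_exists p c : exists a b, leaf_arc p p a b /\
  forall m, m <> p -> cyc a (la m) b = (sd p m == c).
Proof.
have [S1 S2] := leaf_arcs p.
have [m [pm _ mc]] := neighbour p c.
have [[c1 C1] [c2 C2]] := (arc_halfP S1, arc_halfP S2).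
have [c1E|c1E] := eqVneq c1 c; first by exists (la p), (lb p); rewrite -c1E.
exists (lb p), (la p); split=> // k kp; rewrite C2//; congr (_ == _).
have E : cyc (lb p) (la m) (la p) = ~~ cyc (la p) (la m) (lb p).
  by apply: cycC; [have [] := la_neq pm|have [] := la_neq (nesym pm)|by have [] := lab_neq p].
move: E; rewrite (C1 m (nesym pm)) (C2 m (nesym pm)) mc [c == c1]eq_sym (negPf c1E).
by move/eqP.
Qed.

(** This describes the leafs in the arc in terms that an automorphism respects: sides of [p] and
    [q], and cyclic order. Beyond [p] and [q] the arc has no leafs ([cyc_across], [cyc_acrossV]);
    between them, an end of [p] or [q] may be replaced by the other one. *)
Lemma arc_pqP p q a b m : p <> q -> leaf_arc p q a b -> m <> p -> m <> q ->
  cyc a (la m) b = [&& sd p m == sd p q, sd q m == sd q p & cyc (la p) (la m) (la q)].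
Proof.
move=> pq A mp mq; have [pa qb ab S] := A.
have nn l k t : l <> k -> is_end k t -> t != la l /\ t != lb l.
  by move=> nm mt; split; apply: (is_end_neq (nesym nm) mt); [left|right].
have [m1 m2] := nn p m (la m) (nesym mp) (or_introl erefl).
have [m3 m4] := nn q m (la m) (nesym mq) (or_introl erefl).
have [a1 a2] := nn q p a (nesym pq) pa.
have [b1 b2] := nn p q b pq qb.
have [q1 q2] := nn p q (la q) pq (or_introl erefl).
have sp : sd p q = inl p b by rewrite (sd_is_end pq qb).
have sq : sd q p = inl q a by rewrite (sd_is_end (nesym pq) pa).
have other l t : is_end l t -> exists2 t', is_end l t' & t != t'.
  by have [? ?] := lab_neq l; move=> [->|->]; [exists (lb l) => //; right|exists (la l) => //; left].
have [|np] := eqVneq (sd p m) (sd p q); last first.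
  have [a' pa' aa'] := other _ _ pa.
  by rewrite (@cyc_across p a a')// ?(arc_endsF A _ pa')//; [left|rewrite -sp].
have [|nq] := eqVneq (sd q m) (sd q p); last first.
  have [b' qb' bb'] := other _ _ qb => _ /=.
  by rewrite (@cyc_acrossV q a b b')// ?(arc_endsF A _ qb')//; [right|rewrite -sq].
move=> qm pm /=; have pmb : sd p m = inl p b by rewrite pm.
have laq : inl p (la q) = sd p q by [].
have -> : cyc (la p) (la m) (la q) = cyc a (la m) (la q).
  by case: pa => -> //; apply: cyc_end; rewrite // -/(sd p m) pm.
have qm' : inl q (la m) = inl q a by rewrite -sq -qm.
by case: qb => -> //; rewrite [LHS]cyc_rot [LHS]cyc_rot [RHS]cyc_rot [RHS]cyc_rot;
  apply/esym/cyc_end.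
Qed.

Lemma arc_pq_exists p q : p <> q -> unsep p q -> exists a b, leaf_arc p q a b.
Proof.
(* The ends are chosen so that the arc leaves [p] on the side of [q] and reaches [q] on the side of
   [p], without passing the other end of either. *)
move=> pq U; pose a := if sd p q then la p else lb p.
pose b := if sd q p then lb q else la q.
have pa : is_end p a by rewrite /a; case: ifP; [left|right].
have qb : is_end q b by rewrite /b; case: ifP; [right|left].
have nn l k t : l <> k -> is_end k t -> t != la l /\ t != lb l.
  by move=> nm mt; split; apply: (is_end_neq (nesym nm) mt); [left|right].
have [b1 b2] := nn p q b pq qb; have [a1 a2] := nn q p a (nesym pq) pa.
have ab : a != b by exact: is_end_neq pa qb.
exists a, b; split=> // m.
have [->|mp] := pselect (m = p).
  have pb := sd_is_end pq qb; have [_ plt _] := leaf_ltW p; clearbody b.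
  move: pb; rewrite /a /inl /cyc; case: (sd p q);
  by case: (ltgtP b (la p)) => //; case: (ltgtP b (lb p)) => //; rewrite ?ltxx//=; lra.
have [->|mq] := pselect (m = q).
  have qa := sd_is_end (nesym pq) pa; have [_ qlt _] := leaf_ltW q; clearbody a.
  move: qa; rewrite /b /inl /cyc; case: (sd q p);
  by case: (ltgtP a (la q)) => //; case: (ltgtP a (lb q)) => //; rewrite ?ltxx//=; lra.
have [m1 m2] := nn m p a mp pa; have [m3 m4] := nn m q b mq qb.
by apply/eqP; rewrite cyc_sep// (sd_is_end mp pa) (sd_is_end mq qb) (U m).
Qed.

Lemma aut_side g l C : is_side (aut_e g l) (aut_v g C) <-> is_side l C.
Proof. exact: (aut_incident g). Qed.

Lemma aut_e_inj g : injective (aut_e g : @leaf R -> @leaf R).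
Proof. exact: can_inj (@aut_eK _ g). Qed.

(** The sides of a leaf are the halves of the tree cut at an edge: on the way from [C] to [m],
    crossing edges other than [l] does not change the side of [l]. *)
Lemma aut_sdW g C m l : l <> m -> sd l m = sg C l ->
  sd (aut_e g l) (aut_e g m) = sg (aut_v g C) (aut_e g l).
Proof.
move: l; move: C m; apply: tree_ind => [C m mC l lm _|C C' r m rC rC' sC' rm rmC' IH l lm lmC].
  by apply: side_sd; [exact/aut_side|move/aut_e_inj].
have lr : l <> r by move=> lr; move: lmC; rewrite lr rmC' sC'; case: (sg C r).
have grl : aut_e g l <> aut_e g r by move/aut_e_inj.
rewrite (IH l lm); last by rewrite lmC -(side_sd rC lr) (side_sd rC' lr).
have h1 : is_side (aut_e g r) (aut_v g C) by exact/aut_side.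
have h2 : is_side (aut_e g r) (aut_v g C') by exact/aut_side.
by rewrite -(side_sd h1 grl) (side_sd h2 grl).
Qed.

Lemma aut_sd g C m l : l <> m ->
  (sd (aut_e g l) (aut_e g m) == sg (aut_v g C) (aut_e g l)) = (sd l m == sg C l).
Proof.
move=> lm; apply/idP/idP => /eqP H; apply/eqP; last exact: aut_sdW.
have lm' : aut_e g l <> aut_e g m by move/aut_e_inj.
have := @aut_sdW (g^-1)%g _ _ _ lm' H.
by rewrite /= !aut_eK aut_vK.
Qed.

Lemma side_cycP C p q r : is_side p C -> is_side q C -> is_side r C ->
  p <> q -> q <> r -> p <> r -> side_cyc C p q r <-> cyc (la p) (la q) (la r).
Proof.
move=> pC qC rC pq qr pr.
have E x y z l m k : is_side l C -> is_side m C -> is_side k C -> l <> m -> m <> k -> l <> k ->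
    is_end l x -> is_end m y -> is_end k z -> cyc x y z = cyc (la l) y z.
  move=> lC mC kC lm mk lk [->//|->] my kz; apply/esym/cyc_end.
  - by rewrite (sd_is_end lm my) (sd_is_end lk kz) (side_sd mC) ?(side_sd kC).
  - by apply: (is_end_neq (nesym lm) my); left.
  - by apply: (is_end_neq (nesym lm) my); right.
  - by apply: (is_end_neq (nesym lk) kz); left.
  - by apply: (is_end_neq (nesym lk) kz); right.
have laE l : is_end l (la l) by left.
split=> [[_ _ _ _ [x [y [z [xp yq zr]]]]]|H].
  rewrite circle_cycP.
  have H l w : leaf_ends l w -> is_end l (crd w).
    have [l1 l2] := leaf_end_itv l.
    by move=> /leaf_endsE[->|->]; [left|right]; rewrite to_circleK.
  have e1 : cyc (crd x) (crd y) (crd z) = cyc (la p) (crd y) (crd z).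
    by apply: (E _ _ _ p q r) => //; exact: H.
  have e2 : cyc (crd y) (crd z) (la p) = cyc (la q) (crd z) (la p).
    by apply: (E _ _ _ q r p); rewrite //; try exact: nesym; try exact: H.
  have e3 : cyc (crd z) (la p) (la q) = cyc (la r) (la p) (la q).
    by apply: (E _ _ _ r p q); rewrite //; try exact: nesym; try exact: H.
  by rewrite e1 cyc_rot e2 cyc_rot e3 cyc_rot.
split=> //; exists (to_circle (la p)), (to_circle (la q)), (to_circle (la r)).
have [p02 _] := leaf_end_itv p; have [q02 _] := leaf_end_itv q; have [r02 _] := leaf_end_itv r.
by split; [apply/leaf_endsE; left|apply/leaf_endsE; left|apply/leaf_endsE; left|exact/circle_cycE].
Qed.

(* The side of [C] towards [m] has the same cyclic position as [m]. *)
Lemma towards_side C p q m : p <> q -> is_side p C -> is_side q C -> m <> p -> m <> q ->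
  sd p m = sg C p -> sd q m = sg C q ->
  exists r, [/\ is_side r C, r <> p, r <> q & r = m \/ r <> m /\ sd r m <> sg C r].
Proof.
move=> pq pC qC mp mq pm qm.
have [/nearest_side[r [rm rs] rC]|/side_of_sep0 mC] := pselect (sep C m !=set0).
  by exists r; split=> //; [move=> rp; apply: rs; rewrite rp|move=> rq; apply: rs; rewrite rq|right].
by exists m; split=> //; left.
Qed.

(** If [r] separates [m] from [C], then [m] lies behind [r] as seen from [p] and [q], and
    [cyc_behind] applies. *)
Lemma towards_cyc C p q m r : p <> q -> is_side p C -> is_side q C -> m <> p -> m <> q ->
  r <> p -> r <> q -> r = m \/ r <> m /\ sd r m <> sg C r ->
  cyc (la p) (la m) (la q) = cyc (la p) (la r) (la q).
Proof.
move=> pq pC qC mp mq rp rq [->//|[rm rs]].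
have pr : sd r p = sg C r by apply: side_sd.
have qr : sd r q = sg C r by apply: side_sd.
rewrite cyc_rot [RHS]cyc_rot; apply/esym/cyc_behind.
- by rewrite -/(sd r p) -/(sd r q) pr qr.
- by rewrite -/(sd r m) -/(sd r q) qr; case: (sd r m) (sg C r) rs => -[].
all: first [by have [] := la_neq rq | by have [] := la_neq (nesym rq)
  | by have [] := la_neq rp | by have [] := la_neq (nesym rp)
  | by have [] := la_neq rm | by have [] := la_neq (nesym rm)].
Qed.

(** At the Cantorgon shared by [p] and [q] the cyclic order is kept or reversed; accordingly the
    image arc runs from the image of [p] to that of [q] or back. For [p = q] the arc is a side of
    [p], and no cyclic order is involved. *)
Lemma aut_arc g p q a b : leaf_arc p q a b -> exists p' q' a' b',
  [/\ leaf_arc p' q' a' b',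
      (p' = aut_e g p /\ q' = aut_e g q) \/ (p' = aut_e g q /\ q' = aut_e g p) &
      forall m, cyc a (la m) b = cyc a' (la (aut_e g m)) b'].
Proof.
move=> A; pose G : @leaf R -> @leaf R := aut_e g.
have GI : injective G := @aut_e_inj g.
have pqF p1 q1 a1 b1 p2 q2 a2 b2 : leaf_arc p1 q1 a1 b1 -> leaf_arc p2 q2 a2 b2 ->
    (p2 = G p1 /\ q2 = G q1) \/ (p2 = G q1 /\ q2 = G p1) ->
    (forall m, m <> p1 -> m <> q1 -> cyc a1 (la m) b1 = cyc a2 (la (G m)) b2) ->
    forall m, cyc a1 (la m) b1 = cyc a2 (la (G m)) b2.
  move=> A1 A2 E H m; have [mp|mp] := pselect (m = p1).
    rewrite (arc_endsF A1 (or_introl mp)); last by left.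
    by rewrite (arc_endsF A2 (m := G m))//; [case: E => -[-> ->]; rewrite mp; [left|right]|left].
  have [mq|mq] := pselect (m = q1); last exact: H.
  rewrite (arc_endsF A1 (or_intror mq)); last by left.
  by rewrite (arc_endsF A2 (m := G m))//; [case: E => -[-> ->]; rewrite mq; [right|left]|left].
have [pq|pq] := pselect (p = q).
  rewrite -pq in A *; have [c Ac] := arc_halfP A.
  (* [C] is the Cantorgon adjacent to [p] on the side of the arc; its image tells which side of
     [G p] to take. *)
  have [C [pC sC]] := side_exists_sg p c.
  have [a' [b' [A' Ac']]] := arc_half_exists (G p) (sg (aut_v g C) (G p)).
  exists (G p), (G p), a', b'; split=> //; first by left.
  apply: (pqF _ _ _ _ _ _ _ _ A A'); first by left.
  move=> m mp _; rewrite Ac// Ac'; last by move/GI.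
  by rewrite -sC; apply/esym/aut_sd/nesym.
have [C [pC qC sC]] := unsep_common pq (arc_unsep A).
have GpC : is_side (G p) (aut_v g C) by exact/aut_side.
have GqC : is_side (G q) (aut_v g C) by exact/aut_side.
have Gpq : G p <> G q by move/GI.
have cond m : m <> p -> m <> q ->
    (sd (G p) (G m) == sd (G p) (G q)) = (sd p m == sd p q) /\
    (sd (G q) (G m) == sd (G q) (G p)) = (sd q m == sd q p).
  move=> mp mq; rewrite (side_sd GqC Gpq) (side_sd GpC (nesym Gpq)).
  rewrite (side_sd qC pq) (side_sd pC (nesym pq)).
  by split; apply: aut_sd; exact: nesym.
(* Orientation is known on the sides of [C] only, so [m] is replaced by the side of [C] towards it,
   both before and after applying [g]. *)
have key m : m <> p -> m <> q -> sd p m == sd p q -> sd q m == sd q p ->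
    exists r, [/\ is_side r C, r <> p, r <> q,
      cyc (la p) (la m) (la q) = cyc (la p) (la r) (la q) &
      cyc (la (G p)) (la (G m)) (la (G q)) = cyc (la (G p)) (la (G r)) (la (G q))].
  move=> mp mq; rewrite (side_sd qC pq) (side_sd pC (nesym pq)) => /eqP pm /eqP qm.
  have [r [rC rp rq rm]] := towards_side pq pC qC mp mq pm qm; exists r; split=> //.
    exact: towards_cyc rm.
  apply: (towards_cyc Gpq GpC GqC); [by move/GI..|].
  case: rm => [->|[rm rs]]; [by left|right; split; first by move/GI].
  by move=> /eqP; rewrite aut_sd// => /eqP.
have neq3 m : m <> p -> m <> q -> [/\ la p != la m, la m != la q & la p != la q].
  by move=> mp mq; split; [have [] := la_neq (nesym mp)|have [] := la_neq mq|have [] := la_neq pq].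
have G3 m : m <> p -> m <> q -> [/\ la (G p) != la (G m), la (G m) != la (G q) & la (G p) != la (G q)].
  move=> mp mq; have np : G p <> G m by move/GI/esym.
  have nq : G m <> G q by move/GI.
  by split; [have [] := la_neq np|have [] := la_neq nq|have [] := la_neq Gpq].
case: (aut_respects g C) => resp.
- have [a' [b' A']] := arc_pq_exists Gpq (sides_unsep GpC GqC).
  exists (G p), (G q), a', b'; split=> //; first by left.
  apply: (pqF _ _ _ _ _ _ _ _ A A'); first by left.
  move=> m mp mq; rewrite (arc_pqP pq A)// (arc_pqP Gpq A'); [|by move/GI..].
  have [-> ->] := cond m mp mq; case E1: (sd p m == _) => //=; case E2: (sd q m == _) => //=.
  have [r [rC rp rq -> ->]] := key m mp mq E1 E2.
  have GrC : is_side (G r) (aut_v g C) by exact/aut_side.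
  have Gpr : G p <> G r by move/GI/esym.
  have Grq : G r <> G q by move/GI.
  have H : side_cyc C p r q <-> side_cyc (aut_v g C) (G p) (G r) (G q) := resp p r q pC rC qC.
  have e1 := side_cycP pC rC qC (nesym rp) rq pq.
  have e2 := side_cycP GpC GrC GqC Gpr Grq Gpq.
  by apply/idP/idP => [/e1/H/e2|/e2/H/e1].
- have [a' [b' A']] := arc_pq_exists (nesym Gpq) (sides_unsep GqC GpC).
  exists (G q), (G p), a', b'; split=> //; first by right.
  apply: (pqF _ _ _ _ _ _ _ _ A A'); first by right.
  move=> m mp mq; rewrite (arc_pqP pq A)// (arc_pqP (nesym Gpq) A'); [|by move/GI..].
  have [-> ->] := cond m mp mq; rewrite [RHS]andbCA.
  case E1: (sd p m == _) => //=; case E2: (sd q m == _) => //=.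
  have [r [rC rp rq -> KE]] := key m mp mq E1 E2.
  have [g1 g2 g3] := G3 m mp mq; have [g4 g5 g6] := G3 r rp rq.
  rewrite [RHS]cycC; [|by rewrite eq_sym..]; rewrite KE -cycC; [|by rewrite // eq_sym..].
  have GrC : is_side (G r) (aut_v g C) by exact/aut_side.
  have Gqr : G q <> G r by move/GI/esym.
  have Grp : G r <> G p by move/GI.
  have H : side_cyc C p r q <-> side_cyc (aut_v g C) (G q) (G r) (G p) := resp p r q pC rC qC.
  have e1 := side_cycP pC rC qC (nesym rp) rq pq.
  have e2 := side_cycP GqC GrC GpC Gqr Grp (nesym Gpq).
  by apply/idP/idP => [/e1/H/e2|/e2/H/e1].
Qed.

End Arcs.

(** * Topology of the Basilica *)

Section Topology.
Context {R : realType}.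
Implicit Types (s t u a b : R) (l m n p q r : @leaf R) (C : @cantorgon R)
  (x y : basilica R) (O : set (basilica R)).

Definition bq t : basilica R := to_basilica (to_circle t).

Lemma bq_open O : open O <-> open (bq @^-1` O).
Proof. by []. Qed.

Lemma bq_continuous : continuous bq.
Proof. by apply/continuousP => O /bq_open. Qed.

Lemma bq_surj x : exists2 t, 0 < t <= 2 & bq t = x.
Proof.
by exists (crd (repr x)); [exact: crd_itv|rewrite /bq crdK; exact: reprK].
Qed.

Lemma bqE s t : 0 < s <= 2 -> 0 < t <= 2 ->
  bq s = bq t <-> s = t \/ exists l, is_end l s /\ is_end l t.
Proof.
move=> s02 t02; rewrite /bq to_basilicaE basilica_relP; split.
- move=> [/to_circle_inj|[n [k [nk /to_circle_inj sE /to_circle_inj tE]]]|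
    [n [k [nk /to_circle_inj tE /to_circle_inj sE]]]]; first by left; auto.
  + right; exists (mkleaf nk); have [_ _ aE bE] := @mkleafE R _ _ nk.
    rewrite /is_end aE bE; split; [left; apply: sE|right; apply: tE] => //.
      by have := @code_end_itv R n k 1%N nk isT.
    by have := @code_end_itv R n k 2%N nk isT.
  + right; exists (mkleaf nk); have [_ _ aE bE] := @mkleafE R _ _ nk.
    rewrite /is_end aE bE; split; [right; apply: sE|left; apply: tE] => //.
      by have := @code_end_itv R n k 2%N nk isT.
    by have := @code_end_itv R n k 1%N nk isT.
- move=> [->|[l [sl tl]]]; first by constructor.
  have ab : code_pair (to_circle (la l)) (to_circle (lb l)).
    by exists (lv l), (lk l); split=> //; exact: leaf_code.
  by case: sl tl => -> [->|->]; [apply: Or31|apply: Or32|apply: Or33|apply: Or31].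
Qed.

Definition pt l : basilica R := bq (la l).

Lemma bq_end l t : is_end l t -> bq t = pt l.
Proof.
by move=> lt; apply/bqE; [exact: is_end_itv lt|apply: is_end_itv; left|right; exists l; split=> //; left].
Qed.

Lemma is_end_inj l m t : is_end l t -> is_end m t -> l = m.
Proof. by move=> lt mt; apply: contrapT => lm; have := is_end_neq lm lt mt; rewrite eqxx. Qed.

Lemma bq_ptP l t : 0 < t <= 2 -> bq t = pt l <-> is_end l t.
Proof.
move=> t02; split; last exact: bq_end.
have l02 := (leaf_end_itv l).1.
move=> /(bqE t02 l02)[->|[m [mt ml]]]; first by left.
by rewrite (is_end_inj (l := l) (m := m) (t := la l))//; left.
Qed.

Lemma pt_inj : injective pt.
Proof.
move=> l m /esym/bq_ptP lm; apply: (@is_end_inj l m (la m)); last by left.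
by apply: lm; have [] := leaf_end_itv m.
Qed.

Lemma to_circle_neq_open s : open [set t : R | to_circle t <> to_circle s].
Proof.
rewrite openE => t /= ts; pose k := Num.floor ((t - s) / 2).
have k1 : s + 2 * k%:~R <= t by have := floor_le ((t - s) / 2); rewrite -/k; lra.
have k2 : t < s + 2 * k%:~R + 2.
  by have := floorD1_gt ((t - s) / 2); rewrite -/k intrD; lra.
have {}k1 : s + 2 * k%:~R < t.
  rewrite lt_neqAle k1 andbT; apply/eqP => st; apply: ts; rewrite -st; exact: to_circleD2.
have : open `]s + 2 * k%:~R, s + 2 * k%:~R + 2[%classic by exact: interval_open.
rewrite openE => /(_ t); rewrite /= in_itv/= k1 k2 => /(_ isT); apply: filterS.
move=> u /=; rewrite in_itv/= => /andP[u1 u2]; rewrite -(to_circleD2 s k) => /to_circle_near us.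
suff : u = s + 2 * k%:~R by lra.
by apply: us; rewrite ltr_norml; lra.
Qed.

Lemma circle_cyc_open (w z : circle R) : open [set t : R | circle_cyc w (to_circle t) z].
Proof.
rewrite openE => t /= [a [b [c [-> /to_circleE[k tE] -> [ab bc ca]]]]].
have : open `]a + 2 * k%:~R, c + 2 * k%:~R[%classic by exact: interval_open.
rewrite openE => /(_ t); rewrite /= in_itv/=.
rewrite (_ : _ && _); last by rewrite tE !ltrD2r ab bc.
move=> /(_ isT); apply: filterS => u /=; rewrite in_itv/= => /andP[u1 u2].
exists (a + 2 * k%:~R), u, (c + 2 * k%:~R); rewrite !to_circleD2; split=> //.
by split=> //; lra.
Qed.

Lemma bq_neq_open x : open [set y | y <> x].
Proof.
apply/bq_open; have [s s02 <-] := bq_surj x.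
(* A class has at most two points; for a point that is no end of a leaf, [s' = s]. *)
have [s' s'02 ss'] : exists2 s', 0 < s' <= 2 & forall t, 0 < t <= 2 ->
    bq t = bq s <-> t = s \/ t = s'.
  have [[l ls]|nl] := pselect (exists l, is_end l s).
    have [l1 l2] := leaf_end_itv l.
    case: (ls) => sE; [exists (lb l) => //|exists (la l) => //] => t t02; rewrite (bq_end ls) bq_ptP//.
      by rewrite sE.
    by rewrite sE /is_end; tauto.
  exists s => // t t02; rewrite bqE//; split; last by case; left.
  by case=> [|[l [_ ls]]]; [left|case: nl; exists l].
rewrite (_ : _ @^-1` _ = [set t | to_circle t <> to_circle s] `&` [set t | to_circle t <> to_circle s']).
  by apply: openI; exact: to_circle_neq_open.
apply/seteqP; split=> t /=; rewrite -(crdK (to_circle t)); set u := crd _.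
  have u02 : 0 < u <= 2 by exact: crd_itv.
  have -> : bq t = bq u by rewrite /bq crdK.
  rewrite ss'// => us; split=> /to_circle_inj; auto.
have u02 : 0 < u <= 2 by exact: crd_itv.
have -> : bq t = bq u by rewrite /bq crdK.
by rewrite ss'// => -[us us'] [ut|ut]; [apply: us|apply: us']; rewrite ut.
Qed.

Definition U a b : set (basilica R) := [set bq t | t in [set t | 0 < t <= 2 /\ cyc a t b]].

Lemma sat_bq a b s t : sat a b -> 0 < s <= 2 -> 0 < t <= 2 -> bq s = bq t ->
  cyc a s b = cyc a t b.
Proof.
by move=> S s02 t02 /(bqE s02 t02)[->//|[l [[->|->] [->|->]]]]; rewrite // (S l).
Qed.

Lemma UP a b t : sat a b -> 0 < t <= 2 -> U a b (bq t) <-> cyc a t b.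
Proof.
move=> S t02; split=> [[s [s02 sc] st]|tc]; last by exists t.
by rewrite -(sat_bq S s02 t02).
Qed.

Lemma cyc_lift a b t : 0 < a <= 2 -> 0 < b <= 2 ->
  circle_cyc (to_circle a) (to_circle t) (to_circle b) <-> cyc a (crd (to_circle t)) b.
Proof. by move=> a02 b02; rewrite circle_cycP (to_circleK a02) (to_circleK b02). Qed.

Lemma U_preimage a b : sat a b -> 0 < a <= 2 -> 0 < b <= 2 ->
  bq @^-1` (U a b) = [set t | circle_cyc (to_circle a) (to_circle t) (to_circle b)].
Proof.
move=> S a02 b02; apply/seteqP.
have key t : U a b (bq t) <-> circle_cyc (to_circle a) (to_circle t) (to_circle b).
  have -> : bq t = bq (crd (to_circle t)) by rewrite /bq crdK.
  by rewrite UP ?crd_itv// cyc_lift.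
by split=> t /key.
Qed.

Lemma U_open a b : sat a b -> 0 < a <= 2 -> 0 < b <= 2 -> open (U a b).
Proof. by move=> S a02 b02; apply/bq_open; rewrite U_preimage//; exact: circle_cyc_open. Qed.

(** Off the two boundary points, the complement of [U a b] comes from the complementary arc, which
    is open as well. *)
Lemma Uc_open a b : sat a b -> 0 < a <= 2 -> 0 < b <= 2 -> a != b ->
  open [set x | [/\ x <> bq a, x <> bq b & ~ U a b x]].
Proof.
move=> S a02 b02 ab; apply/bq_open.
rewrite (_ : _ @^-1` _ = bq @^-1` [set x | x <> bq a] `&` bq @^-1` [set x | x <> bq b] `&`
   [set t | circle_cyc (to_circle b) (to_circle t) (to_circle a)]).
  apply: openI; last exact: circle_cyc_open.
  by apply: openI; [have /bq_open := @bq_neq_open (bq a)|have /bq_open := @bq_neq_open (bq b)].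
apply/seteqP; split=> t /=; pose u := crd (to_circle t);
  have tE : bq t = bq u by rewrite /bq crdK.
  have UE : U a b (bq u) = (cyc a u b : Prop) by apply/propext/UP => //; exact: crd_itv.
  rewrite tE UE => -[ua ub uc]; do !split=> //; apply/cyc_lift => //; rewrite -/u.
  rewrite cycC ?(eq_sym b a)//; first exact/negP.
  - by apply/eqP => bu; apply: ub; rewrite bu.
  - by apply/eqP => au; apply: ua; rewrite au.
have UE : U a b (bq u) = (cyc a u b : Prop) by apply/propext/UP => //; exact: crd_itv.
move=> [[ua ub] /cyc_lift uc]; rewrite tE UE -tE; split=> //.
by rewrite (cyc_asym (uc _ _)).
Qed.

Definition Kc a b : set (basilica R) := [set x | [\/ x = bq a, x = bq b | U a b x]].

Lemma Kc_closed a b : sat a b -> 0 < a <= 2 -> 0 < b <= 2 -> a != b -> closed (Kc a b).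
Proof.
move=> S a02 b02 ab; rewrite -openC; have := Uc_open S a02 b02 ab.
congr (open _); apply/seteqP; split=> x /=.
  by move=> [xa xb xu] [].
by move=> H; split=> h; apply: H; [apply: Or31|apply: Or32|apply: Or33].
Qed.

Definition conn (F : set (basilica R)) x y :=
  exists A, [/\ connected A, A x, A y & forall z, A z -> ~ F z].

Lemma arc_conn a b s t : 0 < a <= 2 -> 0 < b <= 2 -> 0 < s <= 2 -> 0 < t <= 2 ->
  cyc a s b -> cyc a t b -> exists A, [/\ connected A, A (bq s), A (bq t) & A `<=` U a b].
Proof.
move=> a02 b02 s02 t02 sc tc.
(* The lift of [b] beyond [a], with which the arc becomes an interval of the line. *)
pose b' := if a < b then b else b + 2.
have bb' : to_circle b' = to_circle b.
  by rewrite /b'; case: ifP => // _; rewrite -(to_circleD2 b 1) mulr1.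
have b'2 : b' < a + 2 by move: sc; rewrite /b' /cyc; case: (ltP a b) => ab /or3P[] /andP[] *; lra.
have ex u : 0 < u <= 2 -> cyc a u b -> exists2 u', a < u' < b' & bq u' = bq u.
  move=> u02 uc; have [au|ua] := ltP a u.
    exists u => //; rewrite au /=; move: uc; rewrite /b' /cyc; case: (ltP a b) => h /or3P[] /andP[] *; lra.
  exists (u + 2); last by rewrite /bq -(to_circleD2 u 1) mulr1.
  by move: uc; rewrite /b' /cyc; case: (ltP a b) => h /or3P[] /andP[] *; lra.
have [s' s'b <-] := ex s s02 sc; have [t' t'b <-] := ex t t02 tc.
have sub v w : a < v < b' -> a < w < b' -> bq @` `[v, w] `<=` U a b.
  move=> vb wb _ [u /= /[!in_itv]/= uvw <-].
  exists (crd (to_circle u)); last by rewrite /bq crdK.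
  split; first exact: crd_itv.
  rewrite -cyc_lift//; exists a, u, b'; rewrite bb'; split=> //; split=> //; lra.
have cn v w : connected (bq @` `[v, w]).
  apply: connected_continuous_connected; first exact: segment_connected.
  exact/continuous_subspaceT/bq_continuous.
have [st|/ltW ts] := leP s' t'.
  exists (bq @` `[s', t']); split; [exact: cn| | |exact: sub].
  by exists s' => //=; rewrite in_itv/= lexx.
  by exists t' => //=; rewrite in_itv/= lexx andbT.
exists (bq @` `[t', s']); split; [exact: cn| | |exact: sub].
by exists s' => //=; rewrite in_itv/= lexx andbT.
by exists t' => //=; rewrite in_itv/= lexx.
Qed.

(** The open set [U a b] and the closed set [Kc a b] have the same trace on [A], which is therefore
    clopen in [A]. *)
Lemma arc_sep a b A x y : sat a b -> 0 < a <= 2 -> 0 < b <= 2 -> a != b ->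
  connected A -> (forall z, A z -> z <> bq a /\ z <> bq b) -> A x -> A y ->
  U a b x -> U a b y.
Proof.
move=> S a02 b02 ab Ac AF Ax Ay Ux.
have : A `&` U a b = A; last by move=> E; have [] : (A `&` U a b) y by rewrite E.
apply: Ac; first by exists x.
  by exists (U a b) => //; exact: U_open.
exists (Kc a b); first exact: Kc_closed.
apply/seteqP; split=> z [Az]; first by move=> ?; split=> //; apply: Or33.
by move=> [] // zE; have [] := AF z Az.
Qed.

End Topology.

(** * Triadic arcs: finite closed covers with small pieces *)

Section TriadicArcs.
Context {R : realType}.
Implicit Types (s t u a b : R) (l m n p q r : @leaf R) (C : @cantorgon R)
  (x y : basilica R) (O : set (basilica R)).

(* [tri n 0 = 0] represents the same point of the circle as [2]. *)
Definition tra (k j : nat) : R := if j == 0%N then 2 else tri k j.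

Lemma bq_tra k j : bq (tra k j) = bq (tri k j).
Proof.
rewrite /tra; case: eqP => // ->; rewrite /tri mul0r /bq -(to_circleD2 0 1).
by rewrite add0r mulr1z mulr1.
Qed.

Lemma tri2 k : tri k (2 * 3 ^ k) = 2 :> R.
Proof. by rewrite /tri natrM natrX mulfK// gt_eqF// pow3_gt0. Qed.

(** By reduction of the fraction: a numerator prime to 3 gives an end at its own level, a multiple
    of 3 descends one level, and level 0 is the root leaf. *)
Lemma tra_end k j : (j <= 2 * 3 ^ k)%N -> exists l, is_end l (tra k j).
Proof.
have H i : (0 < i <= 2 * 3 ^ k)%N -> exists l, is_end l (tri k i).
  elim: k i => [|k IH] i ik.
    have c0 : is_code 0 0 by [].
    exists (mkleaf c0); have [_ _ aE bE] := @mkleafE R _ _ c0; rewrite /is_end aE bE.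
    by move: ik; case: i => [|[|[|]]]//; [left|right].
  rewrite expnS in ik; have iE := divn_eq i 3; have := ltn_pmod i (isT : 0 < 3)%N.
  case: (i %% 3)%N iE => [|[|[|//]]] iE _.
  - by rewrite iE addn0 mulnC -triS; apply: IH; lia.
  - have c : is_code k.+1 (i %/ 3) by rewrite /is_code expnS; lia.
    exists (mkleaf c); have [_ _ aE bE] := @mkleafE R _ _ c; left; rewrite aE iE.
    by congr tri; lia.
  - have c : is_code k.+1 (i %/ 3) by rewrite /is_code expnS; lia.
    exists (mkleaf c); have [_ _ aE bE] := @mkleafE R _ _ c; right; rewrite bE iE.
    by congr tri; lia.
move=> jk; rewrite /tra; case: eqP => [_|/eqP j0]; last by apply: H; rewrite lt0n j0.
by rewrite -(tri2 k); apply: H; rewrite muln_gt0 expn_gt0/=.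
Qed.

(** A leaf of level at most [k] has both ends on the grid of level [k]; a finer one cannot straddle
    a grid point. *)
Lemma leaf_in_tri k j l : (tri k j < la l < tri k j.+1) = (tri k j < lb l < tri k j.+1).
Proof.
have [_ ab _] := leaf_ltW l; have [lk|kl] := leqP (lv l) k.
  have [d kd] : exists d, k = (d + lv l)%N by exists (k - lv l)%N; rewrite subnK.
  by rewrite /la /lb ![tri (lv l) _](tri_lift d) -kd !lt_triE; lia.
have := @tri_outside R k j _ (lk l) kl; have := @tri_outside R k j.+1 _ (lk l) kl.
rewrite -/(la l) -/(lb l) => H1 H2.
by apply/idP/idP => /andP[? ?]; apply/andP; split; lra.
Qed.

Lemma tri_lt2 k j : (j < 2 * 3 ^ k)%N -> 0 < (tri k j.+1 : R) <= 2 /\ 0 <= (tri k j : R) < tri k j.+1.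
Proof. by move=> jk; rewrite tri_gt0 tri_le2 tri_ge0 lt_triE ltnSn. Qed.

Lemma cyc_tra k j t : (j < 2 * 3 ^ k)%N -> 0 < t <= 2 ->
  cyc (tra k j) t (tri k j.+1) = (tri k j < t < tri k j.+1).
Proof.
move=> /tri_lt2 [h1 h2] t02; rewrite /tra /cyc; case: eqP => [j0|_].
  have t0 : tri k j = 0 :> R by rewrite j0 /tri mul0r.
  have h3 : tri k j.+1 < 2 :> R.
    by rewrite -(tri2 k) lt_triE j0; have := expn_gt0 3 k; rewrite orTb; lia.
  rewrite t0; apply/idP/idP; first by move=> /or3P[] /andP[] *; lra.
  by move=> ?; apply/or3P; constructor 2; lra.
apply/idP/idP; first by move=> /or3P[] /andP[] *; lra.
by move=> ?; apply/or3P; constructor 1; lra.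
Qed.

Lemma tra_arc k j : (j < 2 * 3 ^ k)%N -> exists p q, leaf_arc p q (tra k j) (tri k j.+1).
Proof.
move=> jk; have [p pa] := @tra_end k j (ltnW jk).
have [q qb] := @tra_end k j.+1 jk; rewrite {1}/tra /= in qb.
have [h1 h2] := tri_lt2 jk.
exists p, q; split=> //.
  rewrite /tra; case: (j =P 0%N) => [j0|_]; last by rewrite lt_eqF//; have /andP[] := h2.
  rewrite j0 -(tri2 k) eq_tri eqn_pmul2r ?expn_gt0//; have : (0 < 3 ^ k)%N by rewrite expn_gt0.
  lia.
by move=> m; have [? ?] := leaf_end_itv m; rewrite !cyc_tra// leaf_in_tri.
Qed.

(** At each level these closed sets form a finite cover of the Basilica, and they shrink as the
    level grows ([KB_small]); they replace the balls of a metric. *)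
Definition KB (k j : nat) : set (basilica R) := bq @` `[tri k j, tri k j.+1].

Lemma KBE k j : (j < 2 * 3 ^ k)%N -> KB k j = Kc (tra k j) (tri k j.+1).
Proof.
move=> jk; have [h1 h2] := tri_lt2 jk; apply/seteqP; split=> x.
  move=> [t /= /[!in_itv]/= /andP[t1 t2] <-].
  have [->|tj] := eqVneq t (tri k j); first by apply: Or31; rewrite bq_tra.
  have [->|tj'] := eqVneq t (tri k j.+1); first exact: Or32.
  have t02 : 0 < t <= 2 by lra.
  by apply: Or33; exists t => //; split=> //; rewrite cyc_tra// !lt_neqAle eq_sym tj t1 tj' t2.
move=> [->|->|[t [t02 tc] <-]].
- by rewrite bq_tra; exists (tri k j) => //=; rewrite in_itv/=; lra.
- by exists (tri k j.+1) => //=; rewrite in_itv/=; lra.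
- by exists t => //=; rewrite in_itv/=; move: tc; rewrite cyc_tra//; lra.
Qed.

Lemma KB_closed k j : (j < 2 * 3 ^ k)%N -> closed (KB k j).
Proof.
move=> jk; rewrite KBE//; have [p [q [pa qb ab S]]] := tra_arc jk.
by apply: Kc_closed => //; [exact: is_end_itv pa|exact: is_end_itv qb].
Qed.

Lemma KB_cover k x : exists2 j, (j < 2 * 3 ^ k)%N & KB k j x.
Proof.
have [t t02 <-] := bq_surj x.
have [i iP] : exists i : nat, i%:R < t * 3 ^+ k <= i.+1%:R.
  pose c := Num.ceil (t * 3 ^+ k); have t0 : 0 < t * 3 ^+ k by rewrite mulr_gt0 ?pow3_gt0//; lra.
  have c0 : (0 < c)%R by rewrite /c ceil_gt0.
  have [i iE] : exists i : nat, c = i%:Z + 1 by exists `|c - 1|%N; clearbody c; lia.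
  exists i; have := ceil_itv (t * 3 ^+ k); rewrite -/c iE addrK intrD -!pmulrn -[i.+1]addn1 natrD.
  by [].
exists i.
  have : i%:R < (2 * 3 ^ k)%:R :> R.
    apply: (lt_le_trans (andP iP).1); rewrite natrM natrX ler_pM2r ?pow3_gt0//; lra.
  by rewrite ltr_nat.
exists t => //=; rewrite in_itv/= /tri ler_pdivrMr ?pow3_gt0// ler_pdivlMr ?pow3_gt0//.
by move: iP; lra.
Qed.

Lemma pow3_small (e : R) : 0 < e -> exists k, (3 ^+ k)^-1 < e.
Proof.
move=> e0; have := @near_infty_natSinv_lt R (PosNum e0) => -[k _ kP]; exists k.
apply: le_lt_trans (kP k (leqnn k)); rewrite lef_pV2 ?posrE ?pow3_gt0 ?ltr0n// -natrX ler_nat.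
exact: ltn_expl.
Qed.

Lemma tri_len k j : tri k j.+1 = tri k j + (3 ^+ k)^-1 :> R.
Proof. by rewrite /tri -[j.+1]addn1 natrD mulrDl mul1r. Qed.

(** Uniform continuity of [bq] on the compact interval [[0, 2]], with the Lebesgue number obtained
    from [compact_near_coveringP]. *)
Lemma KB_small (W : set (basilica R * basilica R)) : entourage_diag W ->
  exists k, forall j x y, (j < 2 * 3 ^ k)%N -> KB k j x -> KB k j y -> W (x, y).
Proof.
move=> Wd; pose P (e : R) t := forall s, `|t - s| < e -> W (bq t, bq s).
have /(compact_near_coveringP _).1/(_ R (0^'+) P _) := @segment_compact R 0 2.
have PP t : `[0, 2]%classic t -> \forall t' \near t & e \near 0^'+, P e t'.
  move=> _; have [[A B] /= [nA nB] ABW] := Wd (bq t).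
  have [a /= a0 aA] : nbhs t (bq @^-1` A) by exact: bq_continuous nA.
  have [b /= b0 bB] : nbhs t (bq @^-1` B) by exact: bq_continuous nB.
  pose e := Num.min a b; have e0 : 0 < e by rewrite lt_min a0.
  have ea : e <= a by rewrite /e ge_min lexx.
  have eb : e <= b by rewrite /e ge_min lexx orbT.
  exists ([set s | `|t - s| < e / 2], [set r | r < e / 2]) => /=.
    split; first by exists (e / 2) => //=; rewrite divr_gt0.
    by apply: nbhs_right_lt; rewrite divr_gt0.
  move=> [u r] /= [tu re] s us; apply: ABW; split => /=.
    by apply: aA => /=; lra.
  apply: bB => /=; apply: le_lt_trans (ler_distD u _ _) _; lra.
move=> /(_ PP) nP; near (0:R)^'+ => e.
have e0 : 0 < e by [].
have eP : forall t, 0 <= t <= 2 -> P e t.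
  have : `[0, 2]%classic `<=` P e by near: e; exact: nP.
  by move=> H t t02; apply: H; rewrite /= in_itv.
have [k ke] := pow3_small e0; exists k => j x y jk [s /= /[!in_itv]/= sI <-] [t /= /[!in_itv]/= tI <-].
have [h1 h2] := tri_lt2 jk; apply: eP; first by lra.
by move: sI tI; rewrite tri_len => sI tI; rewrite ltr_norml; lra.
Unshelve. all: by end_near. Qed.

Lemma KB_shrink O x : open O -> O x ->
  exists k, forall j, (j < 2 * 3 ^ k)%N -> KB k j x -> KB k j `<=` O.
Proof.
(* This entourage restricts only the pairs starting at [x]; it is a neighbourhood of the diagonal
   because points are closed. *)
move=> oO Ox; pose W := [set z : basilica R * basilica R | z.1 = x -> O z.2].
have [z|k kP] := @KB_small W.
  have [->|zx] := pselect (z = x).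
    by exists (setT, O) => /=; [split; [exact: filterT|exact: open_nbhs_nbhs]|move=> [u v] /= [_ +] _].
  exists ([set y | y <> x], setT) => /=; last by move=> [u v] /= [ux _] /= /ux.
  by split; [apply: open_nbhs_nbhs; split=> //; exact: bq_neq_open|exact: filterT].
by exists k => j jk jx y jy; exact: (kP j x y jk jx jy).
Qed.

Lemma KB_separate x y : x <> y -> exists k, forall j, (j < 2 * 3 ^ k)%N -> KB k j x -> ~ KB k j y.
Proof.
move=> xy; have [k kP] := @KB_shrink [set z | z <> y] x (@bq_neq_open R y) xy.
by exists k => j jk jx jy; have := kP j jk jx y jy.
Qed.

Lemma leaf_in_KB k j : (j < 2 * 3 ^ k)%N -> exists l, tri k j < la l < tri k j.+1 /\ lv l = k.+1.
Proof.
move=> jk; have c : is_code k.+1 j by rewrite /is_code expnS; lia.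
by exists (mkleaf c); have [-> _ -> _] := @mkleafE R _ _ c; rewrite ![tri k _]triS !lt_triE; split=> //; lia.
Qed.

Lemma KB_pt k j l : tri k j < la l < tri k j.+1 -> KB k j (pt l).
Proof. by move=> lI; exists (la l) => //=; rewrite in_itv/=; lra. Qed.

Lemma pt_dense O x : open O -> O x -> exists l, O (pt l).
Proof.
move=> oO Ox; have [k kP] := KB_shrink oO Ox; have [j jk jx] := KB_cover k x.
by have [l [lI _]] := leaf_in_KB jk; exists l; apply: (kP j jk jx); exact: KB_pt.
Qed.

(** Connected neighbourhoods of [x] forming a base: the Basilica is locally connected. *)
Definition star (k : nat) x : set (basilica R) :=
  [set y | exists j, [/\ (j < 2 * 3 ^ k)%N, KB k j x & KB k j y]].

Lemma star_connected k x : connected (star k x).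
Proof.
have -> : star k x = \bigcup_(j in [set j | (j < 2 * 3 ^ k)%N /\ KB k j x]) KB k j.
  by apply/seteqP; split=> y [j]; [move=> [? ? ?]; exists j|move=> [? ?] ?; exists j].
apply: bigcup_connected.
  by exists x => j [].
move=> j _; apply: connected_continuous_connected; first exact: segment_connected.
exact/continuous_subspaceT/bq_continuous.
Qed.

Lemma star_nbhs k x : nbhs x (star k x).
Proof.
pose V := \bigcap_(j in [set j | (j < 2 * 3 ^ k)%N /\ ~ KB k j x]) ~` KB k j.
have oV : open V.
  rewrite /V -setC_bigcup openC; apply: closed_bigcup => [|j [jk _]]; last exact: KB_closed.
  by apply: (sub_finite_set _ (finite_II (2 * 3 ^ k))) => j [].
apply: (filterS _ (open_nbhs_nbhs (conj oV _))) => [y Vy|j [_]//].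
have [j jk jy] := KB_cover k y; exists j; split=> //.
by apply: contrapT => jx; exact: (Vy j).
Qed.

Lemma star_small O x : open O -> O x -> exists k, star k x `<=` O.
Proof.
move=> oO Ox; have [k kP] := KB_shrink oO Ox.
by exists k => y [j [jk jx jy]]; exact: kP jy.
Qed.

(** At a level where no triadic arc contains both points, remove the finitely many closed arcs
    missing [x], respectively [y]; the arc around a common point would contain both. *)
Lemma basilica_hausdorff x y : x <> y ->
  exists O O', [/\ open O, open O', O x, O' y & O `&` O' = set0].
Proof.
move=> xy; have [k kP] := KB_separate xy.
pose V x := ~` \bigcup_(j in [set j | (j < 2 * 3 ^ k)%N /\ ~ KB k j x]) KB k j.
have oV z : open (V z).
  rewrite /V openC; apply: closed_bigcup => [|j [jk _]]; last exact: KB_closed.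
  by apply: (sub_finite_set _ (finite_II (2 * 3 ^ k))) => j [].
have Vz z : V z z by move=> [j []].
exists (V x), (V y); split=> //; apply/seteqP; split=> // z [Vx Vy].
have [j jk jz] := KB_cover k z.
have jx : KB k j x by apply: contrapT => jx; apply: Vx; exists j.
by apply: (kP j jk jx); apply: contrapT => jy; apply: Vy; exists j.
Qed.

End TriadicArcs.

(** * Components and their cyclic order in terms of separation *)

Section Components.
Context {R : realType}.
Implicit Types (s t u a b r : R) (l m n p q : @leaf R) (C : @cantorgon R)
  (x y : basilica R).

(** The two sides of [l] are arcs, hence connected, and each is clopen off [pt l]. Lying on the same
    side of a leaf thus becomes a topological notion. *)
Lemma conn_leaf l s t : 0 < s <= 2 -> 0 < t <= 2 -> ~ is_end l s -> ~ is_end l t ->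
  conn [set pt l] (bq s) (bq t) <-> inl l s = inl l t.
Proof.
move=> s02 t02 ls lt; have [[_ _ ab S1] [_ _ ba S2]] := leaf_arcs l.
have [a02 b02] := leaf_end_itv l.
have ptb : bq (lb l) = pt l by apply: bq_end; right.
have neq u : ~ is_end l u -> u != la l /\ u != lb l.
  by move=> lu; split; apply/eqP => uE; apply: lu; [left|right].
have [s1 s2] := neq s ls; have [t1 t2] := neq t lt.
split=> [[A [Ac As At AF]]|st].
  have F z : A z -> z <> bq (la l) /\ z <> bq (lb l).
    by move=> /AF zl; rewrite ptb; split=> /zl.
  have H x y : A x -> A y -> U (la l) (lb l) x -> U (la l) (lb l) y.
    by move=> Ax Ay; apply: (arc_sep S1 a02 b02 ab Ac F).
  apply/idP/idP; rewrite -!cyc_in => h.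
    by apply/(UP S1 t02); apply: (H (bq s) (bq t)) => //; exact/UP.
  by apply/(UP S1 s02); apply: (H (bq t) (bq s)) => //; exact/UP.
case E : (inl l s) in st.
  have [A [Ac As At AU]] := @arc_conn _ (la l) (lb l) s t a02 b02 s02 t02 (etrans (cyc_in _ _) E) (etrans (cyc_in _ _) (esym st)).
  exists A; split=> // z /AU Uz zl; move: Uz; rewrite zl /pt UP//.
  by rewrite cyc_xxy.
have h1 : cyc (lb l) s (la l) by rewrite cyc_out// E.
have h2 : cyc (lb l) t (la l) by rewrite cyc_out// -st.
have [A [Ac As At AU]] := arc_conn b02 a02 s02 t02 h1 h2.
exists A; split=> // z /AU Uz zl; move: Uz; rewrite zl /pt UP//.
by rewrite cyc_xyy.
Qed.

Lemma conn_pt l m n : m <> l -> n <> l -> conn [set pt l] (pt m) (pt n) <-> sd l m = sd l n.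
Proof.
move=> ml nl; rewrite conn_leaf.
- by [].
- by have [] := leaf_end_itv m.
- by have [] := leaf_end_itv n.
- by move=> h; apply: ml; apply: (@is_end_inj _ _ _ (la m)) => //; left.
- by move=> h; apply: nl; apply: (@is_end_inj _ _ _ (la n)) => //; left.
Qed.

Lemma two_sides C : exists p q, [/\ p <> q, is_side p C & is_side q C].
Proof.
have c0 : is_code 0 0 by [].
have [p pC] : exists p, is_side p C.
  have [/nearest_side[r _ rC]|/side_of_sep0 h] := pselect (sep C (mkleaf c0) !=set0).
    by exists r.
  by exists (mkleaf c0).
have [m [pm _ pmC]] := neighbour p (sg C p).
have [/nearest_side[r [rm rs] rC]|/side_of_sep0 mC] := pselect (sep C m !=set0); last by exists p, m.
by exists p, r; split=> // pr; apply: rs; rewrite -pr.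
Qed.

Lemma exists_side_neq C l : exists2 m, m <> l & is_side m C.
Proof.
have [p [q [pq pC qC]]] := two_sides C.
by have [pl|pl] := pselect (p = l); [exists q => // ql; apply: pq; rewrite pl ql|exists p].
Qed.

Definition ideal C t := forall l, is_end l t \/ inl l t = sg C l.

Lemma ideal_bq C s t : 0 < s <= 2 -> 0 < t <= 2 -> bq s = bq t -> ideal C s -> ideal C t.
Proof.
move=> s02 t02 /(bqE s02 t02)[->//|[l [ls lt]]] Is m.
have [<-|lm] := pselect (l = m); first by left.
right; case: (Is m) => [ms|]; first by case: lm; exact: is_end_inj ls ms.
by rewrite (sd_is_end (nesym lm) ls) (sd_is_end (nesym lm) lt).
Qed.

Lemma componentP C t : 0 < t <= 2 -> component C (bq t) <-> ideal C t.
Proof.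
move=> t02; split=> [[w /idealP wC wt]|It].
  by apply: (@ideal_bq C (crd w) t) => //; [exact: crd_itv|rewrite /bq crdK].
exists (to_circle t) => //; apply/idealP; by rewrite to_circleK.
Qed.

Lemma ideal_side C p t : is_end p t -> ideal C t <-> is_side p C.
Proof.
move=> pt; split=> [It|pC].
  apply/sideP => m mp; rewrite -[inl _ _]/(sd m p) -(sd_is_end mp pt).
  by case: (It m) => // mt; case: mp; exact: is_end_inj mt pt.
move=> m; have [->|mp] := pselect (m = p); [by left|right].
by rewrite (sd_is_end mp pt) (side_sd pC).
Qed.

Lemma component_pt C p : component C (pt p) <-> is_side p C.
Proof.
rewrite /pt componentP; last by have [] := leaf_end_itv p.
by apply: ideal_side; left.
Qed.

(** Components are described here through separation by leafs, which a homeomorphism carries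
    over. *)
Lemma component_conn C x : component C x <->
  forall m l, is_side m C -> pt l <> x -> l <> m -> conn [set pt l] x (pt m).
Proof.
have [t t02 <-] := bq_surj x; split=> [/(componentP _ t02) It m l mC lt lm|H].
  have lt' : ~ is_end l t by move/bq_end => /esym.
  rewrite /pt conn_leaf//.
  - by rewrite -[RHS]/(sd l m) (side_sd mC)//; case: (It l).
  - by have [] := leaf_end_itv m.
  - by move=> h; apply: lm; apply: is_end_inj h _; left.
apply/componentP => // l; have [|lt] := pselect (is_end l t); first by left.
right; have [m ml mC] := exists_side_neq C l.
rewrite -(side_sd mC (nesym ml)).
have := H m l mC; rewrite /pt conn_leaf//.
- by apply=> //; [move=> /esym/(bq_ptP _ t02)|exact: nesym].
- by have [] := leaf_end_itv m.
- by move=> h; apply: ml; apply/esym/(is_end_inj h); left.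
Qed.

(** The other points of the component lie on one side of the leaf with ends [s] and [s'], so they do
    not see which of its ends is taken. *)
Lemma ideal_cyc C s s' t r : 0 < s <= 2 -> 0 < s' <= 2 -> 0 < t <= 2 -> 0 < r <= 2 ->
  ideal C t -> ideal C r -> bq s = bq s' -> bq t <> bq s -> bq r <> bq s ->
  cyc s r t = cyc s' r t.
Proof.
move=> s02 s'02 t02 r02 It Ir /(bqE s02 s'02)[->//|[l [ls ls']]] ts rs.
have h u : ideal C u -> bq u <> bq s -> [/\ inl l u = sg C l, u != la l & u != lb l].
  move=> Iu us; have lu : ~ is_end l u by move=> /bq_end lu; apply: us; rewrite lu (bq_end ls).
  by split; [case: (Iu l)|apply/eqP => uE; apply: lu; left|apply/eqP => uE; apply: lu; right].
have [t1 t2 t3] := h t It ts; have [r1 r2 r3] := h r Ir rs.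
have := @cyc_end _ l r t; rewrite t1 r1 => /(_ erefl r2 r3 t2 t3) E.
by case: ls ls' => -> [->|->].
Qed.

Lemma ideal_cycs C s s' r r' t t' : 0 < s <= 2 -> 0 < r <= 2 -> 0 < t <= 2 ->
  0 < s' <= 2 -> 0 < r' <= 2 -> 0 < t' <= 2 ->
  ideal C s -> ideal C r -> ideal C t ->
  bq s = bq s' -> bq r = bq r' -> bq t = bq t' -> bq s <> bq r -> bq r <> bq t -> bq s <> bq t ->
  cyc s r t = cyc s' r' t'.
Proof.
move=> s02 r02 t02 s'02 r'02 t'02 Is Ir It ss rr tt sr rt st.
rewrite (ideal_cyc s02 s'02 t02 r02 It Ir ss (nesym st) (nesym sr)) cyc_rot.
have Is' := ideal_bq s02 s'02 ss Is; have Ir' := ideal_bq r02 r'02 rr Ir.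
have -> : cyc r t s' = cyc r' t s'.
  by apply: (ideal_cyc r02 r'02 s'02 t02 Is' It rr); rewrite -?ss //; exact: nesym.
have -> : cyc r' t s' = cyc s' r' t by rewrite cyc_rot cyc_rot.
rewrite cyc_rot cyc_rot.
have -> : cyc t s' r' = cyc t' s' r'.
  by apply: (ideal_cyc t02 t'02 r'02 s'02 Ir' Is' tt); rewrite -?rr -?ss.
by rewrite cyc_rot.
Qed.

Lemma component_cycP C s r t : 0 < s <= 2 -> 0 < r <= 2 -> 0 < t <= 2 ->
  ideal C s -> ideal C r -> ideal C t -> bq s <> bq r -> bq r <> bq t -> bq s <> bq t ->
  component_cyc C (bq s) (bq r) (bq t) <-> cyc s r t.
Proof.
move=> s02 r02 t02 Is Ir It sr rt st; split=> [[_ _ _ [w [v [z [_ _ _]]]]]|h].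
  move=> [sE rE tE] /circle_cycP.
  have E u (c : circle R) : bq u = to_basilica c -> bq u = bq (crd c) by rewrite /bq crdK.
  by rewrite (ideal_cycs s02 r02 t02 (crd_itv w) (crd_itv v) (crd_itv z) Is Ir It (E _ _ sE) (E _ _ rE) (E _ _ tE)).
split=> //; exists (to_circle s), (to_circle r), (to_circle t).
by split; [apply/idealP; rewrite to_circleK..|split=> //; exact/circle_cycE].
Qed.

(** A separating point has two coordinates. The one chosen makes the arc leave, or reach, the leaf
    on the side of [C], so that the arc is saturated. *)
Lemma ideal_arc C s t : 0 < s <= 2 -> 0 < t <= 2 -> ideal C s -> ideal C t -> bq s <> bq t ->
  exists a b, [/\ 0 < a <= 2, 0 < b <= 2, bq a = bq s & bq b = bq t] /\ (a != b /\ sat a b).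
Proof.
move=> s02 t02 Is It st.
have [a [a02 aE aP]] : exists a, [/\ 0 < a <= 2, bq a = bq s &
    forall p, is_end p a -> a = if sg C p then la p else lb p].
  have [[p ps]|np] := pselect (exists p, is_end p s); last first.
    by exists s; split=> // p ps; case: np; exists p.
  exists (if sg C p then la p else lb p).
  have pe : is_end p (if sg C p then la p else lb p) by case: ifP; [left|right].
  split; [exact: is_end_itv pe|by rewrite (bq_end pe) (bq_end ps)|].
  by move=> q qe; rewrite (is_end_inj qe pe).
have [b [b02 bE bP]] : exists b, [/\ 0 < b <= 2, bq b = bq t &
    forall p, is_end p b -> b = if sg C p then lb p else la p].
  have [[p ps]|np] := pselect (exists p, is_end p t); last first.
    by exists t; split=> // p ps; case: np; exists p.
  exists (if sg C p then lb p else la p).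
  have pe : is_end p (if sg C p then lb p else la p) by case: ifP; [right|left].
  split; [exact: is_end_itv pe|by rewrite (bq_end pe) (bq_end ps)|].
  by move=> q qe; rewrite (is_end_inj qe pe).
have Ia := ideal_bq s02 a02 (esym aE) Is; have Ib := ideal_bq t02 b02 (esym bE) It.
have ab : a != b by apply/eqP => ab; apply: st; rewrite -aE ab.
exists a, b; split=> //; split=> // m.
have nE u : ~ is_end m u -> u != la m /\ u != lb m.
  by move=> mu; split; apply/eqP => uE; apply: mu; [left|right].
have [_ mlt _] := leaf_ltW m.
have [ma|ma] := pselect (is_end m a).
  have mb : ~ is_end m b by move=> mb; apply: st; rewrite -aE -bE (bq_end ma) (bq_end mb).
  have [b1 b2] := nE b mb; have := Ib m => -[//|]; rewrite (aP m ma) /inl /cyc; case: (sg C m);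
  by case: (ltgtP b (la m)) b1 => //; case: (ltgtP b (lb m)) b2 => //; rewrite ?ltxx//=; lra.
have [a1 a2] := nE a ma.
have [mb|mb] := pselect (is_end m b).
  have := Ia m => -[//|]; rewrite (bP m mb) /inl /cyc; case: (sg C m);
  by case: (ltgtP a (la m)) a1 => //; case: (ltgtP a (lb m)) a2 => //; rewrite ?ltxx//=; lra.
have [b1 b2] := nE b mb.
apply/eqP; rewrite cyc_sep//; apply/eqP.
by case: (Ia m) => // ->; case: (Ib m).
Qed.

Lemma conn_quadW C s t r r' : 0 < s <= 2 -> 0 < t <= 2 -> 0 < r <= 2 -> 0 < r' <= 2 ->
  ideal C s -> ideal C t -> ideal C r -> ideal C r' ->
  bq s <> bq t -> bq r <> bq s -> bq r <> bq t -> bq r' <> bq s -> bq r' <> bq t ->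
  cyc s r t -> cyc s r' t <-> conn [set bq s; bq t] (bq r) (bq r').
Proof.
move=> s02 t02 r02 r'02 Is It Ir Ir' st rs rt r's r't rc.
have [a [b [[a02 b02 aE bE] [ab S]]]] := ideal_arc s02 t02 Is It st.
have E u : 0 < u <= 2 -> ideal C u -> bq u <> bq s -> bq u <> bq t -> cyc s u t = cyc a u b.
  move=> u02 Iu us ut; apply: (@ideal_cycs C) => //; exact: nesym.
split=> [r'c|[A [Ac Ar Ar' AF]]].
  rewrite (E r) // in rc; rewrite (E r') // in r'c.
  have [A [Ac As At AU]] := arc_conn a02 b02 r02 r'02 rc r'c.
  exists A; split=> // z /AU Uz [zs|zt]; move: Uz; rewrite ?zs ?zt -?aE -?bE UP//.
    by rewrite cyc_xxy.
  by rewrite cyc_xyy.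
rewrite (E r')//; apply/(UP S r'02); apply: (arc_sep S a02 b02 ab Ac _ Ar Ar').
  by move=> z /AF zF; rewrite aE bE; split=> zE; apply: zF; [left|right].
by apply/UP => //; rewrite -E.
Qed.

(** Two points of a component cut it into two arcs, and points on different arcs are separated by
    the pair in the whole Basilica. Exchanging [s] and [t] reduces to the case [cyc s r t]. *)
Lemma conn_quad C s t r r' : 0 < s <= 2 -> 0 < t <= 2 -> 0 < r <= 2 -> 0 < r' <= 2 ->
  ideal C s -> ideal C t -> ideal C r -> ideal C r' ->
  bq s <> bq t -> bq r <> bq s -> bq r <> bq t -> bq r' <> bq s -> bq r' <> bq t ->
  conn [set bq s; bq t] (bq r) (bq r') <-> cyc s r t = cyc s r' t.
Proof.
move=> s02 t02 r02 r'02 Is It Ir Ir' st rs rt r's r't.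
have neq u v : bq u <> bq v -> u != v by move=> uv; apply/eqP => e; apply: uv; rewrite e.
have [rc|rc] := boolP (cyc s r t).
  by rewrite -(conn_quadW s02 t02 r02 r'02 Is It Ir Ir').
have sw u : bq u <> bq s -> bq u <> bq t -> cyc t u s = ~~ cyc s u t.
  by move=> us ut; apply: cycC; apply: neq => //; exact: nesym.
have rc' : cyc t r s by rewrite sw.
rewrite setUC -(conn_quadW t02 s02 r02 r'02 It Is Ir Ir')//; last exact: nesym.
by rewrite sw//; case: (cyc s r' t).
Qed.

End Components.

(** * The action of a homeomorphism on the tree *)

(** [sigma x y z] will tell whether a homeomorphism keeps the orientation of a triple. By symmetry
    any point may play the middle one, and the middle one may be replaced; so any two triples are
    joined by changing one point at a time. *)
Lemma sign_constant (T : Type) (P : T -> Prop) (sigma : T -> T -> T -> bool) :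
  (forall x y z, P x -> P y -> P z -> x <> y -> y <> z -> x <> z ->
     sigma x y z = sigma y z x /\ sigma x y z = sigma z y x) ->
  (forall x y z w, P x -> P y -> P z -> P w -> x <> y -> y <> z -> x <> z ->
     x <> w -> w <> z -> sigma x y z = sigma x w z) ->
  exists c, forall x y z, P x -> P y -> P z -> x <> y -> y <> z -> x <> z -> sigma x y z = c.
Proof.
move=> sym rep.
have swap23 x y z : P x -> P y -> P z -> x <> y -> y <> z -> x <> z -> sigma x y z = sigma x z y.
  move=> Px Py Pz xy yz xz; have [_ ->] := sym x y z Px Py Pz xy yz xz.
  by have [-> _] := sym x z y Px Pz Py xz (nesym yz) xy; have [-> _] := sym z y x Pz Py Px (nesym yz) (nesym xy) (nesym xz);
   have [-> _] := sym y x z Py Px Pz (nesym xy) xz yz.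
have fst x y z y' z' : P x -> P y -> P z -> P y' -> P z' ->
    x <> y -> y <> z -> x <> z -> x <> y' -> y' <> z' -> x <> z' ->
    sigma x y z = sigma x y' z'.
  move=> Px Py Pz Py' Pz' xy yz xz xy' yz' xz'.
  have [y'z|y'z] := pselect (y' = z).
    by subst y'; rewrite swap23//; apply: (etrans (swap23 _ _ _ _ _ _ _ _ _)) => //;
       [exact: nesym|rewrite (rep x y z z')// 1?swap23//; exact: nesym].
  rewrite (rep x y z y')// swap23//; rewrite (rep x z y' z')//; [|exact: nesym..].
  by rewrite swap23//; exact: nesym.
have all x y z u v w : P x -> P y -> P z -> P u -> P v -> P w ->
    x <> y -> y <> z -> x <> z -> u <> v -> v <> w -> u <> w -> sigma x y z = sigma u v w.
  move=> Px Py Pz Pu Pv Pw xy yz xz uv vw uw; have [xu|xu] := pselect (x = u).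
    by subst u; exact: fst.
  (* A third point [t] links the triples starting at [x] to those starting at [u]. *)
  have [t [Pt xt ut]] : exists t, [/\ P t, x <> t & u <> t].
    by have [uy|uy] := pselect (u = y); [exists z; split=> //; rewrite uy|exists y].
  rewrite (fst x y z u t)//; have [_ ->] := sym x u t Px Pu Pt xu ut xt.
  have [-> _] := sym t u x Pt Pu Px (nesym ut) (nesym xu) (nesym xt).
  by apply: fst => //; exact: nesym.
have [[x [y [z [Px Py Pz [xy yz xz]]]]]|no] :=
    pselect (exists x y z, [/\ P x, P y, P z & [/\ x <> y, y <> z & x <> z]]).
  by exists (sigma x y z) => u v w *; apply: all.
by exists true => x y z Px Py Pz xy yz xz; case: no; exists x, y, z.
Qed.

Lemma asbool_eq4 (A B A' B' : Prop) : ((A <-> A') <-> (B <-> B')) ->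
  (`[< A >] == `[< B >]) = (`[< A' >] == `[< B' >]).
Proof.
move=> H; case: (asboolP A) => a; case: (asboolP B) => b; case: (asboolP A') => a';
  case: (asboolP B') => b' //=; exfalso; tauto.
Qed.

Lemma asbool_eq2 (A B D : Prop) (c : bool) : (B <-> ~ D) -> (`[< A >] == `[< B >]) = c ->
  if c then A <-> B else A <-> D.
Proof.
by move=> H <-; have [d|d] := pselect D; case: (asboolP A) => a; case: (asboolP B) => b //=; tauto.
Qed.

Section Induced.
Context {R : realType}.
Implicit Types (s t u a b r : R) (l m n p q : @leaf R) (C : @cantorgon R)
  (x y z : basilica R) (f : homeo (basilica R)).

Lemma homeo_VK f x : (f^-1)%g (f x) = x. Proof. exact: homeoK. Qed.
Lemma homeo_KV f x : f ((f^-1)%g x) = x. Proof. exact: homeoVK. Qed.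
Lemma homeo_inj f : injective f. Proof. exact: can_inj (@homeoK _ f). Qed.

Lemma conn_homeo f (F F' : set (basilica R)) x y : (forall z, F' (f z) -> F z) ->
  conn F x y -> conn F' (f x) (f y).
Proof.
move=> FF' [A [Ac Ax Ay AF]]; exists (f @` A); split.
- apply: connected_continuous_connected => //; apply: continuous_subspaceT; exact: (@homeo_cts _ f).
- by exists x.
- by exists y.
- by move=> _ [w Aw <-] /FF'; exact: AF.
Qed.

(** If [x] has a single preimage on the circle, any two other points are joined by the image of an
    interval of the line that avoids the lifts of [x]. *)
Lemma separatingP x : (exists y z, [/\ y <> x, z <> x & ~ conn [set x] y z]) <-> exists l, x = pt l.
Proof.
split=> [[y [z [yx zx yz]]]|[l ->]]; last first.
  have [m [lm _ ms]] := neighbour l true; have [n [ln _ ns]] := neighbour l false.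
  exists (pt m), (pt n); split.
  - by move=> /pt_inj/esym.
  - by move=> /pt_inj/esym.
  - by rewrite conn_pt ?ms ?ns//; exact: nesym.
have [t t02 tx] := bq_surj x; apply: contrapT => xl; apply: yz.
have tl l : ~ is_end l t by move=> /bq_end lt; apply: xl; exists l; rewrite -tx.
have lift w : w <> x -> exists2 u, t < u < t + 2 & bq u = w.
  move=> wx; have [u u02 uw] := bq_surj w.
  have ut : u != t by apply/eqP => ut; apply: wx; rewrite -uw ut.
  have [lt|gt] := ltP t u; first by exists u => //; lra.
  exists (u + 2); last by rewrite -uw /bq -(to_circleD2 u 1) mulr1.
  have {}gt : u < t by rewrite lt_neqAle ut.
  by lra.
have [v vI vy] := lift y yx; have [w wI wz] := lift z zx.
exists (bq @` `[Num.min v w, Num.max v w]); split.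
- apply: connected_continuous_connected; first exact: segment_connected.
  exact/continuous_subspaceT/bq_continuous.
- by exists v => //=; rewrite in_itv/= ge_min le_max lexx.
- by exists w => //=; rewrite in_itv/= ge_min le_max lexx !orbT.
- move=> _ [u /= /[!in_itv]/= uI <-] ux.
  have {}uI : t < u < t + 2.
    case/andP: uI; rewrite ge_min le_max => /orP u1 /orP u2.
    by case: u1 u2 => ? [] ?; lra.
  have : bq (crd (to_circle u)) = bq t by rewrite tx -ux /bq crdK.
  move=> /(bqE (crd_itv _) t02)[ut|[l [_ /tl//]]].
  have : to_circle u = to_circle t by rewrite -ut crdK.
  have ut2 : `|u - t| < 2 by rewrite ltr_norml; lra.
  by move=> /(to_circle_near ut2) ut3; move: uI; rewrite ut3 ltxx.
Qed.

Fact homeo_leaf_exists f l : exists m, f (pt l) = pt m.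
Proof.
have [_ /(_ (ex_intro _ l erefl))[y [z [yx zx yz]]]] := separatingP (pt l).
have [+ _] := separatingP (f (pt l)); apply.
exists (f y), (f z); split; [by move/homeo_inj|by move/homeo_inj|].
move=> /(@conn_homeo (f^-1)%g _ [set pt l]); rewrite !homeo_VK => H; apply: yz; apply: H.
by move=> w /= wl; rewrite -wl homeo_KV.
Qed.

Definition homeo_leaf f l : @leaf R := projT1 (cid (homeo_leaf_exists f l)).

Lemma homeo_leafE f l : f (pt l) = pt (homeo_leaf f l).
Proof. by rewrite /homeo_leaf; case: cid. Qed.

Lemma homeo_leafK f : cancel (homeo_leaf f) (homeo_leaf (f^-1)%g).
Proof. by move=> l; apply: pt_inj; rewrite -!homeo_leafE homeo_VK. Qed.

Lemma homeo_leafVK f : cancel (homeo_leaf (f^-1)%g) (homeo_leaf f).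
Proof. by move=> l; apply: pt_inj; rewrite -!homeo_leafE homeo_KV. Qed.

Lemma homeo_leaf_inj f : injective (homeo_leaf f).
Proof. exact: can_inj (homeo_leafK f). Qed.

Lemma conn_homeo_leaf f l x y : conn [set pt l] x y -> conn [set pt (homeo_leaf f l)] (f x) (f y).
Proof. by apply: conn_homeo => z /=; rewrite -homeo_leafE => /homeo_inj. Qed.

Lemma unsep_homeo f p q : unsep p q -> unsep (homeo_leaf f p) (homeo_leaf f q).
Proof.
move=> U n np nq; rewrite -(homeo_leafVK f n) in np nq *; set m := homeo_leaf _ n in np nq *.
have mp : p <> m by move=> pm; apply: np; rewrite pm.
have mq : q <> m by move=> qm; apply: nq; rewrite qm.
apply/conn_pt; [exact: nesym|exact: nesym|].
rewrite -(homeo_leafE f p) -(homeo_leafE f q); apply: conn_homeo_leaf.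
apply/conn_pt => //; apply: U; exact: nesym.
Qed.

(** Two sides have unseparated images, which single out [C']; for a third side the Helly property
    [side_of_unsep] applies. *)
Fact homeo_cantorgon_exists f C :
  exists C', forall l, is_side l C -> is_side (homeo_leaf f l) C'.
Proof.
have [p [q [pq pC qC]]] := two_sides C.
have fpq : homeo_leaf f p <> homeo_leaf f q by move/homeo_leaf_inj.
have [C' [pC' qC' _]] := unsep_common fpq (@unsep_homeo f _ _ (sides_unsep pC qC)).
exists C' => l lC; apply: (side_of_unsep fpq) => //; apply: unsep_homeo; exact: (sides_unsep lC).
Qed.

Definition homeo_cantorgon f C : @cantorgon R := projT1 (cid (homeo_cantorgon_exists f C)).

Lemma homeo_cantorgonW f C l : is_side l C -> is_side (homeo_leaf f l) (homeo_cantorgon f C).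
Proof. by rewrite /homeo_cantorgon; case: cid => C' /= H; exact: H. Qed.

Lemma homeo_cantorgonK f : cancel (homeo_cantorgon f) (homeo_cantorgon (f^-1)%g).
Proof.
move=> C; have [p [q [pq pC qC]]] := two_sides C.
apply: (sides_unique pq) => //; rewrite -[X in is_side X](homeo_leafK f);
  by do 2!apply: homeo_cantorgonW.
Qed.

Lemma homeo_cantorgonVK f : cancel (homeo_cantorgon (f^-1)%g) (homeo_cantorgon f).
Proof. by move=> C; have := homeo_cantorgonK (f^-1)%g C; rewrite invgK. Qed.

Lemma homeo_side f l C : is_side (homeo_leaf f l) (homeo_cantorgon f C) <-> is_side l C.
Proof.
split; last exact: homeo_cantorgonW.
by move=> /(@homeo_cantorgonW (f^-1)%g); rewrite homeo_leafK homeo_cantorgonK.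
Qed.

Lemma homeo_componentW f C x : component C x -> component (homeo_cantorgon f C) (f x).
Proof.
move=> /component_conn H; apply/component_conn => m l.
rewrite -(homeo_leafVK f m) -(homeo_leafVK f l) homeo_side => mC lx lm.
rewrite -(homeo_leafE f (homeo_leaf _ m)); apply: conn_homeo_leaf; apply: H => //.
  by move=> lx'; apply: lx; rewrite -homeo_leafE lx'.
by move=> ml; apply: lm; rewrite ml.
Qed.

Lemma homeo_component f C : f @` component C = component (homeo_cantorgon f C).
Proof.
apply/seteqP; split=> [_ [x xC <-]|x xC]; first exact: homeo_componentW.
exists ((f^-1)%g x); last exact: homeo_KV.
by have := @homeo_componentW (f^-1)%g _ _ xC; rewrite homeo_cantorgonK.
Qed.

Lemma component_cyc_neq C x y z : component_cyc C x y z -> [/\ x <> y, y <> z & x <> z].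
Proof. by case. Qed.

Lemma component_cycC C x y z : component C x -> component C y -> component C z ->
  x <> y -> y <> z -> x <> z ->
  (component_cyc C x y z <-> component_cyc C y z x) /\
  (component_cyc C x y z <-> ~ component_cyc C z y x).
Proof.
have [s s02 <-] := bq_surj x; have [r r02 <-] := bq_surj y; have [t t02 <-] := bq_surj z.
move=> /(componentP _ s02) Is /(componentP _ r02) Ir /(componentP _ t02) It sr rt st.
rewrite component_cycP// component_cycP//; [|exact: nesym..].
rewrite component_cycP//; [|exact: nesym..].
split; first by rewrite (cyc_rot s r t).
rewrite (@cycC _ s r t); first by split=> [/negP//|/negP].
all: by apply/eqP => e; rewrite e in sr rt st.
Qed.

Lemma component_quad C x y z w : component C x -> component C y -> component C z -> component C w ->
  x <> y -> y <> z -> x <> z -> x <> w -> w <> z ->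
  conn [set x; z] y w <-> (component_cyc C x y z <-> component_cyc C x w z).
Proof.
have [s s02 <-] := bq_surj x; have [r r02 <-] := bq_surj y; have [t t02 <-] := bq_surj z.
have [u u02 <-] := bq_surj w.
move=> /(componentP _ s02) Is /(componentP _ r02) Ir /(componentP _ t02) It /(componentP _ u02) Iu.
move=> sr rt st su ut; rewrite (@conn_quad _ C)//; [|exact: nesym..].
rewrite component_cycP// component_cycP//; split=> [->//|[h1 h2]].
by apply/idP/idP.
Qed.

(** By [component_quad], separation of pairs by pairs decides whether replacing the middle point of
    a triple changes its orientation. The homeomorphism preserves such separation, so
    [sign_constant] yields a single sign. *)
Lemma homeo_sign_distinct f C : exists c : bool, forall x y z,
  component C x -> component C y -> component C z -> x <> y -> y <> z -> x <> z ->
  (if c then component_cyc C x y z <-> component_cyc (homeo_cantorgon f C) (f x) (f y) (f z)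
   else component_cyc C x y z <-> component_cyc (homeo_cantorgon f C) (f z) (f y) (f x)).
Proof.
pose C' := homeo_cantorgon f C.
pose sigma x y z := `[< component_cyc C x y z >] == `[< component_cyc C' (f x) (f y) (f z) >].
have fneq x y : x <> y -> f x <> f y by move=> xy /homeo_inj.
have [| |c cP] := @sign_constant _ (component C) sigma.
- move=> x y z Cx Cy Cz xy yz xz; rewrite /sigma.
  have [/propext e1 /propext e2] := component_cycC Cx Cy Cz xy yz xz.
  have [/propext e3 /propext e4] := component_cycC (@homeo_componentW f _ _ Cx) (@homeo_componentW f _ _ Cy)
     (@homeo_componentW f _ _ Cz) (fneq _ _ xy) (fneq _ _ yz) (fneq _ _ xz).
  rewrite e1 e3; split=> //; rewrite -e1 -e3 e2 e4 !asbool_neg.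
  by case: asbool; case: asbool.
- move=> x y z w Cx Cy Cz Cw xy yz xz xw wz; rewrite /sigma.
  have h1 := component_quad Cx Cy Cz Cw xy yz xz xw wz.
  have h2 := component_quad (@homeo_componentW f _ _ Cx) (@homeo_componentW f _ _ Cy)
     (@homeo_componentW f _ _ Cz) (@homeo_componentW f _ _ Cw) (fneq _ _ xy) (fneq _ _ yz)
     (fneq _ _ xz) (fneq _ _ xw) (fneq _ _ wz).
  have h3 : conn [set x; z] y w <-> conn [set f x; f z] (f y) (f w).
    split; first by apply: conn_homeo => v /= [] /homeo_inj ->; [left|right].
    move=> /(@conn_homeo (f^-1)%g _ [set x; z]); rewrite !homeo_VK; apply.
    by move=> v /= [] <-; rewrite homeo_KV; [left|right].
  have h4 : (component_cyc C x y z <-> component_cyc C x w z) <->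
    (component_cyc C' (f x) (f y) (f z) <-> component_cyc C' (f x) (f w) (f z)).
    by rewrite -h1 -h2.
  exact: asbool_eq4.
exists c => x y z Cx Cy Cz xy yz xz; have := cP x y z Cx Cy Cz xy yz xz; rewrite /sigma.
have [_ e] := component_cycC (@homeo_componentW f _ _ Cx) (@homeo_componentW f _ _ Cy)
     (@homeo_componentW f _ _ Cz) (fneq _ _ xy) (fneq _ _ yz) (fneq _ _ xz).
exact: asbool_eq2.
Qed.

Lemma homeo_sign f C : exists c : bool, forall x y z,
  component C x -> component C y -> component C z ->
  (if c then component_cyc C x y z <-> component_cyc (homeo_cantorgon f C) (f x) (f y) (f z)
   else component_cyc C x y z <-> component_cyc (homeo_cantorgon f C) (f z) (f y) (f x)).
Proof.
have [c cP] := homeo_sign_distinct f C; exists c => x y z Cx Cy Cz.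
have [[xy yz xz]|no] := pselect [/\ x <> y, y <> z & x <> z]; first exact: cP.
case: c {cP}; split=> /component_cyc_neq[h1 h2 h3]; case: no; split=> // e;
  by [apply: h1; rewrite e|apply: h2; rewrite e|apply: h3; rewrite e].
Qed.

Lemma side_component_cyc C p q (r : @leaf R) : is_side p C -> is_side q C -> is_side r C ->
  side_cyc C p q r <-> component_cyc C (pt p) (pt q) (pt r).
Proof.
move=> pC qC rC; have H : p <> q -> q <> r -> p <> r ->
    side_cyc C p q r <-> component_cyc C (pt p) (pt q) (pt r).
  move=> pq qr pr; have [p02 _] := leaf_end_itv p; have [q02 _] := leaf_end_itv q.
  have [r02 _] := leaf_end_itv r; rewrite side_cycP//; apply: iff_sym.
  have I l : is_side l C -> ideal C (la l) by move=> lC; apply/(@ideal_side _ C l); [left|].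
  by apply: (@component_cycP _ C (la p) (la q) (la r)) => //; do ?[exact: I|move/pt_inj].
split=> h; first by have [_ _ _ [pq qr pr] _] := h; exact/H.
have [pq qr pr] := component_cyc_neq h.
by apply/H => // e; [apply: pq|apply: qr|apply: pr]; rewrite e.
Qed.

Fact homeo_respects f C :
  cyc_preserving_at (G := basilica_tree R) (homeo_cantorgon f) (homeo_leaf f) C \/
  cyc_reversing_at (G := basilica_tree R) (homeo_cantorgon f) (homeo_leaf f) C.
Proof.
have [c cP] := homeo_sign f C.
have H l : is_side l C -> component C (pt l) by move/component_pt.
have fs l : is_side l C -> is_side (homeo_leaf f l) (homeo_cantorgon f C) by move/homeo_side.
case: c cP => cP; [left|right] => p q r pC qC rC.
  apply: iff_trans (side_component_cyc pC qC rC) _.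
  apply: iff_trans (cP _ _ _ (H p pC) (H q qC) (H r rC)) _.
  rewrite !homeo_leafE; apply: iff_sym; exact: side_component_cyc (fs p pC) (fs q qC) (fs r rC).
apply: iff_trans (side_component_cyc pC qC rC) _.
apply: iff_trans (cP _ _ _ (H p pC) (H q qC) (H r rC)) _.
rewrite !homeo_leafE; apply: iff_sym; exact: side_component_cyc (fs r rC) (fs q qC) (fs p pC).
Qed.

Definition Pi f : cyc_aut (basilica_tree R) :=
  @CycAut (basilica_tree R) (homeo_cantorgon f) (homeo_leaf f)
    (homeo_cantorgon (f^-1)%g) (homeo_leaf (f^-1)%g)
    (homeo_cantorgonK f) (homeo_cantorgonVK f) (homeo_leafK f) (homeo_leafVK f)
    (homeo_side f) (homeo_respects f).

(** Two sides determine a Cantorgon, so the edge map determines the vertex map. *)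
Lemma aut_eq (g h : cyc_aut (basilica_tree R)) :
  (forall l, aut_e g l = aut_e h l) -> g = h.
Proof.
move=> gh; apply: cyc_aut_eq => //= C; have [p [q [pq pC qC]]] := two_sides C.
have gpq : aut_e g p <> aut_e g q by move/aut_e_inj.
apply: (sides_unique gpq); do ?[exact/aut_side|rewrite gh; exact/aut_side].
Qed.

Lemma Pi_induces f g : Pi f = g <-> induces f g.
Proof.
split=> [<-|[_ fl]].
  split=> [C|l]; first exact: homeo_component.
  have E k : to_basilica @` leaf_ends k = [set pt k].
    apply/seteqP; split=> [_ [w /leaf_endsE[->|->] <-] /=|_ ->].
    - by apply: bq_end; left.
    - by apply: bq_end; right.
    - by exists (to_circle (la k)) => //; apply/leaf_endsE; left.
  by rewrite !E image_set1 homeo_leafE.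
apply: aut_eq => l /=; apply: pt_inj; rewrite -homeo_leafE.
have : (f @` (to_basilica @` leaf_ends l)) (f (pt l)).
  by exists (pt l) => //; exists (to_circle (la l)) => //; apply/leaf_endsE; left.
rewrite fl => -[w /leaf_endsE[->|->] <-]; first by apply/esym/bq_end; left.
by apply: bq_end; right.
Qed.

Lemma PiM f f' : Pi (f * f')%g = (Pi f * Pi f')%g.
Proof. by apply: aut_eq => l /=; apply: pt_inj; rewrite -!homeo_leafE. Qed.

End Induced.

(** * The homeomorphism induced by an automorphism *)

Section Extension.
Context {R : realType}.
Implicit Types (s t u a b : R) (l m n p q : @leaf R) (C : @cantorgon R)
  (x y z : basilica R) (f : homeo (basilica R)) (g : cyc_aut (basilica_tree R)).

(** A relation rather than a function, so that it can be read backwards for the inverse automorphism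
    ([arc_imageV]). *)
Definition arc_image g p q a b p' q' a' b' :=
  [/\ leaf_arc p q a b, leaf_arc p' q' a' b',
      (p' = aut_e g p /\ q' = aut_e g q) \/ (p' = aut_e g q /\ q' = aut_e g p) &
      forall m, cyc a (la m) b = cyc a' (la (aut_e g m)) b'].

Lemma arc_image_exists g p q a b : leaf_arc p q a b ->
  exists p' q' a' b', arc_image g p q a b p' q' a' b'.
Proof.
by move=> A; have [p' [q' [a' [b' [A' E H]]]]] := aut_arc g A; exists p', q', a', b'.
Qed.

Lemma aut_eKV g l : aut_e (g^-1)%g (aut_e g l) = l. Proof. exact: (@aut_eK _ g). Qed.
Lemma aut_eVK' g l : aut_e g (aut_e (g^-1)%g l) = l. Proof. exact: (@aut_eVK _ g). Qed.

Lemma arc_imageV g p q a b p' q' a' b' : arc_image g p q a b p' q' a' b' ->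
  arc_image (g^-1)%g p' q' a' b' p q a b.
Proof.
move=> [A A' E H]; split=> // [|m].
  by case: E => -[-> ->]; rewrite !aut_eKV; [left|right].
by rewrite H aut_eVK'.
Qed.

Lemma leaf_arc_itv p q a b : leaf_arc p q a b -> [/\ 0 < a <= 2, 0 < b <= 2, a != b & sat a b].
Proof. by move=> [/is_end_itv ? /is_end_itv ? ? ?]. Qed.

Lemma Kc_pt p q a b m : leaf_arc p q a b ->
  Kc a b (pt m) <-> [\/ m = p, m = q | cyc a (la m) b].
Proof.
move=> A; have [pa qb _ S] := A; have m02 := (leaf_end_itv m).1.
rewrite /Kc /= (bq_end pa) (bq_end qb); split=> [[/pt_inj ->|/pt_inj ->|]|[->|->|]].
- exact: Or31.
- exact: Or32.
- by move=> /(UP S m02); exact: Or33.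
- exact: Or31.
- exact: Or32.
- by move=> /(UP S m02); exact: Or33.
Qed.

Lemma arc_image_pt g p q a b p' q' a' b' m : arc_image g p q a b p' q' a' b' ->
  Kc a b (pt m) <-> Kc a' b' (pt (aut_e g m)).
Proof.
move=> [A A' E H]; rewrite (Kc_pt m A) (Kc_pt _ A') H.
have I : injective (aut_e g : @leaf R -> @leaf R) := @aut_e_inj R g.
split=> [[->|->|c]|[e|e|c]]; try exact: Or33.
- by case: E => -[-> ->]; [apply: Or31|apply: Or32].
- by case: E => -[-> ->]; [apply: Or32|apply: Or31].
- by case: E => -[p'E q'E]; rewrite p'E in e; [apply: Or31|apply: Or32]; exact: I.
- by case: E => -[p'E q'E]; rewrite q'E in e; [apply: Or32|apply: Or31]; exact: I.
Qed.

Lemma Kc_U p q a b x : leaf_arc p q a b -> (forall l, x <> pt l) -> Kc a b x -> U a b x.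
Proof. by move=> [pa qb _ _] nx [] // xE; [case: (nx p)|case: (nx q)]; rewrite xE (bq_end pa, bq_end qb). Qed.

(** A common point that is not separating is interior to both arcs, and separating points are dense.
    This reduces intersections of arcs to leafs, on which [g] is defined. *)
Lemma arcs_meet p q a b p' q' a' b' x : leaf_arc p q a b -> leaf_arc p' q' a' b' ->
  Kc a b x -> Kc a' b' x -> exists m, Kc a b (pt m) /\ Kc a' b' (pt m).
Proof.
move=> A A' K K'; have [[m xm]|nx] := pselect (exists m, x = pt m).
  by exists m; rewrite -xm.
have {}nx l : x <> pt l by move=> xl; apply: nx; exists l.
have [a02 b02 _ S] := leaf_arc_itv A; have [a'02 b'02 _ S'] := leaf_arc_itv A'.
have [m [Um Um']] : exists m, (U a b `&` U a' b') (pt m).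
  apply: (@pt_dense _ _ x); first by apply: openI; apply: U_open.
  by split; [exact: Kc_U A nx K|exact: Kc_U A' nx K'].
by exists m; split; exact: Or33.
Qed.

(* [y] is the only point lying in the images of all the arcs around [x]. *)
Definition arc_related g x y := forall p q a b p' q' a' b',
  arc_image g p q a b p' q' a' b' -> Kc a b x -> Kc a' b' y.

Lemma arc_related_pt g l : arc_related g (pt l) (pt (aut_e g l)).
Proof. by move=> p q a b p' q' a' b' /arc_image_pt ->. Qed.

(** For [x] off the leafs, [y] is a cluster point of [pt (aut_e g l)] as [pt l] tends to [x], and
    exists by compactness. A separating point is treated apart: it may be the endpoint of an arc,
    which is then no neighbourhood of it. *)
Lemma arc_related_exists g x : exists y, arc_related g x y.
Proof.
have [[l ->]|nx] := pselect (exists l, x = pt l).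
  by exists (pt (aut_e g l)); exact: arc_related_pt.
have {}nx l : x <> pt l by move=> xl; apply: nx; exists l.
pose F := [set S : set (basilica R) | exists O, [/\ open O, O x &
  forall l, O (pt l) -> S (pt (aut_e g l))]].
have FF : ProperFilter F.
  apply: Build_ProperFilter_ex.
    move=> S [N [oN Nx NS]]; have [l Nl] := pt_dense oN Nx.
    by exists (pt (aut_e g l)); exact: NS.
  split.
  - by exists setT; split=> //; exact: openT.
  - move=> S S' [N [oN Nx NS]] [N' [oN' N'x NS']]; exists (N `&` N'); split=> //.
      exact: openI.
    by move=> l [? ?]; split; [exact: NS|exact: NS'].
  - by move=> S S' SS' [N [oN Nx NS]]; exists N; split=> // l /NS /SS'.
have [y [_ yF]] := @basilica_compact R F FF filterT.
exists y => p q a b p' q' a' b' I K; have [A A' _ H] := I.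
have [a02 b02 _ S] := leaf_arc_itv A; have [a'02 b'02 ab' S'] := leaf_arc_itv A'.
have cK := Kc_closed S' a'02 b'02 ab'.
apply: cK => B nB; apply: yF nB; exists (U a b); split; [by apply: U_open|exact: Kc_U A nx K|].
move=> l Ul; apply/(arc_image_pt _ I); exact: Or33.
Qed.

(** If [x] missed the arc, so would a small triadic arc around [x]. The images of the two arcs both
    contain [y], hence share a separating point, whose preimage would lie in both. *)
Lemma arc_relatedV g x y : arc_related g x y -> arc_related (g^-1)%g y x.
Proof.
move=> xy p q a b p' q' a' b' I Ky; apply: contrapT => nKx; have [A A' _ _] := I.
have [a'02 b'02 ab' S'] := leaf_arc_itv A'.
have oK : open (~` Kc a' b') by rewrite openC; apply: Kc_closed.
have [k kP] := KB_shrink oK nKx; have [j jk jx] := KB_cover k x.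
have [r [s A1]] := @tra_arc R _ _ jk; have [r' [s' [c' [d' I1]]]] := arc_image_exists g A1.
have KJ : Kc (tra k j) (tri k j.+1) x by rewrite -KBE.
have [_ A2 _ _] := I1.
have [m [m1 m2]] := arcs_meet A2 A (xy _ _ _ _ _ _ _ _ I1 KJ) Ky.
apply: (kP j jk jx (pt (aut_e (g^-1)%g m))).
  by rewrite KBE//; apply/(arc_image_pt _ I1); rewrite aut_eVK'.
by apply/(arc_image_pt _ I).
Qed.

Lemma arc_related_unique g x y y' : arc_related g x y -> arc_related g x y' -> y = y'.
Proof.
move=> xy xy'; apply: contrapT => yy'; have [k kP] := KB_separate (nesym yy').
have [j jk jy'] := KB_cover k y'; apply: (kP j jk jy').
have [r [s A1]] := @tra_arc R _ _ jk; have [r' [s' [c' [d' I1]]]] := arc_image_exists (g^-1)%g A1.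
have I2 := arc_imageV I1; rewrite invgK in I2.
rewrite KBE//; apply: (xy _ _ _ _ _ _ _ _ I2).
by apply: (arc_relatedV xy' I1); rewrite -KBE.
Qed.

Definition ext g x : basilica R := projT1 (cid (arc_related_exists g x)).

Lemma extP g x : arc_related g x (ext g x).
Proof. by rewrite /ext; case: cid. Qed.

Lemma extK g : cancel (ext g) (ext (g^-1)%g).
Proof. by move=> x; apply: (@arc_related_unique (g^-1)%g (ext g x)); [exact: extP|exact: arc_relatedV (@extP g x)]. Qed.

Lemma extVK g : cancel (ext (g^-1)%g) (ext g).
Proof. by move=> x; have := extK (g^-1)%g x; rewrite invgK. Qed.

Lemma ext_pt g l : ext g (pt l) = pt (aut_e g l).
Proof. by apply: (@arc_related_unique g (pt l)); [exact: extP|exact: arc_related_pt]. Qed.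

Lemma ext_Kc g p q a b p' q' a' b' x : arc_image g p q a b p' q' a' b' ->
  Kc a' b' (ext g x) <-> Kc a b x.
Proof.
move=> I; split=> K; last exact: (@extP g x _ _ _ _ _ _ _ _ I K).
by have := @extP (g^-1)%g (ext g x) _ _ _ _ _ _ _ _ (arc_imageV I) K; rewrite extK.
Qed.

(** The preimage of a triadic arc is an arc, hence closed; near [x] the finitely many arcs missing
    [ext g x] are still missed. *)
Lemma ext_continuous g : continuous (ext g).
Proof.
move=> x B; rewrite nbhsE => -[N [oN Nx] NB].
have [k kP] := KB_shrink oN Nx.
pose V := ~` \bigcup_(j in [set j | (j < 2 * 3 ^ k)%N /\ ~ KB k j (ext g x)])
  (ext g @^-1` KB k j).
have oV : open V.
  rewrite /V openC; apply: closed_bigcup => [|j [jk _]].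
    by apply: (sub_finite_set _ (finite_II (2 * 3 ^ k))) => j [].
  have [r [s A1]] := @tra_arc R _ _ jk; have [r' [s' [c' [d' I1]]]] := arc_image_exists (g^-1)%g A1.
  have I2 := arc_imageV I1; rewrite invgK in I2.
  rewrite (_ : _ @^-1` _ = Kc c' d'); last first.
    by apply/seteqP; split=> z /=; rewrite KBE// (ext_Kc _ I2).
  have [A2 _ _ _] := I2; have [? ? ? ?] := leaf_arc_itv A2; by apply: Kc_closed.
have Vx : V x by move=> [i [_ ni] xi]; exact: ni.
apply: (filterS _ (open_nbhs_nbhs (conj oV Vx))) => z Vz; apply: NB.
have [j jk jz] := KB_cover k (ext g z).
apply: (kP j jk _ _ jz); apply: contrapT => jx; apply: Vz; exists j => //.
Qed.

Definition Psi g : homeo (basilica R) :=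
  @Homeo (basilica R) (ext g) (ext (g^-1)%g) (extK g) (extVK g)
    (ext_continuous (g := g)) (ext_continuous (g := (g^-1)%g)).

Lemma homeo_ext f f' : (forall l, f (pt l) = f' (pt l)) -> f = f'.
Proof.
move=> ff'; apply: homeo_eq => x; apply: contrapT => ne.
have [N [N' [oN oN' Nx N'x NN']]] := basilica_hausdorff ne.
have [l [Nl N'l]] : exists l, ((f @^-1` N) `&` (f' @^-1` N')) (pt l).
  apply: (@pt_dense _ _ x); last by split.
  by apply: openI; [have /continuousP := @homeo_cts _ f|have /continuousP := @homeo_cts _ f']; apply.
have : (N `&` N') (f (pt l)) by split=> //; rewrite ff'.
by rewrite NN'.
Qed.

Lemma PsiK g : Pi (Psi g) = g.
Proof. by apply: aut_eq => l; apply: pt_inj; rewrite -homeo_leafE -ext_pt. Qed.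

Lemma PiK f : Psi (Pi f) = f.
Proof. by apply: homeo_ext => l; rewrite /= ext_pt homeo_leafE. Qed.

End Extension.

(** * Continuity *)

Section Continuity.
Context {R : realType}.
Implicit Types (s t u a b : R) (l m n p q : @leaf R) (C : @cantorgon R)
  (x y z : basilica R) (f : homeo (basilica R)) (g h : cyc_aut (basilica_tree R)).

Lemma leaf_sides_finite l : finite_set [set C | is_side l C].
Proof.
have [C1 [lC1 sC1]] := side_exists_sg l true; have [C2 [lC2 sC2]] := side_exists_sg l false.
apply: (@sub_finite_set _ _ ([set C1] `|` [set C2])); last by rewrite finite_setU; split; exact: finite_set1.
move=> C /= lC; case E : (sg C l); [left|right]; apply: (@side_unique _ _ _ l) => //.
  by rewrite sC1.
by rewrite sC2.
Qed.

Lemma leaf_subtree l : finite_subtree (G := basilica_tree R) [set C | is_side l C] [set l].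
Proof.
split.
- exact: leaf_sides_finite.
- exact: finite_set1.
- by have [C [lC _]] := side_exists_sg l true; exists C.
- by move=> e v ->.
- by move=> u v lu lv; apply: Relation_Operators.rt_step; exists l.
Qed.

Lemma coset_open (i : cyc_aut (basilica_tree R) * (set (@cantorgon R) * set (@leaf R))) :
  finite_subtree (G := basilica_tree R) i.2.1 i.2.2 -> open (stabilizer_coset i).
Proof.
move=> iD; exists [set stabilizer_coset i]; last by rewrite bigcup_set1.
move=> _ ->; exact: finI_from1.
Qed.

Lemma filter_bigcap_finite (I : choiceType) (T : Type) (F : set_system T) {FF : Filter F}
    (E : set I) (B : I -> set T) : finite_set E -> (forall i, E i -> F (B i)) ->
  F (\bigcap_(i in E) B i).
Proof.
by move=> /finite_fsetP[D ->] EB; apply: filter_bigI => i iD; exact: EB.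
Qed.

(** The topology is that of pointwise convergence on leafs: a vertex is determined by two of its
    sides, and a single edge with its two ends is a finite subtree. *)
Lemma nbhs_autP g (S : set (cyc_aut (basilica_tree R))) : nbhs g S <->
  exists2 E : set (@leaf R), finite_set E &
    forall h, (forall l, E l -> aut_e h l = aut_e g l) -> S h.
Proof.
split=> [|[E Efin ES]].
  rewrite nbhsE => -[B [[D' D'F <-] [F D'F' Fg]] BS].
  have [N ND NF] : finI_from [set i : cyc_aut (basilica_tree R) *
      (set (vertex (basilica_tree R)) * set (edge (basilica_tree R))) |
      finite_subtree i.2.1 i.2.2] stabilizer_coset F by exact: D'F.
  pose I : Type := (cyc_aut (basilica_tree R) * (set (@cantorgon R) * set (@leaf R)))%type.
  pose NS : set I := [set` N].
  have NSfin : finite_set NS by exact: finite_fset.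
  have NSD (i : I) : NS i -> finite_subtree (G := basilica_tree R) i.2.1 i.2.2.
    by move=> /ND; rewrite inE.
  have {NF}NSF : \bigcap_(i in NS) stabilizer_coset i = F := NF.
  have coset (i : I) : NS i -> exists2 E : set (@leaf R), finite_set E &
      forall h, (forall l, E l -> aut_e h l = aut_e g l) -> stabilizer_coset i h.
    move=> iN; have [Vfin Efin _ _ _] := NSD _ iN.
    have [s [sV sE] gs] : stabilizer_coset i g by have : (\bigcap_(i in NS) stabilizer_coset i) g; [rewrite NSF|exact].
    (* For each vertex of the subtree two sides are added, which control the value at that
       vertex. *)
    pose p (v : @cantorgon R) := projT1 (cid (two_sides v)).
    pose q (v : @cantorgon R) := projT1 (cid (projT2 (cid (two_sides v)))).
    have pqP v : [/\ p v <> q v, is_side (p v) v & is_side (q v) v].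
      by rewrite /p /q; case: cid => p0 /= ex; case: cid.
    exists (i.2.2 `|` (p @` i.2.1 `|` q @` i.2.1)).
      by rewrite !finite_setU; split=> //; split; exact: finite_image.
    move=> h hg; exists (i.1^-1 * h)%g; last by rewrite mulgA mulgV mul1g.
    have hgv v : i.2.1 v -> aut_v h v = aut_v g v.
      move=> Vv; have [pq pv qv] := pqP v.
      have gpq : aut_e g (p v) <> aut_e g (q v) by move/aut_e_inj.
      apply: (sides_unique gpq); [|
        |exact/aut_side|exact/aut_side].
        by rewrite -hg; [exact/aut_side|right; left; exists v].
      by rewrite -hg; [exact/aut_side|right; right; exists v].
    split=> [v Vv|e Ee].
      by rewrite -[RHS](sV v Vv) /= hgv// gs /= aut_vK.
    by rewrite -[RHS](sE e Ee) /= hg; [rewrite gs /= aut_eK|left].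
  have [E Efin EP] : exists2 E : set (@leaf R), finite_set E &
      forall i, NS i -> forall h, (forall l, E l -> aut_e h l = aut_e g l) -> stabilizer_coset i h.
    pose e i := if pselect (NS i) is left iN then s2val (cid2 (coset i iN)) else set0.
    exists (\bigcup_(i in NS) e i).
      apply: bigcup_finite => // i iN; rewrite /e; case: pselect => [iN'|]; last by move/(_ iN).
      by case: cid2.
    move=> i iN h H; have : forall l, e i l -> aut_e h l = aut_e g l by move=> l eil; apply: H; exists i.
    by rewrite /e; case: pselect => // iN'; case: cid2 => /= Ei _; exact.
  exists E => // h hE; apply: BS; exists F => //.
  have : (\bigcap_(i in NS) stabilizer_coset i) h by move=> i iN; exact: (EP i iN h hE).
  by rewrite NSF.
suff nP : nbhs g (\bigcap_(l in E) [set h : cyc_aut (basilica_tree R) | aut_e h l = aut_e g l]).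
  by apply: filterS nP => h Eh; apply: ES => l /Eh.
apply: filter_bigcap_finite => // l El.
have oc := @coset_open (g, ([set C | is_side l C], [set l])) (leaf_subtree l).
have gc : stabilizer_coset (g, ([set C | is_side l C], [set l])) g.
  by exists 1%g; [split=> [v|e]|rewrite /= mulg1].
apply: (filterS _ (open_nbhs_nbhs (conj oc gc))) => h [s [_ sl] ->] /=.
by rewrite (sl l).
Qed.

Lemma arc_leaf p q a b : leaf_arc p q a b -> exists m, cyc a (la m) b.
Proof.
move=> A; have [a02 b02 ab S] := leaf_arc_itv A.
have [t t02 tc] : exists2 t, 0 < t <= 2 & cyc a t b.
  have [lt|le] := ltP a b.
    by exists ((a + b) / 2); [lra|rewrite /cyc; apply/or3P; constructor 1; lra].
  have {}le : b < a by rewrite lt_neqAle eq_sym ab.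
  by exists (b / 2); [lra|rewrite /cyc; apply/or3P; constructor 2; lra].
have [m] := @pt_dense _ (U a b) (bq t) (U_open S a02 b02) ((UP S t02).2 tc).
by move=> /(UP S (leaf_end_itv m).1); exists m.
Qed.

(** An arc between [l] and another side contains a leaf, and the side of [C] towards that leaf is
    the third one. *)
Lemma three_sides C l : is_side l C -> exists p q,
  [/\ is_side p C, is_side q C & [/\ p <> q, l <> p & l <> q]].
Proof.
move=> lC; have [p pl pC] := exists_side_neq C l.
have [a [b A]] := arc_pq_exists (nesym pl) (sides_unsep lC pC).
have [m mc] := arc_leaf A.
have ml : m <> l by move=> ml; move: mc; rewrite (arc_endsF A (or_introl ml)); [|left].
have mp : m <> p by move=> mp; move: mc; rewrite (arc_endsF A (or_intror mp)); [|left].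
move: mc; rewrite (arc_pqP (nesym pl) A ml mp) => /and3P[/eqP m1 /eqP m2 _].
rewrite (side_sd pC (nesym pl)) in m1; rewrite (side_sd lC pl) in m2.
have [r [rC rl rp _]] := towards_side (nesym pl) lC pC ml mp m1 m2.
by exists p, r; split=> //; split=> //; exact: nesym.
Qed.

Lemma conn_trans F x y z : conn F x y -> conn F y z -> conn F x z.
Proof.
move=> [A [Ac Ax Ay AF]] [B [Bc By Bz BF]]; exists (A `|` B); split.
- by apply: connectedU => //; exists y.
- by left.
- by right.
- by move=> w [/AF|/BF].
Qed.

Lemma disjoint_connected_nbhs x y : x <> y -> exists A B,
  [/\ nbhs x A, nbhs y B, connected A, connected B & A `&` B = set0].
Proof.
move=> xy; have [N [N' [oN oN' Nx N'y NN']]] := basilica_hausdorff xy.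
have [k kN] := star_small oN Nx; have [k' kN'] := star_small oN' N'y.
exists (star k x), (star k' y); split; try exact: star_nbhs; try exact: star_connected.
by rewrite -subset0 -NN' => z [/kN ? /kN'].
Qed.

Lemma entourage_pt x (A : set (basilica R)) : nbhs x A ->
  entourage_diag [set uv | uv.1 = x -> A uv.2].
Proof.
move=> nA z; have [->|zx] := pselect (z = x).
  by exists (setT, A) => /=; [split; [exact: filterT|]|move=> [u v] /= [_ +] _].
exists ([set y | y <> x], setT) => /=; last by move=> [u v] /= [ux _] /= /ux.
by split; [apply: open_nbhs_nbhs; split=> //; exact: bq_neq_open|exact: filterT].
Qed.

Lemma entourageI (W W' : set (basilica R * basilica R)) :
  entourage_diag W -> entourage_diag W' -> entourage_diag (W `&` W').
Proof. by move=> H H' x; exact: filterI. Qed.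

(* A homeomorphism close to [f] has the same value as [f] at a separating point
   [pt l]: the value must separate points near the images of sides of the two
   Cantorgons adjacent to [l], and only [f (pt l)] does. *)
Lemma leaf_value_open l m : open [set f : homeo (basilica R) | f (pt l) = pt m].
Proof.
move=> f /= flm.
have [C1 [mC1 sC1]] := side_exists_sg m true; have [C2 [mC2 sC2]] := side_exists_sg m false.
have [X1 [X2 [X1C X2C [X12 mX1 mX2]]]] := three_sides mC1.
have [Y1 [Y2 [Y1C Y2C [Y12 mY1 mY2]]]] := three_sides mC2.
have pX : pt X1 <> pt X2 by move/pt_inj. have pY : pt Y1 <> pt Y2 by move/pt_inj.
(* Two candidates are kept at each Cantorgon, with disjoint neighbourhoods: [pt k] lies in at most
   one of these, and [pick] takes the other. *)
have [A1 [A2 [nA1 nA2 cA1 cA2 AA]]] := disjoint_connected_nbhs pX.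
have [B1 [B2 [nB1 nB2 cB1 cB2 BB]]] := disjoint_connected_nbhs pY.
exists (([set uv | uv.1 = pt X1 -> A1 uv.2] `&` [set uv | uv.1 = pt X2 -> A2 uv.2]) `&`
        ([set uv | uv.1 = pt Y1 -> B1 uv.2] `&` [set uv | uv.1 = pt Y2 -> B2 uv.2])).
  by apply: entourageI; apply: entourageI; exact: entourage_pt.
move=> g gW /=; pose k := homeo_leaf g l; have gk : g (pt l) = pt k by exact: homeo_leafE.
rewrite gk; congr pt; apply: contrapT => km.
have pick C Z1 Z2 (D1 D2 : set (basilica R)) : is_side Z1 C -> is_side Z2 C -> m <> Z1 -> m <> Z2 ->
    nbhs (pt Z1) D1 -> nbhs (pt Z2) D2 -> connected D1 -> connected D2 -> D1 `&` D2 = set0 ->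
    D1 (g ((f^-1)%g (pt Z1))) -> D2 (g ((f^-1)%g (pt Z2))) ->
    exists Z, [/\ is_side Z C, m <> Z, k <> Z & conn [set pt k] (g ((f^-1)%g (pt Z))) (pt Z)].
  move=> Z1C Z2C mZ1 mZ2 n1 n2 c1 c2 DD g1 g2.
  have H Z D : nbhs (pt Z) D -> connected D -> D (g ((f^-1)%g (pt Z))) -> ~ D (pt k) ->
      k <> Z /\ conn [set pt k] (g ((f^-1)%g (pt Z))) (pt Z).
    move=> /nbhs_singleton nD cD gD kD; split; first by move=> kZ; apply: kD; rewrite kZ.
    by exists D; split=> // w Dw wk; apply: kD; rewrite -wk.
  have [k1|k1] := pselect (D1 (pt k)).
    have k2 : ~ D2 (pt k) by move=> k2; have : (D1 `&` D2) (pt k) by []; rewrite DD.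
    by exists Z2; have [] := H Z2 D2 n2 c2 g2 k2.
  by exists Z1; have [] := H Z1 D1 n1 c1 g1 k1.
have gA1 : A1 (g ((f^-1)%g (pt X1))) by have [[H _] _] := gW ((f^-1)%g (pt X1)); apply: H; rewrite /= homeo_KV.
have gA2 : A2 (g ((f^-1)%g (pt X2))) by have [[_ H] _] := gW ((f^-1)%g (pt X2)); apply: H; rewrite /= homeo_KV.
have gB1 : B1 (g ((f^-1)%g (pt Y1))) by have [_ [H _]] := gW ((f^-1)%g (pt Y1)); apply: H; rewrite /= homeo_KV.
have gB2 : B2 (g ((f^-1)%g (pt Y2))) by have [_ [_ H]] := gW ((f^-1)%g (pt Y2)); apply: H; rewrite /= homeo_KV.
have [X [XC mX kX cX]] := pick C1 X1 X2 A1 A2 X1C X2C mX1 mX2 nA1 nA2 cA1 cA2 AA gA1 gA2.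
have [Y [YC mY kY cY]] := pick C2 Y1 Y2 B1 B2 Y1C Y2C mY1 mY2 nB1 nB2 cB1 cB2 BB gB1 gB2.
have XY : conn [set pt k] (pt X) (pt Y).
  apply/conn_pt; [exact: nesym|exact: nesym|].
  by rewrite (side_sd XC kX) (side_sd YC kY) -(side_sd mC1 km) (side_sd mC2 km).
have connC F x y : conn F x y -> conn F y x by move=> [A [? ? ? ?]]; exists A.
(* The connected set off [pt k] is carried back by the inverse of [g] and forward by [f]; it would
   join [pt X] to [pt Y] off [pt m], which separates them. *)
have c1 := conn_trans (conn_trans cX XY) (connC _ _ _ cY).
have /(@conn_homeo _ (g^-1)%g _ [set pt l]) c2 := c1.
have {c2} : conn [set pt l] ((f^-1)%g (pt X)) ((f^-1)%g (pt Y)).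
  rewrite -{1}(homeo_VK g ((f^-1)%g (pt X))) -(homeo_VK g ((f^-1)%g (pt Y))).
  by apply: c2 => w /= wl; rewrite -gk -wl homeo_KV.
move=> /(@conn_homeo _ f _ [set pt m]); rewrite !homeo_KV => H.
have /conn_pt : conn [set pt m] (pt X) (pt Y).
  by apply: H => w /=; rewrite -flm => /homeo_inj.
move=> /(_ (nesym mX) (nesym mY)).
by rewrite (side_sd XC mX) (side_sd YC mY) sC1 sC2.
Qed.

Lemma Pi_continuous : continuous (@Pi R).
Proof.
move=> f S /nbhs_autP[E Efin ES].
suff nP : nbhs f (\bigcap_(l in E) [set f' : homeo (basilica R) | f' (pt l) = pt (homeo_leaf f l)]).
  apply: filterS nP => f' f'E; apply: ES => l El /=; apply: pt_inj.
  by rewrite -homeo_leafE f'E.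
apply: filter_bigcap_finite => // l El; apply: open_nbhs_nbhs; split; first exact: leaf_value_open.
by rewrite /= homeo_leafE.
Qed.

Lemma arc_start p q a b : leaf_arc p q a b -> p <> q ->
  a = (if sd p q then la p else lb p) /\ b = (if sd q p then lb q else la q).
Proof.
move=> A pq; have [pa qb _ _] := A.
have pb : inl p b = sd p q by exact: sd_is_end qb.
have qa : inl q a = sd q p by exact: (sd_is_end (nesym pq) pa).
have [_ plt _] := leaf_ltW p; have [_ qlt _] := leaf_ltW q.
split.
  have b1 : b != la p by apply: is_end_neq (nesym pq) qb _; left.
  have b2 : b != lb p by apply: is_end_neq (nesym pq) qb _; right.
  have := arc_endsF A (or_introl erefl) (or_introl erefl : is_end p (la p)).
  have := arc_endsF A (or_introl erefl) (or_intror erefl : is_end p (lb p)).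
  rewrite -pb; case: pa => ->; move: b1 b2; rewrite /cyc /inl;
   case: (ltgtP b (la p)) => //; case: (ltgtP b (lb p)) => //=; lra.
have a1 : a != la q by apply: is_end_neq pq pa _; left.
have a2 : a != lb q by apply: is_end_neq pq pa _; right.
have := arc_endsF A (or_intror erefl) (or_introl erefl : is_end q (la q)).
have := arc_endsF A (or_intror erefl) (or_intror erefl : is_end q (lb q)).
rewrite -qa; case: qb => -> ; move: a1 a2; rewrite /cyc /inl;
 case: (ltgtP a (la q)) => //; case: (ltgtP a (lb q)) => //=; lra.
Qed.

(** Two leafs bound two arcs, and one leaf inside tells them apart. Hence the image of an arc
    depends on the values of the automorphism at three leafs, which gives the continuity of
    [Psi]. *)
Lemma arc_determined p q p' q' a b a' b' m : leaf_arc p q a b -> leaf_arc p' q' a' b' ->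
  (p' = p /\ q' = q) \/ (p' = q /\ q' = p) -> cyc a (la m) b -> cyc a' (la m) b' ->
  a = a' /\ b = b'.
Proof.
move=> A A' E c c'; have sym u v w r : leaf_arc p p u v -> leaf_arc p p w r -> cyc u (la m) v -> cyc w (la m) r -> u = w /\ v = r.
  move=> [[->|->] [->|->] uv _] [[->|->] [->|->] wr _]; rewrite ?eqxx// in uv wr *;
  by move=> /cyc_asym ->.
have [pq|pq] := pselect (p = q).
  have [pE qE] : p' = p /\ q' = p by case: E => -[-> ->]; rewrite pq.
  rewrite -pq in A; rewrite pE qE in A'; exact: sym.
case: E => -[pE qE]; rewrite pE qE in A'.
  by have [-> ->] := arc_start A pq; have [-> ->] := arc_start A' pq.
have mp : m <> p by move=> mp; move: c; rewrite (arc_endsF A (or_introl mp)); [|left].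
have mq : m <> q by move=> mq; move: c; rewrite (arc_endsF A (or_intror mq)); [|left].
move: c c'; rewrite (arc_pqP pq A mp mq) (arc_pqP (nesym pq) A' mq mp).
by move=> /and3P[_ _ c] /and3P[_ _]; rewrite (cyc_asym c).
Qed.

Lemma Psi_continuous : continuous (@Psi R).
Proof.
move=> g S; rewrite nbhsE => -[B [oB Bg] BS].
have [W Wd WB] := oB _ Bg; have [k kW] := KB_small Wd.
have data j : exists D : set (@leaf R), finite_set D /\ ((j < 2 * 3 ^ k)%N ->
    forall h x, (forall l, D l -> aut_e h l = aut_e g l) -> KB k j (ext g x) -> KB k j (ext h x)).
  have [jk|jk] := pselect (j < 2 * 3 ^ k)%N; last by exists set0; split=> // /jk.
  have [p [q A]] := @tra_arc R _ _ jk.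
  have [p' [q' [c [d I]]]] := arc_image_exists (g^-1)%g A.
  have := arc_imageV I; rewrite invgK => I2; have [A2 _ E2 H2] := I2.
  have [m mc] := arc_leaf A2.
  exists ([set p'] `|` ([set q'] `|` [set m])); split.
    by rewrite !finite_setU; split; [|split]; exact: finite_set1.
  move=> _ h x hg; rewrite KBE// (ext_Kc _ I2) => K.
  have [p'' [q'' [c' [d' I3]]]] := arc_image_exists h A2; have [_ A3 E3 H3] := I3.
  have hp : aut_e h p' = aut_e g p' by apply: hg; left.
  have hq : aut_e h q' = aut_e g q' by apply: hg; right; left.
  have hm : aut_e h m = aut_e g m by apply: hg; right; right.
  have EE : (p'' = p /\ q'' = q) \/ (p'' = q /\ q'' = p).
    by move: E3; rewrite hp hq; case: E2 => -[-> ->] [[-> ->]|[-> ->]]; [left|right|right|left].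
  have m2 : cyc (tra k j) (la (aut_e g m)) (tri k j.+1) by rewrite -H2.
  have m3 : cyc c' (la (aut_e g m)) d' by rewrite -hm -H3.
  by have [-> ->] := arc_determined A A3 EE m2 m3; apply/(ext_Kc _ I3).
pose D j := projT1 (cid (data j)).
have DP j := projT2 (cid (data j)).
apply/nbhs_autP; exists (\bigcup_(j in `I_(2 * 3 ^ k)) D j).
  by apply: bigcup_finite; [exact: finite_II|move=> j _; have [] := DP j].
move=> h hg; apply: BS; apply: WB => x; have [j jk jx] := KB_cover k (ext g x).
apply: (kW j _ _ jk jx); have [_ /(_ jk) H] := DP j; apply: H jx => l Dl.
by apply: hg; exists j.
Qed.

(** One condition concerns all triples of points of a component, the other the triples of sides; by
    [homeo_sign] three sides decide for the whole component. *)
Lemma homeo_plusE f : homeo_plus f <-> aut_plus (Pi f).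
Proof.
split=> [H C p q r pC qC rC|H C].
  have [C' [fC pres]] := H C.
  have C'E : C' = homeo_cantorgon f C.
    have [u [v [uv uC vC]]] := two_sides C.
    have fs l : is_side l C -> is_side (homeo_leaf f l) C'.
      move=> lC; apply/component_pt; rewrite -fC -homeo_leafE; exists (pt l) => //.
      exact/component_pt.
    have fuv : homeo_leaf f u <> homeo_leaf f v by move/homeo_leaf_inj.
    by apply: (sides_unique fuv); [exact: fs|exact: fs|exact/homeo_side|exact/homeo_side].
  apply: iff_trans (side_component_cyc pC qC rC) _.
  have cC l : is_side l C -> component C (pt l) by move/component_pt.
  apply: iff_trans (pres _ _ _ (cC p pC) (cC q qC) (cC r rC)) _.
  rewrite !homeo_leafE C'E; apply: iff_sym.
  by apply: side_component_cyc; apply/homeo_side.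
exists (homeo_cantorgon f C); split; first exact: homeo_component.
have [[] cP x y z Cx Cy Cz] := homeo_sign f C; first exact: cP.
have [l [_ [_ lC _]]] := two_sides C.
have [p [q [pC qC [pq lp lq]]]] := three_sides lC.
have cC k : is_side k C -> component C (pt k) by move/component_pt.
have key (u v w : @leaf R) : is_side u C -> is_side v C -> is_side w C -> u <> v -> v <> w -> u <> w ->
    ~ cyc (la u) (la v) (la w).
  move=> uC vC wC uv vw uw c; have fs (k : @leaf R) : is_side k C -> is_side (homeo_leaf f k) (homeo_cantorgon f C).
    by move/homeo_side.
  have c1 : side_cyc C u v w by apply/side_cycP.
  have /(side_component_cyc (fs _ uC) (fs _ vC) (fs _ wC)) c2 := (H C u v w uC vC wC).1 c1.
  have /(cP _ _ _ (cC _ uC) (cC _ vC) (cC _ wC)) := (side_component_cyc uC vC wC).1 c1.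
  rewrite !homeo_leafE; have fc k : is_side k C -> component (homeo_cantorgon f C) (pt (homeo_leaf f k)).
    by move=> /fs/component_pt.
  have [h1 h2 h3] := component_cyc_neq c2.
  by have [_ ->] := component_cycC (fc _ wC) (fc _ vC) (fc _ uC) (nesym h2) (nesym h1) (nesym h3).
have lan (u v : @leaf R) : u <> v -> la u != la v by move=> /la_neq[].
case: (key q p l) => //; try exact: nesym.
rewrite cycC; [|exact/lan/nesym|exact/lan/nesym|exact/lan/nesym].
by apply/negP/key.
Qed.

Lemma aut_plus_subgroup : is_subgroup (@aut_plus (basilica_tree R)).
Proof.
split=> [C p q r pC qC rC //|g h gP hP C p q r pC qC rC].
have iV e v : incident e v -> incident (aut_e (h^-1)%g e) (aut_v (h^-1)%g v).
  by move=> ev; apply/(aut_incident (h^-1)%g).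
rewrite -gP; try exact: iV.
rewrite [X in _ <-> X]hP; try exact: iV.
by rewrite !(@aut_eVK _ h) (@aut_vVK _ h).
Qed.

Lemma Pi1 : Pi (1%g : homeo (basilica R)) = 1%g.
Proof. by apply: aut_eq => l /=; apply: pt_inj; rewrite -homeo_leafE. Qed.

Lemma PiV f : Pi (f^-1)%g = (Pi f)^-1%g.
Proof. by apply: aut_eq => l. Qed.

Lemma homeo_plus_subgroup : is_subgroup (@homeo_plus R).
Proof.
have [A1 AM] := aut_plus_subgroup; split; first by apply/homeo_plusE; rewrite Pi1.
move=> f f' /homeo_plusE fP /homeo_plusE f'P.
by apply/homeo_plusE; rewrite PiM PiV; exact: AM.
Qed.

Lemma Pi_iso (A : set (homeo (basilica R))) (B : set (cyc_aut (basilica_tree R))) :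
  is_subgroup A -> is_subgroup B -> (forall f, A f <-> B (Pi f)) ->
  topgroup_iso A B (@Pi R).
Proof.
move=> sA sB AB; split=> //.
- split.
  + by move=> f /AB.
  + by move=> f f' _ _ e; rewrite -(PiK f) e PiK.
  + by move=> g Bg; exists (Psi g); [apply/AB; rewrite PsiK|exact: PsiK].
- by move=> f f' _ _; exact: PiM.
- split; first exact/continuous_subspaceT/Pi_continuous.
  exists (@Psi R); split.
  + by move=> g Bg; apply/AB; rewrite PsiK.
  + by move=> f _; exact: PiK.
  + by move=> g _; exact: PsiK.
  + exact/continuous_subspaceT/Psi_continuous.
Qed.

Lemma Pi_iso_full : topgroup_iso [set: homeo (basilica R)] [set: cyc_aut (basilica_tree R)] (@Pi R).
Proof. by apply: Pi_iso. Qed.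

Lemma Pi_iso_plus : topgroup_iso (@homeo_plus R) (@aut_plus (basilica_tree R)) (@Pi R).
Proof.
by apply: Pi_iso; [exact: homeo_plus_subgroup|exact: aut_plus_subgroup|exact: homeo_plusE].
Qed.

End Continuity.

(** * Perfect diagrams *)

Section Diagrams.
Context {R : realType}.
Implicit Types (s t u v a b : R) (l m p q : @leaf R) (C : @cantorgon R)
  (K J : R * R) (I T : set (R * R)) (D : set (set (circle R))) (n k i j : nat).

Definition tri_itv n j : R * R := (tri n j, tri n j.+1).

Definition is_tri n K := exists2 j, (j < 2 * 3 ^ n)%N & K = tri_itv n j.

Definition sub_itv K J := J.1 <= K.1 /\ K.2 <= J.2.

Definition inside l K := K.1 < la l /\ lb l < K.2.

Lemma is_tri_lt n K : is_tri n K -> [/\ 0 <= K.1, K.1 < K.2 & K.2 <= 2].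
Proof. by move=> [j jn ->] /=; rewrite tri_ge0 lt_triE ltnSn tri_le2. Qed.

Lemma is_tri_nested n n' K K' : (n <= n')%N -> is_tri n K -> is_tri n' K' ->
  sub_itv K' K \/ (K'.2 <= K.1 \/ K.2 <= K'.1).
Proof.
move=> nn' [j jn ->] [j' jn' ->]; rewrite /sub_itv /=.
have [d ->] : exists d, n' = (d + n)%N by exists (n' - n)%N; rewrite subnK.
rewrite !(tri_lift d n) !le_triE mulSn.
have : (0 < 3 ^ d)%N by rewrite expn_gt0.
case: (ltnP j' (j * 3 ^ d)) => h1; first by right; left.
by case: (ltnP j' (3 ^ d + j * 3 ^ d)) => h2; [left|right; right].
Qed.

Lemma is_tri_inj n n' K : is_tri n K -> is_tri n' K -> n = n'.
Proof.
wlog nn' : n n' / (n <= n')%N => [H h h'|].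
  by have [nn|/ltnW nn] := leqP n n'; [exact: H|apply/esym; exact: H].
move=> [j jn ->] [j' jn' [/eqP e1 /eqP e2]]; move: e1 e2.
have [d dE] : exists d, n' = (d + n)%N by exists (n' - n)%N; rewrite subnK.
rewrite dE !(tri_lift d n) !eq_tri !eqn_pmul2r ?expn_gt0// mulSn => /eqP e1 /eqP e2.
have : (3 ^ d = 1)%N by lia.
by case: d dE {e1 e2} => //= d; rewrite expnS; lia.
Qed.

Lemma triS3 n j : tri n.+1 (3 * j).+1 = tri n j + (tri n j.+1 - tri n j) / 3 :> R /\
  tri n.+1 (3 * j).+2 = tri n j + 2 * (tri n j.+1 - tri n j) / 3 :> R.
Proof.
have p0 : 3 ^+ n != 0 :> R by exact/lt0r_neq0/pow3_gt0.
by rewrite /tri exprS -!natr1 natrM; split; field.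
Qed.

Lemma is_tri_thirds n K a b : is_tri n K -> a = K.1 + (K.2 - K.1) / 3 -> b = K.1 + 2 * (K.2 - K.1) / 3 ->
  exists j, [/\ (j < 2 * 3 ^ n)%N, K = tri_itv n j,
   (K.1, a) = tri_itv n.+1 (3 * j), (a, b) = tri_itv n.+1 (3 * j).+1 &
   (b, K.2) = tri_itv n.+1 (3 * j).+2].
Proof.
move=> [j jn ->] /= aE bE; have [e1 e2] := triS3 n j; exists j; rewrite /tri_itv aE bE e1 e2.
by split=> //; rewrite triS // [tri n j.+1]triS; congr (_, tri _ _); lia.
Qed.

Lemma perfect_tri D I : perfect_diagram D I -> forall K, I K -> exists n, is_tri n K.
Proof.
elim=> {D I} [K|D I u v a b _ IH Iuv aE bE K].
  have z : tri 0 0 = 0 :> R by rewrite /tri mul0r.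
  have e k : tri 0 k = k%:R :> R by rewrite /tri expr0 divr1.
  by move=> [->|->]; exists 0%N; [exists 0%N|exists 1%N] => //; rewrite /tri_itv ?e.
move=> [[IK _]|]; first exact: IH.
have [n nuv] := IH _ Iuv; have [j [jn _ e1 e2 e3]] := is_tri_thirds nuv aE bE.
by move=> [[->|->]|->]; exists n.+1; rewrite ?e1 ?e2 ?e3;
  [exists (3 * j)%N|exists (3 * j).+1|exists (3 * j).+2] => //; rewrite expnS; lia.
Qed.

Lemma perfect_finite D I : perfect_diagram D I -> finite_set I.
Proof.
elim=> {D I} [|D I u v a b _ IH _ _ _]; first by rewrite finite_setU; split; exact: finite_set1.
rewrite !finite_setU; split; first exact: finite_setD.
by split; [split; exact: finite_set1|exact: finite_set1].
Qed.

Lemma perfect_cover D I : perfect_diagram D I -> forall t, 0 < t <= 2 ->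
  exists2 K, I K & K.1 < t <= K.2.
Proof.
elim=> {D I} [t t02|D I u v a b P IH Iuv aE bE t t02].
  have [t1|t1] := leP t 1; first by exists (0, 1); [left|rewrite /= t1; lra].
  by exists (1, 2); [right|rewrite /= t1; lra].
have [n /is_tri_lt/= [u0 uv v2]] := perfect_tri P Iuv.
have [K IK tK] := IH t t02; have [KE|KE] := pselect (K = (u, v)); last by exists K => //; left.
rewrite KE /= in tK; have [ta|ta] := leP t a; first by exists (u, a); [right; left; left|rewrite /= ta; lra].
have [tb|tb] := leP t b; first by exists (a, b); [right; left; right|rewrite /= tb; lra].
by exists (b, v); [right; right|rewrite /= tb; lra].
Qed.

Definition disjoint_itvs I := forall K J, I K -> I J -> K <> J -> K.2 <= J.1 \/ J.2 <= K.1.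

Lemma perfect_disjoint D I : perfect_diagram D I -> disjoint_itvs I.
Proof.
elim=> {D I} [K J|D I u v a b P IH Iuv aE bE].
  by move=> [->|->] [->|->] //= _; [left|right].
have [n /is_tri_lt/= [u0 uv v2]] := perfect_tri P Iuv.
have third K : [set (u, a); (a, b); (b, v)] K -> u <= K.1 /\ K.2 <= v.
  by move=> [[->|->]|->] /=; lra.
move=> K J [[IK /= Kuv]|K3] [[IJ /= Juv]|J3] KJ.
- exact: IH.
- by have := third _ J3; have [] := IH _ _ IK Iuv Kuv; rewrite /=; [left|right]; lra.
- by have := third _ K3; have [] := IH _ _ IJ Iuv Juv; rewrite /=; [right|left]; lra.
- by move: K3 J3 KJ => [[->|->]|->] [[->|->]|->] //= _; first [left; lra|right; lra].
Qed.

Lemma inside_tri n j l : inside l (tri_itv n j) <-> tri n j < la l < tri n j.+1.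
Proof.
have [_ ab _] := leaf_ltW l; rewrite /inside /=; split=> [[h1 h2]|h]; first by lra.
by have := h; rewrite leaf_in_tri; lra.
Qed.

Lemma inside_thirds n j l : (j < 2 * 3 ^ n)%N -> inside l (tri_itv n j) ->
  [\/ lv l = n.+1 /\ lk l = j, inside l (tri_itv n.+1 (3 * j)),
      inside l (tri_itv n.+1 (3 * j).+1) | inside l (tri_itv n.+1 (3 * j).+2)].
Proof.
move=> jn lj; have [lv1|lv1] := leqP (lv l) n.+1.
  have /inside_tri := lj; rewrite /la.
  have [lv2|lv2] := leqP (lv l) n.
    have [d dE] : exists d, n = (d + lv l)%N by exists (n - lv l)%N; rewrite subnK.
    by rewrite [tri (lv l) _](tri_lift d) -dE !lt_triE; lia.
  have lvE : lv l = n.+1 by lia.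
  by rewrite lvE ![tri n _]triS !lt_triE => h; apply: Or41; split=> //; lia.
have ou i := @tri_outside R n.+1 i _ (lk l) lv1; rewrite -/(la l) -/(lb l) in ou.
move: lj; rewrite /inside /= triS [tri n j.+1]triS.
have -> : (3 * j.+1 = (3 * j).+3)%N by lia.
move=> [h1 h2]; have [_ ab _] := leaf_ltW l.
have [q1|q1] := ou (3 * j).+1; last by apply: Or42; split=> //=; lra.
have [q2|q2] := ou (3 * j).+2; last by apply: Or43; split=> //=; lra.
by apply: Or44; split.
Qed.

Lemma mid_leaf_exists n j : (j < 2 * 3 ^ n)%N -> exists l, [/\ lv l = n.+1, lk l = j,
  la l = tri n.+1 (3 * j).+1 & lb l = tri n.+1 (3 * j).+2].
Proof.
move=> jn; have c : is_code n.+1 j by rewrite /is_code expnS; lia.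
exists (mkleaf c); have [-> -> -> ->] := @mkleafE R _ _ c; split=> //.
  by rewrite addn1.
by rewrite addn2.
Qed.

(** The leafs of a diagram are recovered from its intervals, so an isomorphism of diagrams can be
    checked on intervals. In the step, the only leaf inside [(u, v)] and inside none of its thirds
    is the middle one. *)
Lemma perfect_leafs D I : perfect_diagram D I -> forall A,
  D A <-> exists2 l, A = leaf_ends l & forall K, I K -> ~ inside l K.
Proof.
elim=> {D I} [A|D I u v a b P IH Iuv aE bE A].
  have c0 : is_code 0 0 by [].
  have e k : tri 0 k = k%:R :> R by rewrite /tri expr0 divr1.
  have [lv0 lk0 la0 lb0] := @mkleafE R _ _ c0; rewrite !e in la0 lb0.
  have rootE : leaf_ends (mkleaf c0) = [set to_circle 0; to_circle 1] :> set (circle R).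
    rewrite (@leaf_codeE R (mkleaf c0)).2 la0 lb0 setUC.
    by have := to_circleD2 (0 : R) 1; rewrite add0r mulr1z mulr1 => ->.
  split=> [->|[l -> lI]].
    exists (mkleaf c0) => // K [->|->]; rewrite /inside la0 lb0 /= => -[]; lra.
  have lv0' : lv l = 0%N.
    apply/eqP; rewrite -leqn0 leqNgt; apply/negP => l0.
    have [a0 ab b2] := leaf_ltW l.
    have := @tri_outside R 0 1 _ (lk l) l0; rewrite e -/(la l) -/(lb l) => -[r1|r1].
      have := @tri_outside R 0 2 _ (lk l) l0; rewrite e -/(la l) -/(lb l) => -[r2|r2]; first by have := lt_le_trans (lt_trans r2 ab) b2; rewrite ltxx.
      by apply: (lI (1, 2)); [right|split].
    by apply: (lI (0, 1)); [left|split].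
  rewrite -rootE; congr leaf_ends; apply: leaf_code_inj; rewrite ?lv0 ?lk0//.
  by have := leaf_code l; rewrite /is_code lv0'; lia.
have [n nuv] := perfect_tri P Iuv.
have [j [jn uvE e1 e2 e3]] := is_tri_thirds nuv aE bE.
have [m [lvm lkm lam lbm]] := mid_leaf_exists jn.
have [aE' bE'] : a = la m /\ b = lb m by case: e2 => -> ->; rewrite lam lbm.
have mE : leaf_ends m = [set to_circle a; to_circle b].
  by rewrite (leaf_codeE m).2 aE' bE'.
have muv : inside m (u, v).
  by rewrite uvE; apply/inside_tri; rewrite lam triS [tri n j.+1]triS !lt_triE; lia.
have dis := perfect_disjoint P; have [_ mab _] := leaf_ltW m.
have [u0 uv v2] := is_tri_lt nuv; rewrite /= in u0 uv v2.
have third K : [set (u, a); (a, b); (b, v)] K -> u <= K.1 /\ K.2 <= v.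
  by move=> [[->|->]|->] /=; lra.
split=> [[/IH[l -> lI]|->]|[l -> lI]].
- exists l => // K [[IK _]|K3]; first exact: lI.
  move=> [h1 h2]; have [t1 t2] := third K K3; apply: (lI _ Iuv).
  by split=> /=; lra.
- exists m => // K [[IK /= Kuv]|K3] [h1 h2].
    have [mu mv] := muv; rewrite /= in mu mv.
    by have [] := dis _ _ IK Iuv Kuv; rewrite /=; lra.
  by move: K3 h1 h2 => [[->|->]|->] /=; rewrite -aE' -bE' => *; lra.
have [luv|luv] := pselect (inside l (u, v)); last first.
  left; apply/IH; exists l => // K IK; have [->|KE] := pselect (K = (u, v)) => //.
  by apply: lI; left.
right; rewrite /= -mE; congr leaf_ends.
rewrite uvE in luv; have := inside_thirds jn luv.
rewrite -e1 -e2 -e3 /=; case=> [[lvl lkl]|h|h|h].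
- by apply: leaf_code_inj; rewrite ?lvm ?lkm.
- by case: (lI (u, a)) => //; right; left; left.
- by case: (lI (a, b)) => //; right; left; right.
- by case: (lI (b, v)) => //; right; right.
Qed.

End Diagrams.

(** * Thompson maps preserve orientation *)

Section Thompson.
Context {R : realType}.
Implicit Types (s t u v a b : R) (l m p q : @leaf R) (C : @cantorgon R)
  (K J : R * R) (I T : set (R * R)) (D : set (set (circle R))) (n k i j : nat).

Lemma side_between C p q : p <> q -> is_side p C -> is_side q C ->
  exists r : @leaf R, [/\ is_side r C, r <> p, r <> q & cyc (la p) (la r) (la q)].
Proof.
move=> pq pC qC; have [a [b A]] := arc_pq_exists pq (sides_unsep pC qC).
have [m mc] := arc_leaf A.
have mp : m <> p by move=> mp; move: mc; rewrite (arc_endsF A (or_introl mp)); [|left].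
have mq : m <> q by move=> mq; move: mc; rewrite (arc_endsF A (or_intror mq)); [|left].
move: mc; rewrite (arc_pqP pq A mp mq) => /and3P[/eqP m1 /eqP m2 mc].
rewrite (side_sd qC pq) in m1; rewrite (side_sd pC (nesym pq)) in m2.
have [r [rC rp rq rm]] := towards_side pq pC qC mp mq m1 m2.
by exists r; split=> //; rewrite -(towards_cyc pq pC qC mp mq rp rq rm).
Qed.

(** With finitely many sides one would come next after [p], against [side_between]; [f] is the
    counterclockwise distance from [p]. *)
Lemma infinite_sides C : infinite_set [set l | is_side l C].
Proof.
move=> fin; have [p [q [pq pC qC]]] := two_sides C.
pose A := [set l | is_side l C /\ l <> p].
pose f l := if la p < la l then la l - la p else la l - la p + 2.
have [||r0 [r0C r0p] rmin] := @finite_argmin R _ A f.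
- by apply: (sub_finite_set _ fin) => l [].
- by exists q; split=> // /esym.
have [r [rC rp rr0 c]] := side_between (nesym r0p) pC r0C.
have := rmin r (conj rC rp); have [p02 _] := leaf_end_itv p; have [r02 _] := leaf_end_itv r.
have [r002 _] := leaf_end_itv r0; move: c; rewrite /f /cyc leNgt => c /negP; apply.
move: c; case: (ltgtP (la p) (la r)) => // h1; case: (ltgtP (la p) (la r0)) => //= h2;
  case: (ltgtP (la r) (la r0)) => //= h3 _; try lra.
Qed.

Lemma three_ordered (A : set (@leaf R)) : infinite_set A -> exists l1 l2 l3,
  [/\ A l1, A l2, A l3 & la l1 < la l2 < la l3].
Proof.
move=> inf; have H (B : set (@leaf R)) : finite_set B -> exists2 l, A l & ~ B l.
  move=> fB; apply: contrapT => no; apply: inf; apply: (sub_finite_set _ fB) => l Al.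
  by apply: contrapT => Bl; apply: no; exists l.
have [l1 A1 _] := H set0 (finite_set0 _).
have [l2 A2 /= n2] := H [set l1] (finite_set1 _).
have fin2 : finite_set ([set l1] `|` [set l2]) by rewrite finite_setU; split; exact: finite_set1.
have [l3 A3 /= n3] := H _ fin2.
have n12 : la l1 != la l2 by have [] := la_neq (nesym n2).
have n13 : la l1 != la l3.
  by have /la_neq[] : l1 <> l3 by move=> e; apply: n3; left.
have n23 : la l2 != la l3.
  by have /la_neq[] : l2 <> l3 by move=> e; apply: n3; right.
move: n12 n13 n23; case: (ltgtP (la l1) (la l2)) => // h1 _; case: (ltgtP (la l1) (la l3)) => // h2 _;
  case: (ltgtP (la l2) (la l3)) => // h3 _.
all: try (exfalso; clear -h1 h2 h3; lra).
- by exists l1, l2, l3; rewrite h1 h3.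
- by exists l1, l3, l2; rewrite h2 h3.
- by exists l3, l1, l2; rewrite h1 h2.
- by exists l2, l1, l3; rewrite h1 h2.
- by exists l2, l3, l1; rewrite h2 h3.
- by exists l3, l2, l1; rewrite h1 h3.
Qed.

(* Every Cantorgon has three sides with an end in the same interval of the
   diagram, on which a Thompson map is linear. *)
Lemma Pi_thompson (f : homeo (basilica R)) : basilica_thompson f -> aut_plus (Pi f).
Proof.
move=> [h [D1 [I1 [D2 [I2 [phi [P1 P2 _ lin]]]]]] fh] C.
pose A K := [set l | is_side l C /\ K.1 < la l <= K.2].
have [K IK inf] : exists2 K, I1 K & infinite_set (A K).
  apply: contrapT => no; apply: (@infinite_sides C).
  apply: (@sub_finite_set _ _ (\bigcup_(K in I1) A K)) => [l lC|].
    by have [K IK lK] := perfect_cover P1 (leaf_end_itv l).1; exists K.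
  apply: bigcup_finite; first exact: perfect_finite P1.
  by move=> K IK; apply: contrapT => inf; apply: no; exists K.
have [l1 [l2 [l3 [[l1C l1K] [l2C l2K] [l3C l3K] /andP[l12 l23]]]]] := three_ordered inf.
have [n /is_tri_lt[K0 K12 K2]] := perfect_tri P1 IK.
have IK' : I1 (K.1, K.2) by rewrite -surjective_pairing.
have [u' [v' [I2K _ _ hK]]] := lin _ _ IK'.
have [n' /is_tri_lt/= [u'0 u'v' v'2]] := perfect_tri P2 I2K.
(* The image of [la l] under the linear piece. It increases with [la l], so the three image sides
   keep their cyclic order. *)
pose w l := u' + (la l - K.1) / (K.2 - K.1) * (v' - u').
have Kp : 0 < K.2 - K.1 by rewrite subr_gt0.
have wE l : K.1 < la l <= K.2 -> [/\ 0 < w l <= 2, u' < w l & is_end (aut_e (Pi f) l) (w l)].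
  move=> /andP[lK1 lK2]; pose t := (la l - K.1) / (K.2 - K.1).
  have t01 : 0 < t <= 1 by rewrite divr_gt0 ?subr_gt0//= ler_pdivrMr// mul1r lerD2r.
  have t1 : 0 < t * (v' - u') by rewrite mulr_gt0 ?subr_gt0//; lra.
  have t2 : t * (v' - u') <= v' - u' by rewrite ler_piMl ?subr_ge0 ?(ltW u'v')//; lra.
  have w02 : 0 < w l <= 2 by rewrite /w -/t; lra.
  split=> //; first by rewrite /w -/t; lra.
  apply/(bq_ptP _ w02); rewrite /= -homeo_leafE /pt /bq fh.
  have := hK t; rewrite -/(w l) => <-; last by lra.
  by congr (to_basilica (h (to_circle _))); rewrite /t divfK ?lt0r_neq0//; lra.
have wlt l m : la l < la m -> w l < w m.
  move=> lm; rewrite /w ltrD2l ltr_pM2r ?subr_gt0// ltr_pM2r ?invr_gt0//; lra.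
have [[w1 w1' e1] [w2 w2' e2] [w3 w3' e3]] := And3 (wE _ l1K) (wE _ l2K) (wE _ l3K).
have GI := @aut_e_inj R (Pi f).
have n12 : l1 <> l2 by move=> e; move: l12; rewrite e ltxx.
have n23 : l2 <> l3 by move=> e; move: l23; rewrite e ltxx.
have n13 : l1 <> l3 by move=> e; have := lt_trans l12 l23; rewrite e ltxx.
have S l : is_side l C -> is_side (aut_e (Pi f) l) (aut_v (Pi f) C) by move=> h0; apply/homeo_side.
have c : side_cyc C l1 l2 l3.
  by apply/side_cycP => //; rewrite /cyc l12 l23.
have c' : side_cyc (aut_v (Pi f) C) (aut_e (Pi f) l1) (aut_e (Pi f) l2) (aut_e (Pi f) l3).
  split; [exact: S|exact: S|exact: S|by split; move/GI|].
  exists (to_circle (w l1)), (to_circle (w l2)), (to_circle (w l3)).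
  have E l t : is_end l t -> leaf_ends l (to_circle t).
    by move=> [->|->]; apply/leaf_endsE; [left|right].
  by split; [exact: E|exact: E|exact: E|apply/circle_cycE => //; rewrite /cyc (wlt _ _ l12) (wlt _ _ l23)].
case: (aut_respects (Pi f) C) => // rev.
have := (rev l1 l2 l3 l1C l2C l3C).1 c; have := c'.
move=> /side_cycP -/(_ (S _ l1C) (S _ l2C) (S _ l3C)) H.
have {}H := H (fun e => n12 (GI _ _ e)) (fun e => n23 (GI _ _ e)) (fun e => n13 (GI _ _ e)).
move=> /side_cycP -/(_ (S _ l3C) (S _ l2C) (S _ l1C)) H'.
have {}H' := H' (fun e => n23 (esym (GI _ _ e))) (fun e => n12 (esym (GI _ _ e))) (fun e => n13 (esym (GI _ _ e))).
by have := cyc_asym H; rewrite H'.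
Qed.

End Thompson.

(** * Tilings by triadic intervals and perfect diagrams *)

Section Tiling.
Context {R : realType}.
Implicit Types (t a b : R)
  (K J : R * R) (I T : set (R * R)) (D : set (set (circle R))) (n m d k i j N : nat).

(** Intervals are taken closed on the right only, to match coordinates in (0,2]; the bound [N] on
    the levels makes subdivision terminate. *)
Definition tiling N T :=
  [/\ forall K, T K -> exists2 n, (n <= N)%N & is_tri n K,
      forall t, 0 < t <= 2 -> exists2 K, T K & K.1 < t <= K.2 &
      forall t K K', T K -> T K' -> K.1 < t <= K.2 -> K'.1 < t <= K'.2 -> K = K'].

Lemma is_tri_sub n n' K K' t : (n <= n')%N -> is_tri n K -> is_tri n' K' ->
  K.1 < t <= K.2 -> K'.1 < t <= K'.2 -> sub_itv K' K.
Proof. by move=> nn' hK hK' tK tK'; have [//|[h|h]] := is_tri_nested nn' hK hK'; lra. Qed.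

Lemma sub_itv_anti K J : sub_itv K J -> sub_itv J K -> K = J.
Proof.
case: K J => [a b] [c d] [/= h1 h2] [/= h3 h4].
by congr (_, _); apply/le_anti; rewrite ?h1 ?h2 ?h3 ?h4.
Qed.

(** [J] is subdivided down to the tiles inside it, by induction on the number [d] of levels left. No
    tile is strictly larger than [J], so [J] is itself a tile or may be cut into thirds. *)
Lemma tiling_refine N T d m J D I : tiling N T -> (N < m + d)%N -> is_tri m J ->
  (forall K, T K -> sub_itv J K -> K = J) -> perfect_diagram D I -> I J ->
  exists D', perfect_diagram D' ((I `\ J) `|` [set K | T K /\ sub_itv K J]).
Proof.
move=> [Ttri Tcov Tuniq]; elim: d m J D I => [|d IH] m J D I Nm Jm NS P IJ.
  have [J0 J12 J2] := is_tri_lt Jm.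
  have [|K TK tK] := Tcov J.2; first by lra.
  have [n nN nK] := Ttri _ TK; have nm : (n <= m)%N by lia.
  have KJ := NS _ TK (is_tri_sub nm nK Jm tK (ltac:(by rewrite J12 lexx))).
  move: nK; rewrite KJ => nK; have := is_tri_inj nK Jm; lia.
have [TJ|TJ] := pselect (T J).
  exists D; suff -> : (I `\ J) `|` [set K | T K /\ sub_itv K J] = I by [].
  apply/seteqP; split=> [K [[]//|[TK KJ]]|K IK]; last first.
    by have [->|KJ] := pselect (K = J); [right; split=> //; split|left].
  have [n _ nK] := Ttri _ TK; have [K0 K12 K2] := is_tri_lt nK; case: KJ => h1 h2.
  by rewrite (Tuniq K.2 K J) ?lexx ?andbT//; lra.
pose a := J.1 + (J.2 - J.1) / 3; pose b := J.1 + 2 * (J.2 - J.1) / 3.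
have [j [jm JE e1 e2 e3]] := is_tri_thirds Jm (erefl a) (erefl b).
pose J1 := (J.1, a); pose J2 := (a, b); pose J3 := (b, J.2).
have [J0 J12 J22] := is_tri_lt Jm.
have [ab1 ab2 ab3] : [/\ J.1 < a, a < b & b < J.2] by rewrite /a /b; split; lra.
have t1 : is_tri m.+1 J1 by exists (3 * j)%N => //; rewrite expnS; lia.
have t2 : is_tri m.+1 J2 by exists (3 * j).+1 => //; rewrite expnS; lia.
have t3 : is_tri m.+1 J3 by exists (3 * j).+2 => //; rewrite expnS; lia.
have NS' J' : is_tri m.+1 J' -> sub_itv J' J -> forall K, T K -> sub_itv J' K -> K = J'.
  move=> tJ' sJ' K TK sK; have [n nN nK] := Ttri _ TK.
  have [_ J'12 _] := is_tri_lt tJ'; case: (sJ') => h1 h2; case: (sK) => h3 h4.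
  have [nm|mn] := leqP n m; last first.
    by apply: sub_itv_anti => //; apply: (is_tri_sub mn tJ' nK (t := J'.2)); lra.
  have KJ : sub_itv J K by apply: (is_tri_sub nm nK Jm (t := J'.2)); lra.
  by have := TK; rewrite (NS _ TK KJ).
have IJ' : I (J.1, J.2) by rewrite -surjective_pairing.
have P1 := perfect_step P IJ' (erefl a) (erefl b); rewrite -surjective_pairing in P1.
have Nd : (N < m.+1 + d)%N by lia.
have s1 : sub_itv J1 J by split => /=; lra.
have s2 : sub_itv J2 J by split => /=; lra.
have s3 : sub_itv J3 J by split => /=; lra.
have [|D2 P2] := IH _ _ _ _ Nd t1 (NS' _ t1 s1) P1; first by right; left; left.
have n12 : J2 <> J1 by move=> [e _]; move: ab1; rewrite -e ltxx.
have n13 : J3 <> J1 by move=> [e _]; move: ab1 ab2; lra.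
have n23 : J3 <> J2 by move=> [e _]; move: ab2; rewrite -e ltxx.
have [|D3 P3] := IH _ _ _ _ Nd t2 (NS' _ t2 s2) P2; first by left; split=> //; right; left; right.
have [|D4 P4] := IH _ _ _ _ Nd t3 (NS' _ t3 s3) P3; first by left; split=> //; left; split=> //; right; right.
exists D4; suff <- : ((((I `\ J `|` [set J1; J2; J3]) `\ J1 `|` [set K | T K /\ sub_itv K J1]) `\ J2
  `|` [set K | T K /\ sub_itv K J2]) `\ J3 `|` [set K | T K /\ sub_itv K J3]) =
  I `\ J `|` [set K | T K /\ sub_itv K J] by [].
have dis := perfect_disjoint P.
have f0 : [/\ J1.2 <= J2.1, J1.2 <= J3.1 & J2.2 <= J3.1] by rewrite /= lexx (ltW ab2).
have [f01 f02 f03] := f0; clear n12 n13 n23 JE e1 e2 e3.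
have f1 K : I K -> K <> J -> [/\ K <> J1, K <> J2 & K <> J3].
  move=> IK KJ; have [n nK] := perfect_tri P IK; have [_ K12 _] := is_tri_lt nK.
  by have h := dis _ _ IK IJ KJ; split=> KE; move: h K12; rewrite KE /=; lra.
have f2 K : T K -> sub_itv K J -> [\/ sub_itv K J1, sub_itv K J2 | sub_itv K J3].
  move=> TK KJ; have [n nN nK] := Ttri _ TK; have [_ K12 _] := is_tri_lt nK.
  have [nm|mn] := leqP n m.
    have h : sub_itv J K by case: KJ => h1 h2; apply: (is_tri_sub nm nK Jm (t := K.2)); lra.
    by have := NS _ TK h => KE; rewrite KE in TK.
  have S J' : is_tri m.+1 J' -> J'.1 < K.2 <= J'.2 -> sub_itv K J'.
    by move=> tJ' h; apply: (is_tri_sub mn tJ' nK h); rewrite K12 lexx.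
  case: KJ => h1 h2; have [h|h] := leP K.2 a; first by apply/Or31/S => //=; lra.
  by have [h'|h'] := leP K.2 b; [apply/Or32/S|apply/Or33/S] => //=; lra.
have f3 K J' J'' : T K -> sub_itv K J' -> sub_itv K J'' -> J'.2 <= J''.1 -> False.
  by move=> TK [h1 h2] [h3 h4] h5; have [n nN nK] := Ttri _ TK; have [_ K12 _] := is_tri_lt nK; clear -K12 h1 h2 h3 h4 h5; lra.
have f4 K : T K -> sub_itv K J1 -> K <> J2 /\ K <> J3.
  by move=> TK h; split=> e; [apply: (f3 K J1 J2)|apply: (f3 K J1 J3)] => //; rewrite e; split.
have f5 K : T K -> sub_itv K J2 -> K <> J3.
  by move=> TK h e; apply: (f3 K J2 J3) => //; rewrite e; split.
have tr K J' : sub_itv J' J -> sub_itv K J' -> sub_itv K J.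
  by move=> [h1 h2] [h3 h4]; split; lra.
apply/seteqP; split=> K /=.
  have := tr K _ s1; have := tr K _ s2; have := tr K _ s3; tauto.
move=> [[IK KJ]|[TK KJ]].
  by have [k1 k2 k3] := f1 _ IK KJ; left; split=> //; left; split=> //; left; split=> //; left.
have [h|h|h] := f2 _ TK KJ; last by right.
  by have [k2 k3] := f4 _ TK h; left; split=> //; left; split=> //; right.
by have k3 := f5 _ TK h; left; split=> //; right.
Qed.

Lemma tiling_perfect N T : tiling N T -> exists D, perfect_diagram D T.
Proof.
move=> tT; have [Ttri Tcov Tuniq] := tT.
have e k : tri 0 k = k%:R :> R by rewrite /tri expr0 divr1.
have t1 : is_tri 0 (0 : R, 1 : R) by exists 0%N => //; rewrite /tri_itv !e.
have t2 : is_tri 0 (1 : R, 2 : R) by exists 1%N => //; rewrite /tri_itv !e.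
have NS J : is_tri 0 J -> forall K, T K -> sub_itv J K -> K = J.
  move=> J0 K TK [h1 h2]; have [n _ nK] := Ttri _ TK; have [_ J12 _] := is_tri_lt J0.
  by apply: sub_itv_anti; [apply: (is_tri_sub (leq0n n) J0 nK (t := J.2))|split]; lra.
have Nd : (N < 0 + N.+1)%N by [].
have [|D1 P1] := tiling_refine tT Nd t1 (NS _ t1) (perfect_start R); first by left.
have [|D2 P2] := tiling_refine tT Nd t2 (NS _ t2) P1.
  by left; split; [right|move=> [/eqP]; rewrite oner_eq0].
exists D2; move: P2; congr perfect_diagram; apply/seteqP; split=> [K /=|K TK /=].
  by move=> [[[[[->|->]]|[]]]|[]].
have [n _ nK] := Ttri _ TK; have [K0 K12 K2] := is_tri_lt nK.
have S J : is_tri 0 J -> J.1 < K.2 <= J.2 -> sub_itv K J.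
  by move=> J0 h; apply: (is_tri_sub (leq0n n) J0 nK h); rewrite K12 lexx.
have [K1|K1] := leP K.2 1; last by right; split=> //; apply: S => //=; lra.
left; split; first by right; split=> //; apply: S => //=; lra.
by move=> KE; move: K1; rewrite KE /= ; lra.
Qed.

Lemma tri_cover n t : 0 < t <= 2 -> exists2 j, (j < 2 * 3 ^ n)%N & tri n j < t <= tri n j.+1.
Proof.
rewrite -(tri2 n) => /andP[t0]; elim: (2 * 3 ^ n)%N => [|j IH] tj.
  by move: tj; rewrite /tri mul0r leNgt t0.
by have [/IH[i ij ti]|tj'] := leP t (tri n j); [exists i => //; apply: leq_trans ij _|exists j; rewrite ?tj'].
Qed.

Lemma level_tiling n : tiling n [set K | is_tri n K].
Proof.
split=> [K nK|t /(tri_cover n)[j jn tj]|t K K' nK nK' tK tK']; first by exists n.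
  by exists (tri_itv n j) => //; exists j.
by apply: sub_itv_anti; [exact: is_tri_sub (leqnn n) nK' nK tK' tK|exact: is_tri_sub (leqnn n) nK nK' tK tK'].
Qed.

End Tiling.

(** * Piecewise linear maps *)

Section Lifts.
Context {R : realType}.
Implicit Types (s t u v a b : R) (l : @leaf R) (F G : R -> R)
  (K J : R * R) (n m d k i j : nat) (f : homeo (basilica R)).

(** Each interval of level [n] goes linearly onto a triadic interval whose level [m] may vary.
    Equality holds in the circle because the values of a lift may leave [[0, 2]]. *)
Definition lin_on n F := forall j, (j < 2 * 3 ^ n)%N -> exists m i, (i < 2 * 3 ^ m)%N /\
  forall t, 0 <= t <= 1 ->
    to_circle (F (tri n j + t / 3 ^+ n)) = to_circle (tri m i + t / 3 ^+ m).

(* Lifts to the line of the piecewise linear homeomorphisms of the circle. *)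
Definition pl_lift F G :=
  [/\ cancel F G, cancel G F, {mono F : s t / s <= t}, forall t, F (t + 2) = F t + 2 &
   [/\ forall s t, bq s = bq t -> bq (F s) = bq (F t),
       forall s t, bq s = bq t -> bq (G s) = bq (G t) & exists n, lin_on n F]].

(** A class closed under products, in which all the generators lie; [tri_map_thompson] places it in
    the Thompson group without keeping track of diagrams in between. *)
Definition tri_map f := exists F G, pl_lift F G /\ forall t, f (bq t) = bq (F t).

Lemma lift_circle F s t : (forall t, F (t + 2) = F t + 2) ->
  to_circle s = to_circle t -> to_circle (F s) = to_circle (F t).
Proof.
move=> F2 /to_circleE[k ->]; suff -> : F (t + 2 * k%:~R) = F t + 2 * k%:~R by rewrite to_circleD2.
have P k' u : F (u + 2 * k'%:R) = F u + 2 * k'%:R.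
  elim: k' => [|k' IH]; first by rewrite mulr0 !addr0.
  have e : 2 * k'.+1%:R = 2 * k'%:R + 2 :> R by rewrite -(natr1 k') mulrDr mulr1.
  by rewrite e [in LHS]addrA F2 IH [RHS]addrA.
case: k => k'; first exact: P.
rewrite NegzE mulrNz mulrN; apply/eqP; rewrite -subr_eq opprK; apply/eqP.
by rewrite -P subrK.
Qed.

Lemma liftV F G : cancel F G -> cancel G F -> {mono F : s t / s <= t} ->
  (forall t, F (t + 2) = F t + 2) ->
  {mono G : s t / s <= t} /\ (forall t, G (t + 2) = G t + 2).
Proof.
move=> FK GK mF F2; split=> [s t|t]; first by rewrite -mF !GK.
by apply: (can_inj FK); rewrite F2 !GK.
Qed.

Lemma mono_continuous F G : cancel F G -> cancel G F -> {mono F : s t / s <= t} -> continuous F.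
Proof.
move=> FK GK mF t; have mF' := leW_mono mF.
apply/cvgrPdist_lt => e e0; near=> s.
have h1 : F t - e < F s by rewrite -[ltLHS]GK mF'; near: s; apply: lt_nbhsr; rewrite -mF' GK; lra.
have h2 : F s < F t + e by rewrite -[ltRHS]GK mF'; near: s; apply: lt_nbhsl; rewrite -mF' GK; lra.
by rewrite distrC ltr_distl h1.
Unshelve. all: by end_near. Qed.

Lemma bq_factor F : continuous F -> (forall s t, bq s = bq t -> bq (F s) = bq (F t)) ->
  exists2 phi : basilica R -> basilica R, continuous phi & forall t, phi (bq t) = bq (F t).
Proof.
move=> cF bF; have ex x : exists t, bq t = x by have [t _ <-] := @bq_surj R x; exists t.
pose phi x := bq (F (projT1 (cid (ex x)))); have phiE t : phi (bq t) = bq (F t).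
  by apply: bF; exact: projT2 (cid (ex _)).
exists phi => //; apply/continuousP => A oA; apply/bq_open.
have -> : bq @^-1` (phi @^-1` A) = (bq \o F) @^-1` A by apply/funext => t; rewrite /preimage /= phiE.
by move: A oA; apply/continuousP => t; apply: continuous_comp; [exact: cF|exact: bq_continuous].
Qed.

Lemma lift_homeo F G : pl_lift F G -> exists f, forall t, f (bq t) = bq (F t).
Proof.
move=> [FK GK mF F2 [bF bG _]]; have [mG _] := liftV FK GK mF F2.
have [phi cphi phiE] := bq_factor (mono_continuous FK GK mF) bF.
have [psi cpsi psiE] := bq_factor (mono_continuous GK FK mG) bG.
have K1 : cancel phi psi by move=> x; have [t _ <-] := bq_surj x; rewrite phiE psiE FK.
have K2 : cancel psi phi by move=> x; have [t _ <-] := bq_surj x; rewrite psiE phiE GK.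
by exists (Homeo K1 K2 cphi cpsi).
Qed.

Lemma tri_addE d n q r t : tri (d + n) (q * 3 ^ d + r) + t / 3 ^+ (d + n) =
  tri n q + ((r%:R + t) / 3 ^+ d) / 3 ^+ n :> R.
Proof.
have p k : 3 ^+ k != 0 :> R by exact/lt0r_neq0/pow3_gt0.
by rewrite /tri natrD natrM natrX exprD; field; rewrite !p.
Qed.

(** Cutting an interval into [3^d] equal parts cuts its image likewise, so the levels of both rise
    by [d]. *)
Lemma lin_refine d n F j : lin_on n F -> (j < 2 * 3 ^ (d + n))%N ->
  exists m i, (i < 2 * 3 ^ (d + m))%N /\ forall t, 0 <= t <= 1 ->
    to_circle (F (tri (d + n) j + t / 3 ^+ (d + n))) = to_circle (tri (d + m) i + t / 3 ^+ (d + m)).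
Proof.
move=> lF jn; pose q := (j %/ 3 ^ d)%N; pose r := (j %% 3 ^ d)%N.
have p3 : (0 < 3 ^ d)%N by rewrite expn_gt0.
have r3 : (r < 3 ^ d)%N by rewrite ltn_mod.
have jE : j = (q * 3 ^ d + r)%N by rewrite /q /r -divn_eq.
have [|m [i [im E]]] := lF q; first by rewrite ltn_divLR// -mulnA -expnD addnC.
exists m, (i * 3 ^ d + r)%N; split; first by rewrite expnD; nia.
have r1 : r%:R + 1 <= 3 ^+ d :> R by rewrite natr1 -natrX ler_nat.
move=> t t01; rewrite jE !tri_addE E//; have p0 : 0 < 3 ^+ d :> R := pow3_gt0 d.
have r0 : 0 <= r%:R :> R by [].
by rewrite divr_ge0 ?(ltW p0)//= ?ler_pdivrMr// ?mul1r; lra.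
Qed.

(** After refinement by [n] levels the image intervals of [F'] have level at least [n], and [F] is
    linear on them. *)
Lemma lin_comp n n' F F' : (forall t, F (t + 2) = F t + 2) -> lin_on n F -> lin_on n' F' ->
  lin_on (n + n') (F \o F').
Proof.
move=> F2 lF lF' j jn; have [m [i [im E]]] := lin_refine lF' jn.
have imn : (i < 2 * 3 ^ (m + n))%N by rewrite addnC.
have [m' [i' [im' E']]] := lin_refine lF imn.
exists (m + m')%N, i'; split=> // t t01 /=.
by rewrite (lift_circle F2 (E t t01)) [(n + m)%N]addnC E'.
Qed.

Lemma tri_mapM f f' : tri_map f -> tri_map f' -> tri_map (f * f')%g.
Proof.
move=> [F [G [[FK GK mF F2 [bF bG [n lF]]] fE]]] [F' [G' [[FK' GK' mF' F2' [bF' bG' [n' lF']]] fE']]].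
exists (F \o F'), (G' \o G); split; last by move=> t /=; rewrite fE' fE.
split=> [||s t|t|]; [exact: can_comp|exact: can_comp|by rewrite /= mF mF'|by rewrite /= F2' F2|].
split=> [s t /bF'/bF//|s t /bG/bG'//|]; exists (n + n')%N; exact: lin_comp.
Qed.

Lemma leaf_ends_pt l (x : circle R) : leaf_ends l x <-> to_basilica x = pt l.
Proof.
rewrite -{2}(crdK x) -/(bq (crd x)) bq_ptP ?crd_itv// leaf_endsE -{1 2}(crdK x).
have [l1 l2] := leaf_end_itv l; have cx := crd_itv x.
by split=> [[/to_circle_inj->|/to_circle_inj->]|[->|->]]//; [left|right|left|right].
Qed.

Lemma tri_level_itv n j t : (tri n j < t < tri n j.+1) <->
  exists2 e : R, 0 < e < 1 & t = tri n j + e / 3 ^+ n.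
Proof.
have p : 0 < 3 ^+ n :> R := pow3_gt0 n.
rewrite tri_len; split=> [/andP[h1 h2]|[e /andP[e0 e1] ->]]; last first.
  by rewrite ltrDl divr_gt0//= ltrD2l ltr_pdivrMr// mulVf ?lt0r_neq0.
exists ((t - tri n j) * 3 ^+ n); last by rewrite mulfK ?lt0r_neq0// addrC subrK.
by rewrite mulr_gt0 ?subr_gt0//= -ltr_pdivlMr// div1r; lra.
Qed.

(** The source diagram has all the intervals of level [n], the target diagram their images, which
    tile because the map is a bijection; by [perfect_leafs] the leafs of the two diagrams
    correspond. *)
Lemma tri_map_thompson f : tri_map f -> basilica_thompson f.
Proof.
move=> [F [G [FG fE]]]; have [FK GK mF F2 [bF bG [n lF]]] := FG.
have [mG G2] := liftV FK GK mF F2.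
pose h x := to_circle (F (crd x)) : circle R.
pose h' x := to_circle (G (crd x)) : circle R.
have hE t : h (to_circle t) = to_circle (F t) by apply: lift_circle => //; rewrite crdK.
have hE' t : h' (to_circle t) = to_circle (G t) by apply: lift_circle => //; rewrite crdK.
have hK : cancel h h' by move=> x; rewrite -(crdK x) hE hE' FK.
have hK' : cancel h' h by move=> x; rewrite -(crdK x) hE' hE GK.
have fh x : f (to_basilica x) = to_basilica (h x).
  by rewrite -(crdK x) hE; exact: fE.
exists h => //.
have /choice[mi miP] : forall j, exists mi : nat * nat, (j < 2 * 3 ^ n)%N ->
    (mi.2 < 2 * 3 ^ mi.1)%N /\ forall t, 0 <= t <= 1 ->
    to_circle (F (tri n j + t / 3 ^+ n)) = to_circle (tri mi.1 mi.2 + t / 3 ^+ mi.1).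
  move=> j; have [jn|jn] := ltnP j (2 * 3 ^ n); last by exists (0%N, 0%N).
  by have [m [i mi]] := lF j jn; exists (m, i).
pose T := [set (tri_itv (mi j).1 (mi j).2 : R * R) | j in [set j | (j < 2 * 3 ^ n)%N]].
have tT : tiling (\max_(j < 2 * 3 ^ n) (mi j).1) T.
  split=> [K [j jn <-]|t t02|t K K' [j jn <-] [j' jn' <-] /= tK tK'].
  - have [im _] := miP _ jn; exists (mi j).1; last by exists (mi j).2.
    exact: (leq_bigmax (Ordinal jn)).
  - pose s := crd (to_circle (G t)) : R; have s02 : 0 < s <= 2 := crd_itv _.
    have [j jn /andP[s1 s2]] := tri_cover n s02; have [im E] := miP _ jn.
    pose e := (s - tri n j) * 3 ^+ n.
    have p3 k : 0 < 3 ^+ k :> R := pow3_gt0 k.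
    have e01 : 0 < e <= 1.
      by rewrite mulr_gt0 ?subr_gt0//= -ler_pdivlMr// div1r; rewrite tri_len in s2; lra.
    have : to_circle t = to_circle (F s).
      by rewrite -(lift_circle F2 (esym (crdK (to_circle (G t))))) GK.
    have -> : s = tri n j + e / 3 ^+ n by rewrite mulfK ?lt0r_neq0// addrC subrK.
    rewrite E; last by lra.
    move=> tE; exists (tri_itv (mi j).1 (mi j).2); first by exists j.
    have w : 0 < e / 3 ^+ (mi j).1 <= (3 ^+ (mi j).1)^-1.
      by rewrite divr_gt0 ?(proj1 (andP e01))//= ler_pdivrMr// mulVf ?lt0r_neq0// (proj2 (andP e01)).
    have := tri_ge0 (R := R) (mi j).1 (mi j).2.
    have : tri (mi j).1 (mi j).2.+1 <= 2 :> R by rewrite tri_le2.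
    rewrite /= tri_len => w1 w2.
    have w02 : 0 < tri (mi j).1 (mi j).2 + e / 3 ^+ (mi j).1 <= 2 by clear -w w1 w2; lra.
    by rewrite (to_circle_inj t02 w02 tE); clear -w; lra.
  - have S k : (k < 2 * 3 ^ n)%N -> tri (mi k).1 (mi k).2 < t <= tri (mi k).1 (mi k).2.+1 ->
       exists2 s, tri n k < s <= tri n k.+1 & to_circle (F s) = to_circle t.
      move=> kn /andP[t1 t2]; have [im E] := miP _ kn.
      pose e := (t - tri (mi k).1 (mi k).2) * 3 ^+ (mi k).1.
      have p3 k' : 0 < 3 ^+ k' :> R := pow3_gt0 k'.
      have e01 : 0 < e <= 1.
        by rewrite mulr_gt0 ?subr_gt0//= -ler_pdivlMr// div1r; rewrite tri_len in t2; lra.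
      exists (tri n k + e / 3 ^+ n).
        by rewrite tri_len ltrDl divr_gt0 ?(proj1 (andP e01))//= lerD2l ler_pdivrMr// mulVf ?lt0r_neq0 ?(proj2 (andP e01)).
      by rewrite E; [rewrite mulfK ?lt0r_neq0// addrC subrK|lra].
    have [[s sk Es] [s' sk' Es']] := (S _ jn tK, S _ jn' tK').
    have B k v : (k < 2 * 3 ^ n)%N -> tri n k < v <= tri n k.+1 -> 0 < v <= 2.
      by move=> kn; have := tri_ge0 (R := R) n k; have := tri_le2 (R := R) n k.+1; rewrite kn; lra.
    have ss : s = s'.
      apply: to_circle_inj; [exact: B jn sk|exact: B jn' sk'|].
      by apply: (can_inj hK); rewrite !hE Es.
    suff -> : j = j' by [].
    have : tri_itv n j = tri_itv n j' :> R * R.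
      have [_ _ TU] := @level_tiling R n; apply: (TU s); [by exists j|by exists j'|exact: sk|by rewrite ss].
    by move=> [/eqP + _]; rewrite eq_tri eqn_pmul2r ?expn_gt0// => /eqP.
have [D1 P1] := tiling_perfect (@level_tiling R n).
have [D2 P2] := tiling_perfect tT.
exists D1, [set K | is_tri n K], D2, T, h; split=> //; last first.
  move=> u v [j jn [-> ->]]; have [im E] := miP _ jn.
  exists (tri (mi j).1 (mi j).2), (tri (mi j).1 (mi j).2.+1).
  have E' t : 0 <= t <= 1 -> h (to_circle (tri n j + t * (tri n j.+1 - tri n j))) =
      to_circle (tri (mi j).1 (mi j).2 + t * (tri (mi j).1 (mi j).2.+1 - tri (mi j).1 (mi j).2)).
    by move=> t01; rewrite hE !tri_len ![_ + (_)^-1]addrC !addrK E.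
  split=> //; first by exists j.
    by have := E' 0; rewrite !mul0r !addr0 => ->//; rewrite lexx ler01.
  by have := E' 1; rewrite !mul1r ![tri _ _ + (_ - _)]addrC !subrK => ->//; rewrite lexx ler01.
split.
- apply/continuousP => A oA; suff : open (to_circle @^-1` (h @^-1` A)) by [].
  have -> : to_circle @^-1` (h @^-1` A) = (to_circle \o F) @^-1` A by apply/funext => t; rewrite /preimage /= hE.
  move: A oA; apply/continuousP => t.
  by apply: continuous_comp; [exact: mono_continuous FK GK mF t|exact: pi_continuous].
- by exists h'.
- move=> x y z [a [b [c [-> -> -> [ab bc ca]]]]]; exists (F a), (F b), (F c); rewrite !hE.
  by split=> //; rewrite -F2 !(leW_mono mF).
pose phi l := aut_e (Pi f) l : @leaf R.
have phiE l : h @` leaf_ends l = leaf_ends (phi l).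
  apply/seteqP; split=> [_ [x /leaf_ends_pt xl <-]|y /leaf_ends_pt yl].
    by apply/leaf_ends_pt; rewrite -fh xl homeo_leafE.
  exists (h' y); last exact: hK'.
  by apply/leaf_ends_pt/(@homeo_inj _ f); rewrite fh hK' yl homeo_leafE.
have ins l : (forall K, is_tri n K -> ~ inside l K) <-> (forall K, T K -> ~ inside (phi l) K).
  split=> [no _ [j jn <-] /inside_tri/tri_level_itv[e e01 le]|no _ [j jn ->] /inside_tri/tri_level_itv[e e01 le]];
    have [im E] := miP _ jn; have e01' : 0 <= e <= 1 by lra.
    pose s := tri n j + e / 3 ^+ n.
    have sj : tri n j < s < tri n j.+1 by apply/tri_level_itv; exists e.
    have s02 : 0 < s <= 2.
      by have := tri_ge0 (R := R) n j; have := tri_le2 (R := R) n j.+1; rewrite jn; lra.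
    apply: (no (tri_itv n j)); first by exists j.
    apply/inside_tri; suff /(bq_ptP _ s02)[<-//|sl] : bq s = pt l by rewrite leaf_in_tri -sl.
    apply: (@homeo_inj _ f); rewrite fE homeo_leafE /bq E// -le; exact: bq_end (or_introl (erefl _)).
  pose w := tri (mi j).1 (mi j).2 + e / 3 ^+ (mi j).1.
  have wj : tri (mi j).1 (mi j).2 < w < tri (mi j).1 (mi j).2.+1 by apply/tri_level_itv; exists e.
  have w02 : 0 < w <= 2.
    by have := tri_ge0 (R := R) (mi j).1 (mi j).2; have := tri_le2 (R := R) (mi j).1 (mi j).2.+1; rewrite im; lra.
  apply: (no (tri_itv (mi j).1 (mi j).2)); first by exists j.
  apply/inside_tri; suff /(bq_ptP _ w02)[<-//|wl] : bq w = pt (phi l) by rewrite leaf_in_tri -wl.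
  by rewrite -homeo_leafE /pt fE le /bq E.
apply/seteqP; split=> [_ [A /(perfect_leafs P1)[l -> lI] <-]|A /(perfect_leafs P2)[l' -> lI]].
  by rewrite phiE; apply/(perfect_leafs P2); exists (phi l) => //; apply/ins.
exists (leaf_ends (aut_eV (Pi f) l')); last by rewrite phiE /phi (@aut_eVK _ (Pi f)).
apply/(perfect_leafs P1); exists (aut_eV (Pi f) l') => //; apply/ins.
by rewrite /phi (@aut_eVK _ (Pi f)).
Qed.

End Lifts.

(** * Compatibility with the leafs, rotation, periodic extension *)

Section Generators.
Context {R : realType}.
Implicit Types (s t u v a b : R) (l : @leaf R) (F G : R -> R) (f g : R -> R)
  (n m d k i j N e : nat).

Lemma bqD2 t : bq (t + 2) = bq t.
Proof. by have := to_circleD2 t 1; rewrite mulr1z mulr1 /bq => ->. Qed.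

Lemma bq_step n k : bq (tri n (3 * k + 1)) = bq (tri n (3 * k + 2)) :> basilica R.
Proof. by apply/to_basilicaE/asboolP/rst_step; exists k, n. Qed.

(** A leaf of level above [n] has both ends in one linear piece, with numerators congruent to 1 and
    2 modulo 3, and so have their images. Compatibility thus needs checking only at the finitely
    many leafs of level at most [n]. *)
Lemma lin_bq n l F : lin_on n F -> (n < lv l)%N -> bq (F (la l)) = bq (F (lb l)).
Proof.
move=> lF nl; have [d dE] : exists d, lv l = (d.+1 + n)%N by exists (lv l - n).-1; lia.
pose j := (lk l %/ 3 ^ d)%N; pose r := (lk l %% 3 ^ d)%N.
have r3 : (r < 3 ^ d)%N by rewrite ltn_mod expn_gt0.
have kE : lk l = (j * 3 ^ d + r)%N by rewrite /j /r -divn_eq.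
have [|m [i [im E]]] := lF j.
  have := leaf_code l; rewrite /is_code kE dE addSn expnS addnC expnD => c.
  have : (3 * (j * 3 ^ d) < 2 * (3 * (3 ^ n * 3 ^ d)))%N by lia.
  have : (0 < 3 ^ d)%N by rewrite expn_gt0.
  by nia.
have S c : (c <= 2)%N -> to_circle (F (tri (lv l) (3 * lk l + c))) =
    to_circle (tri (d.+1 + m) (3 * (i * 3 ^ d + r) + c)) :> circle R.
  move=> c2; have p0 : 0 < 3 ^+ d.+1 :> R := pow3_gt0 _.
  have -> : (3 * lk l + c = j * 3 ^ d.+1 + (3 * r + c))%N by rewrite kE expnS; lia.
  have -> : (3 * (i * 3 ^ d + r) + c = i * 3 ^ d.+1 + (3 * r + c))%N by rewrite expnS; lia.
  have := tri_addE (R := R) d.+1 n j (3 * r + c) 0; have := tri_addE (R := R) d.+1 m i (3 * r + c) 0.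
  rewrite dE !mul0r !addr0 => -> ->; apply: E; rewrite divr_ge0 ?ler0n ?(ltW p0)//=.
  by rewrite ler_pdivrMr// mul1r -natrX ler_nat expnS; lia.
by rewrite /la /lb /bq !S//; exact: bq_step.
Qed.

Lemma lin_compat N F : (forall t, F (t + 2) = F t + 2) -> lin_on N F ->
  (forall l, (lv l <= N)%N -> bq (F (la l)) = bq (F (lb l))) ->
  forall s t, bq s = bq t -> bq (F s) = bq (F t).
Proof.
move=> F2 lF low s t st.
have C u : bq (crd (to_circle u)) = bq u by rewrite /bq crdK.
have CF u : bq (F (crd (to_circle u))) = bq (F u).
  by congr to_basilica; apply: lift_circle => //; rewrite crdK.
have leafF l : bq (F (la l)) = bq (F (lb l)).
  by have [lN|Nl] := leqP (lv l) N; [exact: low|exact: lin_bq lF Nl].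
rewrite -CF -[in RHS]CF; move: st; rewrite -C -[RHS]C => /bqE[||->//|[l]]; try exact: crd_itv.
by move=> [[->|->] [->|->]].
Qed.

Lemma tri_map1 : tri_map (1%g : homeo (basilica R)).
Proof.
exists id, id; split=> //; split=> //; split=> //; exists 0%N => j jn.
by exists 0%N, j.
Qed.

Lemma lift_map F G N : cancel F G -> cancel G F -> {mono F : s t / s <= t} ->
  (forall t, F (t + 2) = F t + 2) -> lin_on N F ->
  (forall l, (lv l <= N)%N -> bq (F (la l)) = bq (F (lb l))) ->
  (forall s t, bq s = bq t -> bq (G s) = bq (G t)) ->
  exists2 h : homeo (basilica R), tri_map h & forall t, h (bq t) = bq (F t).
Proof.
move=> FK GK mF F2 lF low bG.
have L : pl_lift F G by split=> //; split=> //; [exact: lin_compat lF low|exists N].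
by have [h hE] := lift_homeo L; exists h => //; exists F, G.
Qed.

Lemma tri0 k : tri 0 k = k%:R :> R.
Proof. by rewrite /tri expr0 divr1. Qed.

Lemma root_ends l : lv l = 0%N -> la l = 1 /\ lb l = 2.
Proof.
move=> l0; have := leaf_code l; rewrite /la /lb l0 /is_code !tri0 => c.
by have -> : lk l = 0%N by lia.
Qed.

Lemma rotation_map : exists2 h : homeo (basilica R), tri_map h & forall t, h (bq t) = bq (t + 1).
Proof.
have F2 t : t + 2 + 1 = t + 1 + 2 by rewrite addrAC.
have lF : lin_on 0 (fun t => t + 1).
  move=> j; rewrite expn0 muln1 => j2; exists 0%N; rewrite !tri0 !expr0.
  case: j j2 => [|[|//]] _; [exists 1%N|exists 0%N]; split=> // t _; rewrite !tri0 !divr1.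
    by rewrite add0r addrC.
  have := to_circleD2 t 1; rewrite mulr1z mulr1 add0r => <-; congr to_circle; lra.
have low l : (lv l <= 0)%N -> bq (la l + 1) = bq (lb l + 1).
  rewrite leqn0 => /eqP/root_ends[-> ->]; rewrite [2 + 1]addrC bqD2.
  by have := bq_step 0 0; rewrite !tri0.
apply: (@lift_map _ (fun t => t - 1) 0) => //.
- by move=> t; rewrite addrK.
- by move=> t; rewrite subrK.
- by move=> s t; rewrite lerD2r.
(* The inverse [t - 1] differs from [t + 1] by a full turn, so its compatibility is that of the
   rotation. *)
- move=> s t st; have := lin_compat F2 lF low st.
  have e u : u + 1 = u - 1 + 2 by clear st; lra.
  by rewrite !e !bqD2.
Qed.

(** The start of the period [[2z, 2z + 2)] containing [t]. Coordinates are in (0,2] instead, so the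
    point 2 is a case apart in [periodizeE]. *)
Definition fl t : R := (Num.floor (t / 2))%:~R * 2.

Lemma fl_itv t : 0 <= t - fl t < 2.
Proof.
have := floor_itv (t / 2); rewrite ler_pdivlMr// => /andP[h1].
by rewrite ltr_pdivrMr// intrD mulr1z mulrDl mul1r => h2; rewrite /fl; lra.
Qed.

Lemma fl_unique t (z : int) : 0 <= t - z%:~R * 2 < 2 -> fl t = z%:~R * 2.
Proof.
move=> h; suff /eqP E : Num.floor (t / 2) == z by rewrite /fl E.
by rewrite floor_eq ler_pdivlMr// ltr_pdivrMr// intrD mulr1z mulrDl mul1r; lra.
Qed.

Definition periodize f t : R := f (t - fl t) + fl t.

Definition end_fixing f g := [/\ cancel f g, cancel g f, {mono f : s t / s <= t}, f 0 = 0 & f 2 = 2].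

Lemma end_fixingV f g : end_fixing f g -> end_fixing g f.
Proof.
move=> [fK gK mf f0 f2]; split=> //; first by move=> s t; rewrite -mf !gK.
  by rewrite -{1}f0 fK.
by rewrite -{1}f2 fK.
Qed.

Lemma end_fixing_itv f g t : end_fixing f g -> 0 <= t < 2 -> 0 <= f t < 2.
Proof. by move=> [fK gK mf f0 f2]; rewrite -{2}f0 -{2}f2 mf (leW_mono mf). Qed.

Lemma fl_periodize f g t : end_fixing f g -> fl (periodize f t) = fl t.
Proof.
move=> fg; have h := end_fixing_itv fg (fl_itv t).
by rewrite [RHS]/fl; apply: fl_unique; rewrite -/(fl t) /periodize addrK.
Qed.

Lemma periodizeK f g : end_fixing f g -> cancel (periodize f) (periodize g).
Proof.
move=> fg t; rewrite {1}/periodize (fl_periodize _ fg) /periodize addrK.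
by case: fg => fK _ _ _ _; rewrite fK subrK.
Qed.

Lemma fl_le s t : s <= t -> fl s = fl t \/ fl s + 2 <= fl t.
Proof.
move=> st; have : Num.floor (s / 2) <= Num.floor (t / 2) by rewrite le_floor// ler_pM2r ?invr_gt0.
rewrite le_eqVlt => /orP[/eqP e|]; first by left; rewrite /fl e.
rewrite -lezD1 -(ler_int R) intrD mulr1z /fl => h; right; lra.
Qed.

Lemma periodize_mono f g : end_fixing f g -> {mono periodize f : s t / s <= t}.
Proof.
move=> fg; apply: le_mono => s t st; have [E|E] := fl_le (ltW st).
  by case: fg => _ _ mf _ _; rewrite /periodize E ltrD2r (leW_mono mf) ltrD2r.
have := end_fixing_itv fg (fl_itv s); have := end_fixing_itv fg (fl_itv t); rewrite /periodize; lra.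
Qed.

Lemma periodizeD2 f t : periodize f (t + 2) = periodize f t + 2.
Proof.
have -> : periodize f (t + 2) = f (t + 2 - fl (t + 2)) + fl (t + 2) by [].
have -> : fl (t + 2) = fl t + 2.
  rewrite (@fl_unique (t + 2) (Num.floor (t / 2) + 1)) ?intrD ?mulrDl ?mul1r//.
  by have := fl_itv t; rewrite /fl; lra.
by rewrite /periodize addrA; congr (f _ + _ + _); lra.
Qed.

Lemma periodizeE f g t : end_fixing f g -> 0 <= t <= 2 -> periodize f t = f t.
Proof.
move=> [_ _ _ f0 f2] /andP[t0]; rewrite le_eqVlt => /orP[/eqP->|t2].
  by have := periodizeD2 f 0; rewrite add0r => ->; rewrite /periodize (@fl_unique 0 0) ?mul0r ?subrr ?subr0 ?f0 ?f2 ?addr0 ?add0r //; lra.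
by rewrite /periodize (@fl_unique t 0) ?mul0r ?subr0 ?addr0//; lra.
Qed.

End Generators.

(** * Generators supported in a triadic interval, and the exchange of two leafs *)

Section LocalMaps.
Context {R : realType}.
Implicit Types (s t u v a b : R) (l : @leaf R) (F G : R -> R) (f g : R -> R)
  (n m d k i j N e : nat).

(** Ninths suffice for the breakpoints of [x0] and its inverse. The last clause is the check at the
    leafs of level 1 and 2 in [[0, 1]], to which linearity on the ninths does not apply. *)
Definition unit_pl f :=
  [/\ forall t, t <= 0 \/ 1 <= t -> f t = t,
      forall i, (i < 9)%N -> exists m k, (k < 3 ^ m)%N /\
        forall t, 0 <= t <= 1 -> f ((i%:R + t) / 9) = tri m k + t / 3 ^+ m &
      forall e i, (e < 2)%N -> (i < 3 ^ e)%N -> exists m k,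
        f (tri e.+1 (3 * i + 1)) = tri m.+1 (3 * k + 1) /\
        f (tri e.+1 (3 * i + 2)) = tri m.+1 (3 * k + 2)].

(** The conjugate of [f] by the affine map of [[0, 1]] onto [tri_itv n j]. *)
Definition scale n j f t := tri n j + f ((t - tri n j) * 3 ^+ n) / 3 ^+ n.

Lemma scale_tri n j f d i : scale n j f (tri (d + n) (j * 3 ^ d + i)) =
  tri n j + f (tri d i) / 3 ^+ n.
Proof.
have p k : 3 ^+ k != 0 :> R by exact/lt0r_neq0/pow3_gt0.
rewrite /scale; congr (_ + f _ / _); have := tri_addE (R := R) d n j i 0.
by rewrite !mul0r !addr0 => ->; rewrite addrC addKr mulfVK.
Qed.

Lemma scale_out n j f t : (forall t, t <= 0 \/ 1 <= t -> f t = t) ->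
  ~ (tri n j < t < tri n j.+1) -> scale n j f t = t.
Proof.
have p : 0 < 3 ^+ n :> R := pow3_gt0 n.
move=> fout /negP; rewrite negb_and -!leNgt => h; rewrite /scale fout.
  by rewrite mulfK ?lt0r_neq0// addrC subrK.
case/orP: h => h; [left|right]; first by rewrite pmulr_lle0// subr_le0.
by rewrite -ler_pdivrMr// div1r lerBrDl -tri_len.
Qed.

Lemma scale_end_fixing n j f g : (j < 2 * 3 ^ n)%N -> cancel f g -> cancel g f ->
  {mono f : s t / s <= t} -> unit_pl f -> end_fixing (scale n j f) (scale n j g).
Proof.
move=> jn fK gK mf [fout _ _]; have p : 0 < 3 ^+ n :> R := pow3_gt0 n.
have K f' g' : cancel f' g' -> cancel (scale n j f') (scale n j g').
  by move=> K t; rewrite /scale [_ + f' _ / _]addrC addrK mulfVK ?lt0r_neq0// K mulfK ?lt0r_neq0// addrC subrK.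
split; [exact: K|exact: K|move=> s t| |].
- by rewrite /scale lerD2l ler_pM2r ?invr_gt0// mf ler_pM2r// lerD2r.
- by apply: scale_out => //; have := tri_ge0 (R := R) n j; lra.
- by apply: scale_out => //; have := tri_le2 (R := R) n j.+1; rewrite jn; lra.
Qed.

Lemma scale_lin n j f g : (j < 2 * 3 ^ n)%N -> end_fixing (scale n j f) (scale n j g) ->
  unit_pl f -> lin_on (2 + n) (periodize (scale n j f)).
Proof.
move=> jn ef [fout fpl _] i iN; have p k : 0 < 3 ^+ k :> R := pow3_gt0 k.
have itv2 t : 0 <= t <= 1 -> tri (2 + n) i <= tri (2 + n) i + t / 3 ^+ (2 + n) <= (tri (2 + n) i.+1 : R).
  by move=> t01; rewrite tri_len lerDl lerD2l divr_ge0 ?(ltW (p _))//= ?ler_pdivrMr// ?mulVf ?lt0r_neq0//; lra.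
have b2 : tri (2 + n) i.+1 <= 2 :> R by rewrite tri_le2.
have b0 := tri_ge0 (R := R) (2 + n) i.
have E t : 0 <= t <= 1 -> periodize (scale n j f) (tri (2 + n) i + t / 3 ^+ (2 + n)) =
    scale n j f (tri (2 + n) i + t / 3 ^+ (2 + n)).
  by move=> /itv2 h; apply: periodizeE ef _; lra.
have [ij|ij] := eqVneq (i %/ 9)%N j; last first.
  exists (2 + n)%N, i; split=> // t t01; rewrite E// scale_out// => h; have := itv2 t t01.
  have jE k : tri n k = tri (2 + n) (9 * k) :> R by rewrite (tri_lift 2%N n k) mulnC.
  rewrite !jE in h; move=> h'.
  have : tri (2 + n) (9 * j) < tri (2 + n) i.+1 :> R by lra.
  have : tri (2 + n) i < tri (2 + n) (9 * j.+1) :> R by lra.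
  by rewrite !lt_triE; move: ij; lia.
have [|m [k [km fE]]] := fpl (i %% 9)%N; first by rewrite ltn_mod.
have iE : i = (j * 3 ^ 2 + i %% 9)%N by rewrite -ij -divn_eq.
exists (m + n)%N, (j * 3 ^ m + k)%N; split; first by rewrite expnD; nia.
move=> t t01; rewrite E// tri_addE /scale [in LHS]iE tri_addE [_ + _ / _ / _]addrC addrK mulfVK ?lt0r_neq0//.
have -> : 3 ^+ 2 = 9 :> R by rewrite -natrX.
by rewrite fE// [(k%:R + t) / _]mulrDl.
Qed.

(** Such a leaf either is outside the interval, where the map is the identity, or is a rescaled leaf
    of level 1 or 2 in [[0, 1]]. *)
Lemma scale_low n j f g l : (j < 2 * 3 ^ n)%N -> end_fixing (scale n j f) (scale n j g) ->
  unit_pl f -> (lv l <= 2 + n)%N ->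
  bq (periodize (scale n j f) (la l)) = bq (periodize (scale n j f) (lb l)).
Proof.
move=> jn ef [fout _ fpair] ln; have [a0 ab b2] := leaf_ltW l.
rewrite !(periodizeE ef) ?(ltW a0) ?(ltW (lt_trans a0 ab)) ?(ltW (lt_le_trans ab b2)) ?b2//.
have [lj|lj] := boolP (tri n j < la l < tri n j.+1); last first.
  have lj' := lj; rewrite leaf_in_tri in lj'.
  rewrite !scale_out//; [|exact/negP|exact/negP].
  by symmetry; apply: bq_end; right.
have nl : (n < lv l)%N.
  move: lj; rewrite ltnNge; apply: contraTN => ln'; rewrite /la.
  have -> : n = (n - lv l + lv l)%N by rewrite subnK.
  by rewrite (tri_lift (n - lv l) (lv l)) !lt_triE; lia.
have [e eE] : exists e, lv l = (e.+1 + n)%N by exists (lv l - n).-1; lia.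
have e2 : (e < 2)%N by lia.
move: lj; rewrite /la eE [tri n j](tri_lift e.+1) [tri n j.+1](tri_lift e.+1) !lt_triE !expnS => lj.
pose i := (lk l - j * 3 ^ e)%N.
have iE : lk l = (j * 3 ^ e + i)%N by rewrite /i subnKC//; lia.
have i3 : (i < 3 ^ e)%N by move: lj; rewrite iE mulSn; lia.
have lE c : (3 * lk l + c = j * 3 ^ e.+1 + (3 * i + c))%N by rewrite iE expnS; lia.
have [m [k [f1 f2]]] := fpair e i e2 i3.
rewrite /lb eE !lE !scale_tri f1 f2.
have S c : tri n j + tri m.+1 (3 * k + c) / 3 ^+ n = tri (m.+1 + n) (3 * (j * 3 ^ m + k) + c) :> R.
  have -> : (3 * (j * 3 ^ m + k) + c = j * 3 ^ m.+1 + (3 * k + c))%N by rewrite expnS; lia.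
  by have := tri_addE (R := R) m.+1 n j (3 * k + c) 0; rewrite !mul0r !addr0 => ->.
by rewrite !S; exact: bq_step.
Qed.

Lemma local_map n j f g : (j < 2 * 3 ^ n)%N -> cancel f g -> cancel g f ->
  {mono f : s t / s <= t} -> unit_pl f -> unit_pl g ->
  exists2 h : homeo (basilica R), tri_map h &
    forall t, 0 <= t <= 2 -> h (bq t) = bq (scale n j f t).
Proof.
move=> jn fK gK mf uf ug; have ef := scale_end_fixing jn fK gK mf uf.
have eg := end_fixingV ef.
have [||h hT hE] := lift_map (periodizeK ef) (periodizeK eg) (periodize_mono ef)
    (periodizeD2 _) (scale_lin jn ef uf).
- by move=> l ll; exact: scale_low ef uf ll.
- apply: lin_compat (periodizeD2 _) (scale_lin jn eg ug) _ => l ll.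
  exact: scale_low eg ug ll.
by exists h => // t t02; rewrite hE (periodizeE ef).
Qed.

Ltac piecewise := repeat (case: leP => ?); lra.

(* A base 3 analogue of the generator x_0 of Thompson's group F: it maps
   the middle third of [0,1/3] to that of [0,1], and the latter to that of [2/3,1]. *)
Definition x0 t : R :=
  if t <= 0 then t else if t <= 2 / 9 then 3 * t else if t <= 1 / 3 then t + 4 / 9
  else if t <= 1 then t / 3 + 2 / 3 else t.
Definition x0V t : R :=
  if t <= 0 then t else if t <= 2 / 3 then t / 3 else if t <= 7 / 9 then t - 4 / 9
  else if t <= 1 then 3 * t - 2 else t.

Lemma x0_pieces : [/\ forall t, t <= 0 \/ 1 <= t -> x0 t = t, forall t, 0 <= t <= 2 / 9 -> x0 t = 3 * t,
  forall t, 2 / 9 <= t <= 1 / 3 -> x0 t = t + 4 / 9 & forall t, 1 / 3 <= t <= 1 -> x0 t = t / 3 + 2 / 3].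
Proof. by rewrite /x0; split=> t h; [case: h => h|..]; piecewise. Qed.

Lemma x0V_pieces : [/\ forall t, t <= 0 \/ 1 <= t -> x0V t = t, forall t, 0 <= t <= 2 / 3 -> x0V t = t / 3,
  forall t, 2 / 3 <= t <= 7 / 9 -> x0V t = t - 4 / 9 & forall t, 7 / 9 <= t <= 1 -> x0V t = 3 * t - 2].
Proof. by rewrite /x0V; split=> t h; [case: h => h|..]; piecewise. Qed.

Lemma x0K : cancel x0 x0V.
Proof.
have [h0 h1 h2 h3] := x0_pieces; have [g0 g1 g2 g3] := x0V_pieces => t.
have [t0|t0] := leP t 0; first by rewrite h0 ?g0//; left.
have [t1|t1] := leP 1 t; first by rewrite h0 ?g0//; right.
have [t2|t2] := leP t (2 / 9); first by rewrite h1 ?g1; lra.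
have [t3|t3] := leP t (1 / 3); first by rewrite h2 ?g2; lra.
by rewrite h3 ?g3; lra.
Qed.

Lemma x0VK : cancel x0V x0.
Proof.
have [h0 h1 h2 h3] := x0_pieces; have [g0 g1 g2 g3] := x0V_pieces => t.
have [t0|t0] := leP t 0; first by rewrite g0 ?h0//; left.
have [t1|t1] := leP 1 t; first by rewrite g0 ?h0//; right.
have [t2|t2] := leP t (2 / 3); first by rewrite g1 ?h1; lra.
have [t3|t3] := leP t (7 / 9); first by rewrite g2 ?h2; lra.
by rewrite g3 ?h3; lra.
Qed.

Lemma x0_mono : {mono x0 : s t / s <= t}.
Proof.
apply: le_mono => s t st; rewrite /x0; case: (leP s 0) => s1; case: (leP t 0) => t1; try lra;
case: (leP s (2 / 9)) => s2; try (exfalso; lra); case: (leP t (2 / 9)) => t2; try lra;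
case: (leP s (1 / 3)) => s3; try (exfalso; lra); case: (leP t (1 / 3)) => t3; try lra;
case: (leP s 1) => s4; try (exfalso; lra); case: (leP t 1) => t4; lra.
Qed.

Lemma x0V_mono : {mono x0V : s t / s <= t}.
Proof. by move=> s t; rewrite -x0_mono !x0VK. Qed.

Lemma unit_pl_x0 : unit_pl x0.
Proof.
have [h0 h1 h2 h3] := x0_pieces; split=> // [i i9|e i e2 ie].
  have [i2|i2] := ltnP i 2.
    exists 1%N, i; split; first by lia.
    have : i%:R + 1 <= 2 :> R by rewrite natr1 ler_nat.
    have : 0 <= i%:R :> R by [].
    by move=> *; rewrite h1 /tri; lra.
  have [i3|i3] := ltnP i 3.
    have -> : i = 2%N by lia.
    by exists 2%N, 6%N; split=> // t t01; rewrite h2 /tri; lra.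
  exists 3%N, (18 + i)%N; split; first by lia.
  have : i%:R + 1 <= 9 :> R by rewrite natr1 ler_nat.
  have : 3 <= i%:R :> R by rewrite ler_nat.
  by move=> *; rewrite h3 /tri ?natrD; lra.
case: e e2 ie => [|[|//]] _; rewrite /tri.
  by case: i => // _; exists 1%N, 2%N; split; rewrite !natrD !natrM h3; lra.
case: i => [|[|[|//]]] _.
- by exists 0%N, 0%N; split; rewrite !natrD !natrM h1; lra.
- by exists 2%N, 7%N; split; rewrite !natrD !natrM h3; lra.
- by exists 2%N, 8%N; split; rewrite !natrD !natrM h3; lra.
Qed.

Lemma unit_pl_x0V : unit_pl x0V.
Proof.
have [h0 h1 h2 h3] := x0V_pieces; split=> // [i i9|e i e2 ie].
  have [i6|i6] := ltnP i 6.
    exists 3%N, i; split; first by lia.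
    have : i%:R + 1 <= 6 :> R by rewrite natr1 ler_nat.
    have : 0 <= i%:R :> R by [].
    by move=> *; rewrite h1 /tri; lra.
  have [i7|i7] := ltnP i 7.
    have -> : i = 6%N by lia.
    by exists 2%N, 2%N; split=> // t t01; rewrite h2 /tri; lra.
  exists 1%N, (i - 6)%N; split; first by lia.
  have : i%:R + 1 <= 9 :> R by rewrite natr1 ler_nat.
  have : 7 <= i%:R :> R by rewrite ler_nat.
  by move=> *; rewrite h3 /tri ?(natrB _ (ltnW i7)); lra.
case: e e2 ie => [|[|//]] _; rewrite /tri.
  by case: i => // _; exists 1%N, 0%N; split; rewrite !natrD !natrM h1; lra.
case: i => [|[|[|//]]] _.
- by exists 2%N, 0%N; split; rewrite !natrD !natrM h1; lra.
- by exists 2%N, 1%N; split; rewrite !natrD !natrM h1; lra.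
- by exists 0%N, 0%N; split; rewrite !natrD !natrM h3; lra.
Qed.

(* The lift [swap t + 2 / 3] exchanges the leafs (1,2) and (1/3,2/3); it is an
   involution of the circle. *)
Definition swap t : R :=
  if t <= 1 / 3 then t else if t <= 2 / 3 then 3 * t - 2 / 3
  else if t <= 1 then t + 2 / 3 else (t + 4) / 3.
Definition swapV t : R :=
  if t <= 1 / 3 then t else if t <= 4 / 3 then (t + 2 / 3) / 3
  else if t <= 5 / 3 then t - 2 / 3 else 3 * t - 4.

Lemma swap_pieces : [/\ forall t, t <= 1 / 3 -> swap t = t, forall t, 1 / 3 <= t <= 2 / 3 -> swap t = 3 * t - 2 / 3,
  forall t, 2 / 3 <= t <= 1 -> swap t = t + 2 / 3 & forall t, 1 <= t -> swap t = (t + 4) / 3].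
Proof. by rewrite /swap; split=> t h; piecewise. Qed.

Lemma swap_end_fixing : end_fixing swap swapV.
Proof.
have [h0 h1 h2 h3] := swap_pieces.
have [g0 g1 g2 g3] : [/\ forall t, t <= 1 / 3 -> swapV t = t,
    forall t, 1 / 3 <= t <= 4 / 3 -> swapV t = (t + 2 / 3) / 3,
    forall t, 4 / 3 <= t <= 5 / 3 -> swapV t = t - 2 / 3 & forall t, 5 / 3 <= t -> swapV t = 3 * t - 4].
  by rewrite /swapV; split=> t h; piecewise.
split=> [t|t| | |].
- have [t0|t0] := leP t (1 / 3); first by rewrite h0 ?g0.
  have [t1|t1] := leP t (2 / 3); first by rewrite h1 ?g1; lra.
  by have [t2|t2] := leP t 1; [rewrite h2 ?g2|rewrite h3 ?g3]; lra.
- have [t0|t0] := leP t (1 / 3); first by rewrite g0 ?h0.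
  have [t1|t1] := leP t (4 / 3); first by rewrite g1 ?h1; lra.
  by have [t2|t2] := leP t (5 / 3); [rewrite g2 ?h2|rewrite g3 ?h3]; lra.
- apply: le_mono => s t st; rewrite /swap; case: (leP s (1 / 3)) => s1; case: (leP t (1 / 3)) => t1; try lra;
  case: (leP s (2 / 3)) => s2; try (exfalso; lra); case: (leP t (2 / 3)) => t2; try lra;
  by case: (leP s 1) => s3; try (exfalso; lra); case: (leP t 1) => t3; lra.
- by rewrite h0; lra.
- by rewrite h3; lra.
Qed.

(** The square of the lift is the translation by 2, so the inverse differs from the lift by a full
    turn and respects the leafs for the same reason. *)
Lemma swap_map : exists2 h : homeo (basilica R), tri_map h &
  forall t, 0 <= t <= 2 -> h (bq t) = bq (swap t + 2 / 3).
Proof.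
have [h0 h1 h2 h3] := swap_pieces; have ef := swap_end_fixing.
pose F t := periodize swap t + 2 / 3.
have FE t : 0 <= t <= 2 -> F t = swap t + 2 / 3 by move=> t02; rewrite /F (periodizeE ef).
have F2 t : F (t + 2) = F t + 2 by rewrite /F periodizeD2 addrAC.
have lF : lin_on 1 F.
  move=> j; rewrite expn1 => j6.
  have fE t : 0 <= t <= 1 -> F (tri 1 j + t / 3 ^+ 1) = swap ((j%:R + t) / 3) + 2 / 3.
    move=> t01; have : j%:R + 1 <= 6 :> R by rewrite natr1 ler_nat.
    have : 0 <= j%:R :> R by [].
    by move=> *; rewrite FE /tri expr1 ?mulrDl//; lra.
  have S t u : u = t \/ u = t - 2 -> to_circle t = to_circle u :> circle R.
    by move=> [->//|->]; have := to_circleD2 (t - 2) 1; rewrite mulr1z mulr1 subrK.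
  case: j j6 fE => [|[|[|[|[|[|//]]]]]] _ fE.
  - exists 1%N, 2%N; split=> // t t01; rewrite fE// h0; last lra.
    by apply: S; left; rewrite /tri; lra.
  - exists 0%N, 1%N; split=> // t t01; rewrite fE// h1; last lra.
    by apply: S; left; rewrite tri0 expr0; lra.
  - exists 1%N, 0%N; split=> // t t01; rewrite fE// h2; last lra.
    by apply: S; right; rewrite /tri; lra.
  - exists 2%N, 3%N; split=> // t t01; rewrite fE// h3; last lra.
    by apply: S; right; rewrite /tri; lra.
  - exists 2%N, 4%N; split=> // t t01; rewrite fE// h3; last lra.
    by apply: S; right; rewrite /tri; lra.
  - exists 2%N, 5%N; split=> // t t01; rewrite fE// h3; last lra.
    by apply: S; right; rewrite /tri; lra.
have D t u : u = t - 2 -> bq t = bq u by move=> ->; rewrite -{1}(subrK 2 t) bqD2.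
have low l : (lv l <= 1)%N -> bq (F (la l)) = bq (F (lb l)).
  move=> l1; have [a0 ab b2] := leaf_ltW l.
  rewrite !FE; [|lra|lra]; case lvE: (lv l) l1 => [|[|//]] _.
    have [-> ->] := root_ends lvE; rewrite !h3 ?ler1n//.
    rewrite (D _ (tri 1 (3 * 0 + 1))); last by rewrite /tri; lra.
    by rewrite bq_step; apply/esym/D; rewrite /tri; lra.
  have := leaf_code l; rewrite /la /lb lvE /is_code expn1 => c.
  have [->|->] : lk l = 0%N \/ lk l = 1%N by lia.
    rewrite !h1 /tri; [|lra|lra]; have := @bq_step R 0 0; rewrite !tri0.
    by move=> E; rewrite -[LHS]/(bq _); have := E; congr (bq _ = bq _); lra.
  rewrite !h3 /tri; [|lra|lra].
  rewrite (D _ (tri 2 (3 * 1 + 1))); last by rewrite /tri; lra.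
  by rewrite bq_step; apply/esym/D; rewrite /tri; lra.
have FB t : F (t - 2) = F t - 2 by rewrite -{2}(subrK 2 t) F2 addrK.
have Ffl t u : F (u + fl t) = F u + fl t.
  rewrite /F /periodize; have -> : fl (u + fl t) = fl u + fl t.
    rewrite (@fl_unique _ _ (Num.floor (u / 2) + Num.floor (t / 2))) intrD mulrDl -!/(fl _) //.
    by have := fl_itv u; lra.
  have -> : u + fl t - (fl u + fl t) = u - fl u by ring.
  by ring.
have FF02 t : 0 <= t <= 2 -> F (F t) = t + 2.
  move=> t02; rewrite [F t]FE//.
  have [t0|t0] := leP t (1 / 3); first by rewrite (h0 t)// FE ?h2; lra.
  have [t1|t1] := leP t (2 / 3); first by rewrite (h1 t) ?FE ?h3; lra.
  have [t2|t2] := leP t 1.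
    rewrite (h2 t); last lra.
    have -> : t + 2 / 3 + 2 / 3 = t - 2 / 3 + 2 by field.
    by rewrite F2 FE ?h0; lra.
  rewrite (h3 t) ?(ltW t2)//; have -> : (t + 4) / 3 + 2 / 3 = t / 3 + 2 by field.
  by rewrite F2 FE ?h1; lra.
have FF t : F (F t) = t + 2.
  have h := fl_itv t; rewrite -[in LHS](subrK (fl t) t) !Ffl FF02; lra.
have [||||h hT hE] := @lift_map R F (fun t => F t - 2) 1 _ _ _ F2 lF low.
- by move=> t; rewrite FF addrK.
- by move=> t; rewrite FB FF addrK.
- by move=> s t; rewrite /F lerD2r (periodize_mono ef).
- move=> s t st; have := lin_compat F2 lF low st.
  by rewrite -(D (F s) _ erefl) -(D (F t) _ erefl).
by exists h => // t t02; rewrite hE FE.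
Qed.

End LocalMaps.

(** * Density of the Thompson group *)

Section Density.
Context {R : realType}.
Implicit Types (t u v a b : R) (l m p q : @leaf R) (C : @cantorgon R)
  (K J : R * R) (I : set (R * R)) (D : set (set (circle R)))
  (n i j d : nat) (h f : homeo (basilica R)) (g k : cyc_aut (basilica_tree R)).

Definition supported n j h :=
  forall t, 0 <= t <= 2 -> ~ (tri n j < t < tri n j.+1) -> h (bq t) = bq t.

Lemma inside_level n j l : inside l (tri_itv n j) -> (n < lv l)%N.
Proof.
move=> /inside_tri lj; rewrite ltnNge; apply: contraTN lj => ln; rewrite /la.
have -> : n = (n - lv l + lv l)%N by rewrite subnK.
by rewrite (tri_lift (n - lv l) (lv l)) !lt_triE; lia.
Qed.

Lemma local_generator n j (f g : R -> R) m q : (j < 2 * 3 ^ n)%N -> cancel f g -> cancel g f ->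
  {mono f : s t / s <= t} -> unit_pl f -> unit_pl g ->
  scale n j f (la m) = la q ->
  exists h, [/\ tri_map h, supported n j h & h (pt m) = pt q].
Proof.
move=> jn fK gK mf uf ug mq; have [h hT hE] := local_map jn fK gK mf uf ug.
exists h; split=> // [t t02 tj|]; first by rewrite hE// scale_out//; case: uf.
by have [a0 ab b2] := leaf_ltW m; rewrite /pt hE ?mq//; lra.
Qed.

Lemma local_move n j m q : (j < 2 * 3 ^ n)%N -> lv m = n.+1 -> lk m = j ->
  inside q (tri_itv n j) -> (forall l, inside l (tri_itv n j) -> inl l (la q) = false) ->
  exists h, [/\ tri_map h, supported n j h & h (pt m) = pt q].
Proof.
have [d qd] : exists d, (lv q <= n + d)%N by exists (lv q); lia.
elim: d n j m q qd => [|d IH] n j m q qd jn mn mj qj qout.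
  by have := inside_level qj; lia.
have laE m' n' j' : lv m' = n'.+1 -> lk m' = j' -> la m' = tri (1 + n') (j' * 3 ^ 1 + 1).
  by rewrite /la => -> ->; rewrite expn1 mulnC.
have mid : inside m (tri_itv n j).
  by apply/inside_tri; rewrite (laE _ _ _ mn mj) [tri n j]triS [tri n j.+1]triS !lt_triE; lia.
have third i : (i < 3)%N -> (3 * j + i < 2 * 3 ^ n.+1)%N by rewrite expnS; lia.
have sub i l : (i < 3)%N -> inside l (tri_itv n.+1 (3 * j + i)) -> inside l (tri_itv n j).
  move=> i3 [h1 h2]; split; [apply: le_lt_trans h1|apply: lt_le_trans h2 _];
    by rewrite /= (triS n) le_triE; lia.
have supp i h : (i < 3)%N -> supported n.+1 (3 * j + i) h -> supported n j h.
  move=> i3 hs t t02 tj; apply: hs => // /andP[h1 h2]; apply: tj.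
  rewrite !(triS n); apply/andP; split; [apply: le_lt_trans h1|apply: lt_le_trans h2 _];
    by rewrite le_triE; lia.
have step i m' h : (i < 3)%N -> lv m' = n.+2 -> lk m' = (3 * j + i)%N ->
    [/\ tri_map h, supported n j h & h (pt m) = pt m'] ->
    inside q (tri_itv n.+1 (3 * j + i)) ->
    exists h, [/\ tri_map h, supported n j h & h (pt m) = pt q].
  move=> i3 m'n m'j [hT hs hm] qi.
  have [||h' [hT' hs' hm']] := IH n.+1 (3 * j + i)%N m' q _ (third i i3) m'n m'j qi.
  - by rewrite addSn -addnS.
  - by move=> l /(sub _ _ i3); exact: qout.
  exists (h' * h)%g; split; first exact: tri_mapM.
    by move=> t t02 tj /=; rewrite hs// (supp i).
  by rewrite /= hm.
have [[qn qk]|qi|qi|qi] := inside_thirds jn qj.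
- have -> : m = q by apply: leaf_code_inj; rewrite ?mn ?mj ?qn ?qk.
  by exists 1%g; split=> //; exact: tri_map1.
- have [m' [m'n m'j _ _]] := @mid_leaf_exists R _ _ (third 0%N isT); rewrite addn0 in m'j.
  have [|h hP] := @local_generator n j _ _ m m' jn x0VK x0K x0V_mono unit_pl_x0V unit_pl_x0.
    rewrite (laE _ _ _ mn mj) scale_tri (laE _ _ _ m'n m'j).
    have [_ e _ _] := @x0V_pieces R; rewrite e; last by rewrite /tri expr1; lra.
    by rewrite /tri !exprS !natrD !natrM; field; apply/lt0r_neq0/pow3_gt0.
  by apply: (step 0%N m' h) => //; rewrite addn0.
- have := qout _ mid; rewrite /inl.
  move: qi => [/= q1 q2]; have [_ qab _] := leaf_ltW q.
  have -> : la m = tri n.+1 (3 * j).+1 by rewrite (laE _ _ _ mn mj); congr tri; lia.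
  have -> : lb m = tri n.+1 (3 * j).+2 by rewrite /lb mn mj; congr tri; lia.
  by rewrite q1 (lt_trans qab q2).
- have [m' [m'n m'j _ _]] := @mid_leaf_exists R _ _ (third 2%N isT).
  have [|h hP] := @local_generator n j _ _ m m' jn x0K x0VK x0_mono unit_pl_x0 unit_pl_x0V.
    rewrite (laE _ _ _ mn mj) scale_tri (laE _ _ _ m'n m'j).
    have [_ _ _ e] := @x0_pieces R; rewrite e; last by rewrite /tri expr1; lra.
    by rewrite /tri !exprS !natrD !natrM; field; apply/lt0r_neq0/pow3_gt0.
  by apply: (step 2%N m' h) => //; rewrite addn2.
Qed.

Lemma aut_e_Pi h l m : h (pt l) = pt m -> aut_e (Pi h) l = m :> @leaf R.
Proof. by move=> hl; apply: pt_inj; rewrite -hl homeo_leafE. Qed.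

Lemma aut_eM g k l : aut_e (g * k)%g l = aut_e g (aut_e k l).
Proof. by []. Qed.

Lemma root_exists : exists r : @leaf R, lv r = 0%N.
Proof.
have c : is_code 0 0 by [].
by exists (mkleaf c); have [] := @mkleafE R _ _ c.
Qed.

Lemma root_side r l : lv r = 0%N -> l <> r ->
  inside l (tri_itv 0 0) /\ sd r l = false \/ inside l (tri_itv 0 1) /\ sd r l = true.
Proof.
move=> r0 lr; have [ra rb] := root_ends r0; have [a0 ab b2] := leaf_ltW l.
have l0 : (0 < lv l)%N.
  by case lvE: (lv l) => //; case: lr; apply: leaf_code_inj; rewrite ?r0 ?lvE//;
    have := leaf_code l; have := leaf_code r; rewrite /is_code r0 lvE; lia.
have := @tri_outside R 0 1 _ (lk l) l0; rewrite -/(la l) -/(lb l) tri0 => -[l1|l1]; [right|left];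
  rewrite /sd /inl ra rb /inside /= !tri0.
  have b2' : lb l != 2.
    by have [_ _ _] := la_neq lr; rewrite rb.
  have {b2}b2 : lb l < 2 by rewrite lt_neqAle b2'.
  by rewrite l1 b2 (lt_trans ab b2).
split=> //; apply/negbTE; rewrite negb_and -leNgt; apply/orP; left; lra.
Qed.

(** The map of [swap_map] carries the root to the middle leaf of [[0, 1]], the rotation carries that
    one to the middle leaf of [[1, 2]], and [local_move] goes on inside the interval. *)
Lemma root_unsep r l : lv r = 0%N -> unsep r l ->
  exists2 h, tri_map h & aut_e (Pi h) r = l.
Proof.
move=> r0 rl; have [->|lr] := pselect (l = r).
  exists 1%g; first exact: tri_map1.
  exact: aut_e_Pi.
have [ra rb] := root_ends r0; have [sw sT sE] := @swap_map R; have [ro rT rE] := @rotation_map R.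
have mv i : inside l (tri_itv 0 i) -> (i < 2)%N -> forall m, lv m = 1%N -> lk m = i ->
    exists2 h, tri_map h & h (pt m) = pt l.
  move=> li i2 m m1 mi; have [||h [hT _ hm]] := @local_move 0 i m l _ m1 mi li.
  - by rewrite expn0 muln1.
  - move=> q qi; have [->|ql] := pselect (q = l); first exact: inl_la.
    have [qr|qr] := pselect (q = r).
      by have := inside_level qi; rewrite qr r0.
    have := rl q qr ql; rewrite /sd => <-; rewrite ra /inl.
    apply/negbTE; rewrite negb_and -!leNgt; move: qi => [/=]; rewrite !tri0.
    have [_ qab _] := leaf_ltW q; case: i i2 {li mi} => [|[|//]] _ q1 q2; apply/orP.
      by right; lra.
    by left; lra.
  - by exists h.
have [m0 [m0v m0k m0a m0b]] := @mid_leaf_exists R 0 0 isT.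
have [m1 [m1v m1k m1a m1b]] := @mid_leaf_exists R 0 1 isT.
have sm0 : sw (pt r) = pt m0.
  have [_ _ _ h3] := @swap_pieces R.
  rewrite /pt ra sE; last lra.
  rewrite h3//; have -> : (1 + 4) / 3 + 2 / 3 = tri 1 1 + 2 :> R by rewrite /tri; lra.
  by rewrite bqD2 m0a.
case: (root_side r0 lr) => [[li _]|[li _]].
  have [h hT hm] := mv 0%N li isT m0 m0v m0k.
  exists (h * sw)%g; first exact: tri_mapM.
  by apply: aut_e_Pi; rewrite /= sm0.
have [h hT hm] := mv 1%N li isT m1 m1v m1k.
exists (h * (ro * sw))%g; first by apply: tri_mapM => //; exact: tri_mapM.
apply: aut_e_Pi; rewrite /= sm0 -hm; congr (h _).
by rewrite /pt rE m0a m1a; congr bq; rewrite /tri; lra.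
Qed.

(** Induction over the tree: if [h] carries the root to [p], its inverse carries a leaf sharing a
    Cantorgon with [p] to one unseparated from the root. *)
Lemma root_transitive r l : lv r = 0%N -> exists2 h, tri_map h & aut_e (Pi h) r = l.
Proof.
move=> r0; pose T l := exists2 h, tri_map h & aut_e (Pi h) r = l.
have base C p q : is_side p C -> is_side q C -> T p -> T q.
  move=> pC qC [h hT hr]; pose l' := aut_e (Pi h)^-1%g q.
  have rl : unsep r l'.
    have -> : r = aut_e (Pi h)^-1%g p by rewrite -hr aut_eKV.
    by apply: (@sides_unsep _ (aut_v (Pi h)^-1%g C)); apply/aut_side.
  have [h' hT' hl'] := root_unsep r0 rl.
  exists (h * h')%g; first exact: tri_mapM.
  by rewrite PiM aut_eM hl' aut_eVK'.
have Tr : T r by exists 1%g; [exact: tri_map1|exact: aut_e_Pi].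
have [C [rC _]] := side_exists_sg r true.
have : forall p, is_side p C -> T p -> T l; last by move=> /(_ r rC Tr).
clear rC; move: C l; apply: (@tree_ind R (fun C l => forall p, is_side p C -> T p -> T l)).
  by move=> C m mC p pC; exact: base pC mC.
by move=> C C' q m qC qC' _ _ _ IH p pC /(base _ _ _ pC qC); exact: IH.
Qed.

Lemma tri_map_plus h : tri_map h -> aut_plus (Pi h).
Proof. by move=> /tri_map_thompson/Pi_thompson. Qed.

(** [l] is replaced by the side of [C] towards it, and on the sides of [C] the cyclic order is
    preserved. *)
Lemma plus_between k p q l : aut_plus k -> p <> q -> unsep p q ->
  aut_e k p = p -> aut_e k q = q -> l <> p -> l <> q -> sd p l = sd p q -> sd q l = sd q p ->
  cyc (la p) (la (aut_e k l)) (la q) = cyc (la p) (la l) (la q).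
Proof.
move=> kP pq /(unsep_common pq)[C [pC qC _]] kp kq lp lq.
rewrite (side_sd qC pq) (side_sd pC (nesym pq)) => sp sq.
have kI := @aut_e_inj R k.
have [r [rC rp rq rl]] := towards_side pq pC qC lp lq sp sq.
pose C' := aut_v k C; have S m : is_side m C -> is_side (aut_e k m) C' by move/aut_side; apply.
have pC' : is_side p C' by rewrite -kp; exact: S.
have qC' : is_side q C' by rewrite -kq; exact: S.
have klp : aut_e k l <> p by rewrite -kp => /kI.
have klq : aut_e k l <> q by rewrite -kq => /kI.
have krp : aut_e k r <> p by rewrite -kp => /kI.
have krq : aut_e k r <> q by rewrite -kq => /kI.
have sp' : sd p (aut_e k l) = sg C' p by rewrite -kp; apply: aut_sdW => //; exact: nesym.
have sq' : sd q (aut_e k l) = sg C' q by rewrite -kq; apply: aut_sdW => //; exact: nesym.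
have rl' : aut_e k r = aut_e k l \/ aut_e k r <> aut_e k l /\ sd (aut_e k r) (aut_e k l) <> sg C' (aut_e k r).
  case: rl => [->|[rl rs]]; [by left|right; split; first by move/kI].
  by apply/eqP; rewrite aut_sd//; exact/eqP.
rewrite (towards_cyc pq pC qC lp lq rp rq rl) (towards_cyc pq pC' qC' klp klq krp krq rl').
have := kP C p r q pC rC qC; rewrite kp kq => E.
have e1 := side_cycP pC rC qC (nesym rp) rq pq.
have e2 := side_cycP pC' (S _ rC) qC' (nesym krp) krq pq.
by apply/idP/idP => [/e2/E/e1|/e1/E/e2].
Qed.

(** By [arc_pqP] an arc between fixed leafs is described by sides and cyclic order, both kept by
    [k]. A reversal of orientation could exchange the two arcs between [p] and [q]. *)
Lemma plus_inside n j k p q l : (j < 2 * 3 ^ n)%N -> aut_plus k ->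
  leaf_arc p q (tra n j) (tri n j.+1) -> p <> q -> aut_e k p = p -> aut_e k q = q ->
  inside (aut_e k l) (tri_itv n j) <-> inside l (tri_itv n j).
Proof.
move=> jn kP A pq kp kq; have pqU := arc_unsep A; have kI := @aut_e_inj R k.
have E m : inside m (tri_itv n j) <-> cyc (tra n j) (la m) (tri n j.+1).
  by rewrite inside_tri cyc_tra//; have [] := leaf_end_itv m.
apply: (iff_trans (E _)); apply: iff_sym; apply: (iff_trans (E _)).
have [->|lp] := pselect (l = p); first by rewrite kp.
have [->|lq] := pselect (l = q); first by rewrite kq.
have klp : aut_e k l <> p by rewrite -kp => /kI.
have klq : aut_e k l <> q by rewrite -kq => /kI.
rewrite (arc_pqP pq A lp lq) (arc_pqP pq A klp klq).
have [C [pC qC _]] := unsep_common pq pqU.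
have S p' q' : aut_e k p' = p' -> aut_e k q' = q' -> p' <> q' -> l <> p' -> is_side p' C -> is_side q' C ->
    (sd p' (aut_e k l) == sd p' q') = (sd p' l == sd p' q').
  move=> kp' kq' pq' lp' pC' qC'; rewrite (side_sd qC' pq') -(aut_sd k C (nesym lp')) kp'.
  congr (_ == _); have qkC : is_side q' (aut_v k C) by rewrite -kq'; exact/aut_side.
  by rewrite -(side_sd qkC pq') (side_sd qC' pq').
rewrite (S p q) ?(S q p)//; last exact: nesym.
case: eqP => // sp; case: eqP => //= sq.
by rewrite (plus_between kP pq pqU kp kq lp lq sp sq).
Qed.

End Density.

(** * Approximation of an automorphism along perfect diagrams *)

Section Approximation.
Context {R : realType}.
Implicit Types (t u v a b : R) (l m p q : @leaf R) (C : @cantorgon R)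
  (K J : R * R) (I : set (R * R)) (D : set (set (circle R)))
  (n i j d : nat) (h f : homeo (basilica R)) (g k : cyc_aut (basilica_tree R)).

(** [h] agrees with [g] at a leaf iff the discrepancy fixes it; replacing [h] by [h * f] multiplies
    it on the left by the inverse of [Pi f]. *)
Definition discrepancy h g : cyc_aut (basilica_tree R) := ((Pi h)^-1 * g)%g.

Lemma discrepancyM h f g l :
  aut_e (discrepancy (h * f)%g g) l = aut_e (Pi f)^-1%g (aut_e (discrepancy h g) l).
Proof. by rewrite /discrepancy PiM. Qed.

Lemma discrepancy_plus h g : tri_map h -> aut_plus g -> aut_plus (discrepancy h g).
Proof.
move=> /tri_map_plus hP gP; have [A1 AM] := @aut_plus_subgroup R.
have hV : aut_plus (Pi h)^-1%g by rewrite -[(_^-1)%g]mul1g; exact: AM.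
rewrite /discrepancy -[g]invgK; apply: (AM) => //.
by rewrite -[(g^-1)%g]mul1g; exact: AM.
Qed.

(** The fixed leaf [p <> m] prevents [k] from exchanging the sides of [m]. *)
Lemma aut_sd_fixed k m p l : aut_e k m = m -> aut_e k p = p -> m <> p ->
  sd m (aut_e k l) = sd m l.
Proof.
move=> km kp mp; have [->|lm] := pselect (l = m); first by rewrite km.
have [C [_ _]] := side_exists_sg m true.
have := aut_sd k C (nesym lm); have := aut_sd k C mp; rewrite km kp.
by move: (sg (aut_v k C) m) (sg C m) (sd m p) (sd m l) (sd m (aut_e k l)) => [] [] [] [] [].
Qed.

Lemma rotation_flips r : lv r = 0%N -> exists2 h, tri_map h &
  aut_e (Pi h) r = r /\ forall l, l <> r -> sd r (aut_e (Pi h) l) = ~~ sd r l.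
Proof.
move=> r0; have [h hT hE] := @rotation_map R; have [ra rb] := root_ends r0.
have hr : aut_e (Pi h) r = r.
  apply: aut_e_Pi; rewrite {1}/pt hE ra; apply: bq_end; right; rewrite rb; lra.
exists h => //; split=> // l lr; set m := aut_e (Pi h) l.
have mr : m <> r by rewrite -hr => /(@aut_e_inj R).
have mE : bq (la l + 1) = pt m by rewrite -hE /m /= -homeo_leafE.
have E t : bq t = pt m -> 0 < t <= 2 -> sd r m = inl r t.
  by move=> tm t02; apply/esym/sd_is_end; [exact: nesym|apply/bq_ptP].
have [a0 ab b2] := leaf_ltW l; rewrite /sd {2}/inl ra rb.
case: (root_side r0 lr) => [[[/= _ l1] _]|[[/= l1 _] _]]; rewrite !tri0 in l1.
  rewrite -/(sd r m) (E _ mE); last by lra.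
  by rewrite /inl ra rb; lra.
rewrite -/(sd r m) (E (la l - 1)); last by lra.
  by rewrite /inl ra rb; lra.
by rewrite -mE -bqD2; congr bq; lra.
Qed.

(** Once the root is fixed its two sides may still be exchanged; the rotation by 1, which fixes the
    root and exchanges its sides, then repairs this. *)
Lemma discrepancy_root r g : lv r = 0%N -> exists2 h, tri_map h &
  aut_e (discrepancy h g) r = r /\ forall l, l <> r -> sd r (aut_e (discrepancy h g) l) = sd r l.
Proof.
move=> r0; have [h hT hr] := root_transitive (aut_e g r) r0.
have kr : aut_e (discrepancy h g) r = r by rewrite /discrepancy aut_eM -hr aut_eKV.
have [C [_ _]] := side_exists_sg r true.
have kI := @aut_e_inj R (discrepancy h g).
have E l : l <> r -> _ := fun lr => @aut_sd R (discrepancy h g) C l r (nesym lr).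
rewrite kr in E; have [e|e] := eqVneq (sg (aut_v (discrepancy h g) C) r) (sg C r).
  exists h => //; split=> // l /E; rewrite e.
  by move: (sd r l) (sd r (aut_e (discrepancy h g) l)) (sg C r) => [] [] [].
have [f fT [fr fflip]] := rotation_flips r0.
exists (h * f)%g; first exact: tri_mapM.
split; first by rewrite discrepancyM kr -{1}fr aut_eKV.
move=> l lr; rewrite discrepancyM; have := E l lr.
set q := aut_e (discrepancy h g) l; have qr : q <> r by rewrite -kr => /kI.
pose q' := aut_e (Pi f)^-1%g q; have qE : q = aut_e (Pi f) q' by rewrite aut_eVK'.
have q'r : q' <> r by move=> q'r; apply: qr; rewrite qE q'r.
rewrite -/q' qE fflip//.
by move: e (sd r l) (sd r q'); case: (sg C r); case: (sg (aut_v (discrepancy h g) C) r) => // _ [] [].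
Qed.

Lemma density_start g : exists2 h, tri_map h &
  (forall l, [set [set to_circle 0; to_circle 1]] (leaf_ends l) -> aut_e (discrepancy h g) l = l) /\
  (forall K l, [set (0, 1); (1, 2)] K -> inside (aut_e (discrepancy h g) l) K <-> inside l K).
Proof.
have [r r0] := @root_exists R; have [h hT [kr kE]] := discrepancy_root g r0.
have [ra rb] := root_ends r0.
have t0 : tri_itv 0 0 = (0, 1) :> R * R by rewrite /tri_itv !tri0.
have t1 : tri_itv 0 1 = (1, 2) :> R * R by rewrite /tri_itv !tri0.
exists h => //; split=> [l|K l].
  move=> /(perfect_leafs (perfect_start R))[l' /leaf_eq <- lI].
  have [->|lr] := pselect (l = r); first by [].
  by case: (root_side r0 lr) => -[li _]; [case: (lI (0, 1))|case: (lI (1, 2))];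
    rewrite -?t0 -?t1//; [left|right].
have [->|lr] := pselect (l = r); first by rewrite kr.
have qr : aut_e (discrepancy h g) l <> r by rewrite -kr => /(@aut_e_inj R).
have S m : m <> r -> (inside m (0, 1) <-> sd r m = false) /\ (inside m (1, 2) <-> sd r m = true).
  move=> mr; have [m0 mb _] := leaf_ltW m.
  have := root_side r0 mr; rewrite t0 t1 /sd /inl ra rb => -[[[/= h1 h2] ->]|[[/= h1 h2] ->]].
    split; first by split.
    by split=> // -[/=]; lra.
  split; last by split.
  by split=> // -[/=]; lra.
have [S1 S2] := S _ lr; have [S1' S2'] := S _ qr.
move=> [->|->]; first by rewrite S1 S1' kE.
by rewrite S2 S2' kE.
Qed.

(** The invariant also says that the discrepancy preserves every interval, which confines the next
    move to one interval. The outer new thirds are bounded by [m] and an older leaf of the diagram,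
    so [plus_inside] applies; the middle one is the inner side of [m], treated by [aut_sd_fixed]. *)
Lemma density_step g D I : aut_plus g -> perfect_diagram D I -> exists2 h, tri_map h &
  (forall l, D (leaf_ends l) -> aut_e (discrepancy h g) l = l) /\
  (forall K l, I K -> inside (aut_e (discrepancy h g) l) K <-> inside l K).
Proof.
move=> gP; elim=> {D I} [|D I u v a b P [h hT [kD kI]] Iuv aE bE]; first exact: density_start.
set k := discrepancy h g in kD kI.
have [n nuv] := perfect_tri P Iuv.
have [j [jn uvE e1 e2 e3]] := is_tri_thirds nuv aE bE.
have [m [mn mj ma mb]] := @mid_leaf_exists R n j jn.
have [aE' bE'] : a = la m /\ b = lb m by case: e2 => -> ->; rewrite ma mb.
have mE : leaf_ends m = [set to_circle a; to_circle b] by rewrite (leaf_codeE m).2 aE' bE'.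
have [u0 uv v2] := is_tri_lt nuv; rewrite /= in u0 uv v2.
have mJ : inside m (u, v).
  by rewrite uvE; apply/inside_tri; rewrite ma triS [tri n j.+1]triS !lt_triE; lia.
have dis := perfect_disjoint P.
have [r r0] := @root_exists R.
have rI K : I K -> ~ inside r K.
  by move=> /(perfect_tri P)[n' [j' _ ->]] /inside_level; rewrite r0.
have kr : aut_e k r = r by apply: kD; apply/(perfect_leafs P); exists r.
have mr : m <> r by move=> e; apply: (rI _ Iuv); rewrite -e.
have rJ l : inside l (u, v) -> sd l r = false.
  move=> [/= l1 l2]; apply/negbTE/negP => /andP[r1 r2]; apply: (rI _ Iuv).
  by rewrite uvE; apply/inside_tri; case: uvE => <- <-; rewrite (lt_trans l1 r1)//= ; have [_ _ _] := leaf_ltW l; rewrite (lt_trans r2 l2).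
pose q := aut_e k m.
have qJ : inside q (u, v) by exact: (proj2 (kI (u, v) m Iuv)).
(* The preimage of [l] has at least the level of [m], so it does not separate [m] from the root;
   hence [l] does not separate [q] from the root, which is on its outer side. *)
have qout l : inside l (u, v) -> inl l (la q) = false.
  move=> lJ; have [->|lq] := pselect (l = q); first exact: inl_la.
  pose l0 := aut_e k^-1%g l; have lE : aut_e k l0 = l by rewrite aut_eVK'.
  have l0J : inside l0 (u, v) by apply: (proj1 (kI (u, v) l0 Iuv)); rewrite lE.
  have l0m : l0 <> m by move=> e; apply: lq; rewrite -lE e.
  have l0r : l0 <> r by move=> e; apply: (rI _ Iuv); rewrite -e.
  have s0 : sd l0 m = false.
    apply/negbTE/negP => /inl_level; rewrite mn ltnS leqNgt.
    by move: l0J; rewrite uvE => /inside_level ->.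
  have [C [_ _]] := side_exists_sg l0 true.
  have := aut_sd k C l0m; have := aut_sd k C l0r; rewrite kr lE s0 (rJ _ lJ) (rJ _ l0J) -/q /sd.
  by move: (sg (aut_v k C) l) (sg C l0) (inl l (la q)) => [] [] [].
rewrite uvE in qJ qout.
have [h1 [hT1 hs1 hm1]] := local_move jn mn mj qJ qout.
exists (h * h1)%g; first exact: tri_mapM.
set k' := discrepancy (h * h1)%g g.
have kE l : aut_e k' l = aut_e (Pi h1)^-1%g (aut_e k l) by exact: discrepancyM.
have k'P : aut_plus k' by apply: discrepancy_plus => //; exact: tri_mapM.
have fix1 l : ~ inside l (u, v) -> aut_e (Pi h1)^-1%g l = l.
  rewrite uvE inside_tri => lJ; have [a0 ab b2] := leaf_ltW l.
  have {1}<- : aut_e (Pi h1) l = l by apply: aut_e_Pi; apply: hs1 => //; lra.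
  by rewrite aut_eKV.
have fixK K l : I K -> K <> (u, v) -> inside (aut_e (Pi h1)^-1%g l) K <-> inside l K.
  move=> IK KJ; have no l' : inside l' K -> ~ inside l' (u, v).
    move=> [l1 l2] [/= l3 l4]; have [_ l'ab _] := leaf_ltW l'.
    by case: (dis _ _ IK Iuv KJ) => /=; lra.
  split=> lK; last by rewrite fix1//; exact: no.
  have := fix1 _ (no _ lK) => E; have := @aut_e_inj R (Pi h1)^-1%g _ _ E => E'.
  by rewrite -E'.
have k'm : aut_e k' m = m by rewrite kE -/q -{1}(aut_e_Pi hm1) aut_eKV.
have k'D l : D (leaf_ends l) -> aut_e k' l = l.
  move=> lD; rewrite kE kD// fix1//.
  by move: lD => /(perfect_leafs P)[l' /leaf_eq <-]; exact.
have k'r : aut_e k' r = r by apply: k'D; apply/(perfect_leafs P); exists r.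
(* A leaf ending at a boundary point of [(u, v)] belongs to the old diagram. The alternative [x = 2]
   is the coordinate of [u] when [u = 0]. *)
have endD p x : is_end p x -> x = u \/ x = v \/ x = 2 -> D (leaf_ends p).
  move=> px xE; apply/(perfect_leafs P); exists p => // K IK [p1 p2].
  have [_ pab _] := leaf_ltW p; have [n' /is_tri_lt[_ K12 K2]] := perfect_tri P IK.
  have xK : K.1 < x < K.2 by clear xE; case: px => ->; lra.
  have [KJ|KJ] := pselect (K = (u, v)).
    by move: xK K2; rewrite KJ /= => xK K2; case: xE => [|[|]] ?; lra.
  have := dis _ _ IK Iuv KJ => /= D12; clear -xK D12 K2 K12 uv v2 xE.
  by case: xE => [|[|]] ?; case: D12 => ?; lra.
have endm p x : is_end p x -> x = u \/ x = v \/ x = 2 -> p <> m.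
  move=> px xE pm; have /(perfect_leafs P)[m' /leaf_eq <- mI] := endD _ _ px xE.
  by apply: (mI _ Iuv); rewrite pm.
split=> [l [/k'D//|]|K l].
  by move=> /= lE; have -> : l = m by apply: leaf_eq; rewrite lE mE.
have j3 i : (i < 3)%N -> (3 * j + i < 2 * 3 ^ n.+1)%N by rewrite expnS; lia.
rewrite /= in e1 e3; case=> [[IK KJ]|[[->|->]|->]].
- by rewrite kE fixK//; exact: kI.
- have j0 := j3 0%N isT; rewrite addn0 in j0.
  have [p [q' A]] := tra_arc (R := R) j0; have [px q'x _ _] := A.
  have q'm : q' = m by apply: (is_end_inj q'x); left; rewrite ma.
  have xE : tra n.+1 (3 * j) = u \/ tra n.+1 (3 * j) = v \/ tra n.+1 (3 * j) = 2 :> R.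
    by rewrite /tra; case: eqP => _; [right; right|left; case: e1].
  rewrite e1; apply: (plus_inside _ j0 k'P A).
  + by rewrite q'm; exact: (endm _ _ px xE).
  + by apply: k'D; exact: (endD _ _ px xE).
  + by rewrite q'm.
- have E l' : inside l' (a, b) <-> sd m l' by rewrite e2 inside_tri -ma -mb.
  by apply: (iff_trans (E _)); apply: iff_sym; apply: (iff_trans (E _)); rewrite (aut_sd_fixed _ k'm k'r mr).
- have j2 := j3 2%N isT; rewrite addn2 in j2.
  have [q' [p A]] := tra_arc (R := R) j2; have [q'x px _ _] := A.
  have q'm : q' = m by apply: (is_end_inj q'x); right; rewrite mb.
  have xE : tri n.+1 (3 * j).+3 = u \/ tri n.+1 (3 * j).+3 = v \/ tri n.+1 (3 * j).+3 = 2 :> R.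
    by right; left; case: e3.
  rewrite e3; apply: (plus_inside _ j2 k'P A).
  + by rewrite q'm; exact/nesym/(endm _ _ px xE).
  + by rewrite q'm.
  + by apply: k'D; exact: (endD _ _ px xE).
Qed.

Lemma finite_level_bound (E : set (@leaf R)) : finite_set E -> exists n, forall l, E l -> (lv l <= n)%N.
Proof.
move=> /finite_seqP[s ->]; exists (\max_(l <- s) lv l) => l /= ls.
by rewrite (big_rem l ls)/= leq_maxl.
Qed.

(** A neighbourhood constrains finitely many leafs, and the diagram with all the intervals of level
    [n] contains every leaf of level at most [n]. *)
Lemma thompson_dense : @aut_plus (basilica_tree R) `<=` closure (@Pi R @` (@basilica_thompson R)).
Proof.
move=> g gP S /nbhs_autP[E /finite_level_bound[n nE] ES].
have [D P] := tiling_perfect (@level_tiling R n).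
have [h hT [kD _]] := density_step gP P.
exists (Pi h); split; first by exists h => //; exact: tri_map_thompson.
apply: ES => l lE; have /kD {1}<- : D (leaf_ends l).
  apply/(perfect_leafs P); exists l => // K [j _ ->] /inside_level.
  by rewrite ltnNge nE.
by rewrite /discrepancy aut_eM aut_eVK'.
Qed.

End Approximation.

Theorem theorem1 (R : realType) :
  exists Pi : homeo (basilica R) -> cyc_aut (basilica_tree R),
    [/\ (forall f g, Pi f = g <-> induces f g),
        topgroup_iso [set: homeo (basilica R)]
                     [set: cyc_aut (basilica_tree R)] Pi,
        topgroup_iso (@homeo_plus R) (@aut_plus (basilica_tree R)) Pi &
        Pi @` (@basilica_thompson R) `<=` @aut_plus (basilica_tree R) /\
        @aut_plus (basilica_tree R) `<=` closure (Pi @` (@basilica_thompson R))].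
Proof.
exists (@Pi R); split; [exact: Pi_induces|exact: Pi_iso_full|exact: Pi_iso_plus|split].
  by move=> _ [f fT <-]; exact: Pi_thompson.
exact: thompson_dense.
Qed.
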